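(* Let $M$ be a connected smooth manifold of dimension $n\ge3$ with a smooth symmetric affine connection $\Gamma$ and a smooth everywhere non-degenerate operator field $\mathbf A$ of type $(1,1)$, and consider the system $$\frac{\partial y^i}{\partial t}=\sum_{j=1}^nA^i_j\Big(\frac{\partial^2y^j}{\partial x^2}+\sum_{r,s=1}^n\Gamma^j_{rs}\frac{\partial y^r}{\partial x}\frac{\partial y^s}{\partial x}\Big),\quad i=1,\dots,n.$$ Suppose that the system belongs to the case of general position and that its algebra of point symmetries has the maximal dimension $\dim\mathcal G=\frac{n(n+1)}2$. Then (near every point of $M$) there is a point transformation $\tilde y^i=\tilde y^i(y^1,\dots,y^n)$, i.e. a change of local coordinates on $M$, bringing the system to the form (tildes omitted) $$\frac{\partial y^i}{\partial t}=a\,\frac{\partial^2y^i}{\partial x^2}+\sum_{r=1}^na\,\frac{\varepsilon_r}{f}\,\frac{\partial y^r}{\partial x}\Big(y^i\frac{\partial y^r}{\partial x}-2\,y^r\frac{\partial y^i}{\partial x}\Big),\quad i=1,\dots,n,$$ where $a=\mathrm{const}$, $\varepsilon_1=\pm1,\dots,\varepsilon_n=\pm1$, and $$f=\frac1{2(n-1)}+\frac12\sum_{i=1}^n\varepsilon_i\,(y^i)^2 .$$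
   Context: The coefficients $A^i_j$, $\Gamma^j_{rs}=\Gamma^j_{sr}$ are functions of $y^1,\dots,y^n$ only; the $y^i$ are local coordinates on $M$, and under change of coordinates $A^i_j$ transform as a $(1,1)$ tensor and $\Gamma^j_{rs}$ as an affine connection. Point symmetries: a vector field $\boldsymbol\eta=\sum_i\eta^i(y)\,\partial/\partial y^i$ on $M$ whose local flow carries solutions to solutions ($x,t$ unchanged); this is expressed by the determining equations, which (for non-degenerate $\mathbf A$) read: $L_{\boldsymbol\eta}\mathbf A=0$ and $$\sum_k\frac{\partial\eta^i}{\partial y^k}\Gamma^k_{rs}=\frac{\partial^2\eta^i}{\partial y^r\partial y^s}+\sum_k\Big(\frac{\partial\Gamma^i_{rs}}{\partial y^k}\eta^k+\Gamma^i_{ks}\frac{\partial\eta^k}{\partial y^r}+\Gamma^i_{rk}\frac{\partial\eta^k}{\partial y^s}\Big)$$ (i.e. $\boldsymbol\eta$ is an infinitesimal affine transformation of $\Gamma$). $\mathcal G$ is the real Lie algebra of all point symmetries on $M$. Curvature: $R^i_{srk}=\frac{\partial\Gamma^i_{ks}}{\partial y^r}-\frac{\partial\Gamma^i_{rs}}{\partial y^k}+\sum_q(\Gamma^q_{ks}\Gamma^i_{rq}-\Gamma^q_{rs}\Gamma^i_{kq})$. Ricci tensor: $R_{ij}=\sum_kR^k_{ikj}$, with symmetric part $\hat R_{ij}=\frac12(R_{ij}+R_{ji})$. The system belongs to the case of general position if $n\ge 2$ and the matrix $(\hat R_{ij})$ is non-degenerate (rank $n$) everywhere on $M$. *)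

(* Defs.v *)
From HB Require Import structures.
From mathcomp Require Import all_boot all_order all_algebra.
From mathcomp Require Import all_classical all_reals all_analysis.
Set Implicit Arguments. Unset Strict Implicit. Unset Printing Implicit Defensive.
Import Order.TTheory GRing.Theory Num.Theory.
Import numFieldNormedType.Exports.
Local Open Scope classical_set_scope.
Local Open Scope ring_scope.

(** * Smooth functions on open subsets of R^n *)

(* Coordinates are numbered by 'I_n, i.e. from 0 to n - 1. *)
Definition partial (R : realType) (n : nat) (i : 'I_n) (f : 'rV[R]_n -> R)
  (y : 'rV[R]_n) : R := 'D_(delta_mx 0 i) f y.

Fixpoint Ck (R : realType) (n k : nat) (U : set 'rV[R]_n)
    (f : 'rV[R]_n -> R) : Prop :=
  (forall y, U y -> {for y, continuous f}) /\
  if k is k'.+1 then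
    forall i : 'I_n, (forall y, U y -> derivable f y (delta_mx 0 i)) /\
                     Ck k' U (partial i f)
  else True.

Definition smooth (R : realType) (n : nat) (U : set 'rV[R]_n)
  (f : 'rV[R]_n -> R) : Prop := forall k, Ck k U f.

(** * Smooth manifolds *)

(* [chart_map] and [chart_inv] are total functions; only their values on
   [chart_dom] and on its image are meaningful. *)
Record chart (R : realType) (n : nat) (T : topologicalType) := Chart {
  chart_dom : set T ;
  chart_map : T -> 'rV[R]_n ;
  chart_inv : 'rV[R]_n -> T ;
  chart_dom_open : open chart_dom ;
  chart_img_open : open (chart_map @` chart_dom) ;
  chart_mapK : forall p, chart_dom p -> chart_inv (chart_map p) = p ;
  chart_map_continuous :
    forall p, chart_dom p -> {for p, continuous chart_map} ;
  chart_inv_continuous :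
    forall y, (chart_map @` chart_dom) y -> {for y, continuous chart_inv} }.

Definition chart_img (R : realType) (n : nat) (T : topologicalType)
  (c : chart R n T) : set 'rV[R]_n := chart_map c @` chart_dom c.

Definition overlap (R : realType) (n : nat) (T : topologicalType)
  (c c' : chart R n T) : set 'rV[R]_n :=
  [set y | chart_img c y /\ chart_dom c' (chart_inv c y)].

Definition transition (R : realType) (n : nat) (T : topologicalType)
  (c c' : chart R n T) (y : 'rV[R]_n) : 'rV[R]_n :=
  chart_map c' (chart_inv c y).

Definition compatible (R : realType) (n : nat) (T : topologicalType)
  (c c' : chart R n T) : Prop := forall i : 'I_n,
  smooth (overlap c c') (fun y => transition c c' y 0 i) /\
  smooth (overlap c' c) (fun y => transition c' c y 0 i).

(* The smooth structure is given by its maximal atlas, so the local coordinate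
   systems on the manifold are exactly the members of [atlas]. *)
Record smooth_manifold (R : realType) (n : nat) := SmoothManifold {
  carrier :> topologicalType ;
  atlas : set (chart R n carrier) ;
  manifold_hausdorff : hausdorff_space carrier ;
  manifold_second_countable : @second_countable carrier ;
  atlas_cover : forall p, exists2 c, atlas c & chart_dom c p ;
  atlas_compatible : forall c c', atlas c -> atlas c' -> compatible c c' ;
  atlas_maximal :
    forall c, (forall c', atlas c' -> compatible c c') -> atlas c }.

(** * Fields of geometric objects, given by components in every chart *)

(* The components in the chart c are functions of the coordinates
   y \in chart_img c. Charts outside the atlas and points outside [chart_img c]
   carry irrelevant values. *)

(* eta c y 0 i = eta^i(y) *)
Definition vector_comps (R : realType) (n : nat) (M : smooth_manifold R n) :=
  chart R n M -> 'rV[R]_n -> 'rV[R]_n.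
(* A c y i j = A^i_j(y) *)
Definition operator_comps (R : realType) (n : nat) (M : smooth_manifold R n) :=
  chart R n M -> 'rV[R]_n -> 'M[R]_n.
(* Gam c y i r s = Gamma^i_{rs}(y) *)
Definition connection_comps (R : realType) (n : nat)
  (M : smooth_manifold R n) :=
  chart R n M -> 'rV[R]_n -> 'I_n -> 'I_n -> 'I_n -> R.

(* With y the coordinates of c and y' those of c', the derivative of y'^i with
   respect to y^k, at y. *)
Definition dtrans (R : realType) (n : nat) (M : smooth_manifold R n)
  (c c' : chart R n M) (i k : 'I_n) (y : 'rV[R]_n) : R :=
  partial k (fun z => transition c c' z 0 i) y.

Definition vector_field (R : realType) (n : nat) (M : smooth_manifold R n)
    (eta : vector_comps M) : Prop :=
  (forall c, atlas c -> forall i : 'I_n,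
     smooth (chart_img c) (fun y => eta c y 0 i)) /\
  (forall c c', atlas c -> atlas c' -> forall y, overlap c c' y ->
     forall i : 'I_n, eta c' (transition c c' y) 0 i =
       \sum_(k < n) dtrans c c' i k y * eta c y 0 k).

Definition operator_field (R : realType) (n : nat) (M : smooth_manifold R n)
    (A : operator_comps M) : Prop :=
  (forall c, atlas c -> forall i j : 'I_n,
     smooth (chart_img c) (fun y => A c y i j)) /\
  (forall c c', atlas c -> atlas c' -> forall y, overlap c c' y ->
     forall i j : 'I_n, A c' (transition c c' y) i j =
       \sum_(k < n) \sum_(l < n)
         dtrans c c' i k y * A c y k l * dtrans c' c l j (transition c c' y)).

Definition affine_connection (R : realType) (n : nat)
    (M : smooth_manifold R n) (Gam : connection_comps M) : Prop :=
  (forall c, atlas c -> forall i r s : 'I_n,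
     smooth (chart_img c) (fun y => Gam c y i r s)) /\
  (forall c c', atlas c -> atlas c' -> forall y, overlap c c' y ->
     let y' := transition c c' y in
     forall i r s : 'I_n, Gam c' y' i r s =
       \sum_(k < n) dtrans c c' i k y *
         (\sum_(p < n) \sum_(q < n)
            Gam c y k p q * dtrans c' c p r y' * dtrans c' c q s y'
          + partial r (dtrans c' c k s) y')).

Definition symmetric_connection (R : realType) (n : nat)
  (M : smooth_manifold R n) (Gam : connection_comps M) : Prop :=
  forall c, atlas c -> forall y, chart_img c y ->
  forall i r s : 'I_n, Gam c y i r s = Gam c y i s r.

Definition nondegenerate_operator (R : realType) (n : nat)
  (M : smooth_manifold R n) (A : operator_comps M) : Prop :=
  forall c, atlas c -> forall y, chart_img c y -> A c y \in unitmx.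

(** * Curvature and the case of general position *)

(* curvature Gam c y i s r k = R^i_{srk}(y) *)
Definition curvature (R : realType) (n : nat) (M : smooth_manifold R n)
  (Gam : connection_comps M) (c : chart R n M) (y : 'rV[R]_n)
  (i s r k : 'I_n) : R :=
  partial r (fun z => Gam c z i k s) y - partial k (fun z => Gam c z i r s) y
  + \sum_(q < n) (Gam c y q k s * Gam c y i r q - Gam c y q r s * Gam c y i k q).

Definition ricci (R : realType) (n : nat) (M : smooth_manifold R n)
  (Gam : connection_comps M) (c : chart R n M) (y : 'rV[R]_n) : 'M[R]_n :=
  \matrix_(i, j) \sum_(k < n) curvature Gam c y k i k j.

Definition sym_ricci (R : realType) (n : nat) (M : smooth_manifold R n)
  (Gam : connection_comps M) (c : chart R n M) (y : 'rV[R]_n) : 'M[R]_n :=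
  \matrix_(i, j) (2^-1 * (ricci Gam c y i j + ricci Gam c y j i)).

Definition general_position (R : realType) (n : nat) (M : smooth_manifold R n)
  (Gam : connection_comps M) : Prop :=
  (2 <= n)%N /\
  forall c, atlas c -> forall y, chart_img c y -> sym_ricci Gam c y \in unitmx.

(** * Point symmetries *)

Definition lie_operator (R : realType) (n : nat) (M : smooth_manifold R n)
  (eta : vector_comps M) (A : operator_comps M) (c : chart R n M)
  (y : 'rV[R]_n) (i j : 'I_n) : R :=
  \sum_(k < n) (eta c y 0 k * partial k (fun z => A c z i j) y
                - A c y k j * partial k (fun z => eta c z 0 i) y
                + A c y i k * partial j (fun z => eta c z 0 k) y).

Definition affine_symmetry (R : realType) (n : nat) (M : smooth_manifold R n)
  (eta : vector_comps M) (Gam : connection_comps M) (c : chart R n M)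
  (y : 'rV[R]_n) (i r s : 'I_n) : Prop :=
  let d (k l : 'I_n) := partial l (fun z => eta c z 0 k) in
  \sum_(k < n) d i k y * Gam c y k r s =
  partial r (d i s) y
  + \sum_(k < n) (partial k (fun z => Gam c z i r s) y * eta c y 0 k
                  + Gam c y i k s * d k r y + Gam c y i r k * d k s y).

Definition point_symmetry (R : realType) (n : nat) (M : smooth_manifold R n)
  (A : operator_comps M) (Gam : connection_comps M) (eta : vector_comps M)
  : Prop :=
  vector_field eta /\
  forall c, atlas c -> forall y, chart_img c y ->
    (forall i j : 'I_n, lie_operator eta A c y i j = 0) /\
    (forall i r s : 'I_n, affine_symmetry eta Gam c y i r s).

(* [eta] is the combination of the fields [e k] with constant coefficients
   [lam k]; equality of fields ignores the irrelevant values. *)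
Definition is_lincomb (R : realType) (n d : nat) (M : smooth_manifold R n)
  (lam : 'I_d -> R) (e : 'I_d -> vector_comps M) (eta : vector_comps M)
  : Prop :=
  forall c, atlas c -> forall y, chart_img c y ->
    eta c y = \sum_(k < d) lam k *: e k c y.

(* The real vector space of vector fields satisfying G has a basis of d
   elements. *)
Definition has_dim (R : realType) (n : nat) (M : smooth_manifold R n)
  (G : set (vector_comps M)) (d : nat) : Prop :=
  exists e : 'I_d -> vector_comps M,
    [/\ (forall k, G (e k)),
        (forall lam : 'I_d -> R, is_lincomb lam e (fun _ _ => 0) ->
           forall k, lam k = 0) &
        (forall eta, G eta -> exists lam : 'I_d -> R, is_lincomb lam e eta)].

(** * The systems, as relations between y, y_t, y_x and y_xx *)

Definition evolution_system (R : realType) (n : nat) (A : 'M[R]_n)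
  (Gam : 'I_n -> 'I_n -> 'I_n -> R) (yt yx yxx : 'rV[R]_n) : Prop :=
  forall i : 'I_n, yt 0 i =
    \sum_(j < n) A i j *
      (yxx 0 j + \sum_(r < n) \sum_(s < n) Gam j r s * yx 0 r * yx 0 s).

Definition normal_f (R : realType) (n : nat) (eps : 'I_n -> R)
  (y : 'rV[R]_n) : R :=
  (2 * (n%:R - 1))^-1 + 2^-1 * \sum_(i < n) eps i * y 0 i ^+ 2.

Definition normal_system (R : realType) (n : nat) (a : R) (eps : 'I_n -> R)
  (y yt yx yxx : 'rV[R]_n) : Prop :=
  forall i : 'I_n, yt 0 i =
    a * yxx 0 i +
    \sum_(r < n) a * (eps r / normal_f eps y) * yx 0 r *
                 (y 0 i * yx 0 r - 2 * y 0 r * yx 0 i).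

(* Main.v *)
(* The flow of a point symmetry preserves the connection, hence also its
   curvature and the symmetrized Ricci tensor g, and a symmetry is determined by
   its 1-jet at a point. The 1-jets preserving g at a given point form a space of
   dimension n(n+1)/2, so in the case of maximal dimension all of them come from
   symmetries. In particular every element of so(g) is the linear part of a
   symmetry vanishing at the point. Invariance under these isotropies forces A to
   be scalar, g to be parallel and the curvature to be constant, equal to
   1/(n-1) with respect to g; transitivity makes A constant.
   Coordinates are then found without Frobenius' theorem: Killing fields are the
   skew parallel endomorphisms of the cone bundle TM + R, and products of those
   extend every endomorphism of a fibre, so this bundle has a parallel frame. The
   components of the radial section in this frame immerse M into a quadric of
   R^(n+1), and stereographic projection gives the normal form. *)
Require Import Defs.
From HB Require Import structures.
From mathcomp Require Import all_boot all_order all_algebra.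
From mathcomp Require Import all_classical all_reals all_analysis.
From mathcomp Require Import lra ring.
Set Implicit Arguments. Unset Strict Implicit. Unset Printing Implicit Defensive.
Import Order.TTheory GRing.Theory Num.Theory.
Import numFieldNormedType.Exports.
Local Open Scope classical_set_scope.
Local Open Scope ring_scope.

(** * Functions of class C^k *)

(** Existence of fields and frames is drawn only from the symmetries given by the dimension
    hypothesis; differential equations contribute uniqueness alone, through a Gronwall estimate.
    Independence of the basis is global, whereas the count of 1-jets is made at a point, so a
    combination vanishing on a small ball must be shown to vanish on all of [M]; this is where
    connectedness enters. The bound n >= 3 acts through the presence of a third index: in dimension
    two so(g) is commutative and commutes with non-scalar operators. The constant 1/(n-1) comes from
    g being a Ricci tensor itself: curvature kappa gives the Ricci tensor kappa (n-1) g, which has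
    to be g. Hence G = g/(n-1) has curvature one, the value at which the connection on TM + R is
    flat, and the stereographic scale c with c^2 = 1/(n-1) yields the constant term 1/(2(n-1)) of f.
    Symmetries give parallel endomorphisms of the cone but no parallel sections. The frame is
    recovered from endomorphisms of rank one, normalized by a square root. *)

Section IsDerive.
Context (R : realType) (V : normedModType R).
Implicit Types (f g : V -> R) (x v : V) (a b : R).

Lemma is_derive_add f g x v a b : is_derive x v f a -> is_derive x v g b ->
  is_derive x v (fun y => f y + g y) (a + b).
Proof. by move=> *; exact: is_deriveD. Qed.

Lemma is_derive_opp f x v a : is_derive x v f a ->
  is_derive x v (fun y => - f y) (- a).
Proof. by move=> *; exact: is_deriveN. Qed.

Lemma is_derive_mul f g x v a b : is_derive x v f a -> is_derive x v g b ->
  is_derive x v (fun y => f y * g y) (a * g x + f x * b).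
Proof.
by move=> fa gb; apply: is_derive_eq (is_deriveM fa gb) _; rewrite addrC mulrC.
Qed.

Lemma is_derive_bigsum (I : Type) (r : seq I) (P : pred I) (F : I -> V -> R)
    x v (a : I -> R) : (forall i, P i -> is_derive x v (F i) (a i)) ->
  is_derive x v (fun y => \sum_(i <- r | P i) F i y) (\sum_(i <- r | P i) a i).
Proof.
move=> Fa; elim: r => [|i r IH].
  rewrite big_nil (_ : (fun _ => _) = cst 0); first exact: is_derive_cst.
  by apply/funext => y; rewrite big_nil.
rewrite big_cons; case: ifPn => Pi.
  rewrite (_ : (fun _ => _) = (fun y => F i y + \sum_(j <- r | P j) F j y)).
    by apply: is_derive_add => //; exact: Fa.
  by apply/funext => y; rewrite big_cons Pi.
rewrite (_ : (fun _ => _) = (fun y => \sum_(j <- r | P j) F j y)) //.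
by apply/funext => y; rewrite big_cons (negbTE Pi).
Qed.

Lemma is_derive_inv f x v a : f x != 0 -> is_derive x v f a ->
  is_derive x v (fun y => (f y)^-1) (- (f x ^- 2 * a)).
Proof.
move=> fx0 [df <-]; split; first exact: derivableV.
by rewrite deriveV// scaleNr.
Qed.

(** Derivability in one direction does not make [f] continuous at [x], but it does along the line,
    and the limits of difference quotients below need no more. *)
Lemma derivable_line_continuous f x v : derivable f x v ->
  f (h *: v + x) @[h --> 0^'] --> f x.
Proof.
move=> /derivable1P/derivable1_diffP/differentiable_continuous H.
have {H} : f (h *: v + x) @[h --> 0] --> f (0 *: v + x) by exact: H.
rewrite scale0r add0r => fx.
by apply: cvg_trans fx; apply: cvg_app; exact: nbhs_dnbhs.
Qed.

Lemma is_derive_sqrt f x v a : 0 < f x -> is_derive x v f a ->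
  is_derive x v (fun y => Num.sqrt (f y)) (a / (2 * Num.sqrt (f x))).
Proof.
move=> fx0 [df <-].
have sfx : 0 < Num.sqrt (f x) by rewrite sqrtr_gt0.
suff H : h^-1 *: (Num.sqrt (f (h *: v + x)) - Num.sqrt (f x)) @[h --> 0^'] -->
    'D_v f x / (2 * Num.sqrt (f x)).
  by split; [apply/cvg_ex; exists ('D_v f x / (2 * Num.sqrt (f x)))|
    exact/cvg_lim].
have fl := derivable_line_continuous df.
(* The rationalized quotient: a difference of roots is the difference of the radicands divided by
   the sum of the roots. *)
have H : (h^-1 *: (f (h *: v + x) - f x)) *
   (Num.sqrt (f (h *: v + x)) + Num.sqrt (f x))^-1 @[h --> 0^'] -->
   'D_v f x / (2 * Num.sqrt (f x)).
  apply: cvgM; first exact: df.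
  rewrite mulr2n mulrDl !mul1r.
  apply: cvgV; first by rewrite gt_eqF// addr_gt0.
  apply: cvgD; last exact: cvg_cst.
  by apply: continuous_cvg => //; exact: sqrt_continuous.
apply: cvg_trans H; apply: near_eq_cvg; near=> h.
have fh0 : 0 < f (h *: v + x) by near: h; exact: (cvgr_gt _ fl).
have sh : 0 < Num.sqrt (f (h *: v + x)) by rewrite sqrtr_gt0.
rewrite -scalerAl; congr (_ *: _).
rewrite -{1}(sqr_sqrtr (ltW fh0)) -{1}(sqr_sqrtr (ltW fx0)) subr_sqr mulfK//.
by rewrite gt_eqF// addr_gt0.
Unshelve. all: by end_near. Qed.

End IsDerive.

Section Ck.
Context (R : realType) (n : nat).
Implicit Types (U : set 'rV[R]_n) (f g : 'rV[R]_n -> R) (y v : 'rV[R]_n).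

Lemma is_derive_partial f y i a :
  is_derive y (delta_mx 0 i) f a -> partial i f y = a.
Proof. by case. Qed.

Lemma partial_near f g y i : (\near y, f y = g y) ->
  partial i f y = partial i g y.
Proof. exact: near_eq_derive. Qed.

Lemma near_open U y (P : 'rV[R]_n -> Prop) : open U -> U y ->
  (forall z, U z -> P z) -> \near y, P y.
Proof. by move=> oU Uy UP; apply: filterS (open_nbhs_nbhs (conj oU Uy)). Qed.

Lemma continuous_near f g y : (\near y, f y = g y) ->
  {for y, continuous f} -> {for y, continuous g}.
Proof.
move=> fg H.
have {H} : f z @[z --> y] --> f y by exact: H.
rewrite (nbhs_singleton fg) => H; apply: cvg_trans H.
exact: (@near_eq_cvg _ _ (nbhs y) _ f g fg).
Qed.

Lemma continuous_const y (c : R) : {for y, continuous (fun _ : 'rV[R]_n => c)}.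
Proof. exact: (@cst_continuous 'rV[R]_n R c). Qed.

Lemma continuous_add f g y : {for y, continuous f} -> {for y, continuous g} ->
  {for y, continuous (fun z => f z + g z)}.
Proof. by move=> fc gc; exact: (continuousD fc gc). Qed.

Lemma continuous_mul f g y : {for y, continuous f} -> {for y, continuous g} ->
  {for y, continuous (fun z => f z * g z)}.
Proof. by move=> fc gc; exact: (continuousM fc gc). Qed.

Lemma continuous_inv f y : f y != 0 -> {for y, continuous f} ->
  {for y, continuous (fun z => (f z)^-1)}.
Proof. by move=> f0 fc; exact: (continuousV f0 fc). Qed.

Lemma partial_open U f g y i : open U -> U y -> (forall z, U z -> f z = g z) ->
  partial i f y = partial i g y.
Proof.
move=> oU Uy fg; apply: partial_near.
exact: (near_open oU Uy fg).
Qed.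

Lemma Ck_is_derive k U f y i : Ck k.+1 U f -> U y ->
  is_derive y (delta_mx 0 i) f (partial i f y).
Proof. by case=> _ /(_ i) [df _] Uy; apply/derivableP/df. Qed.

Lemma Ck_continuous k U f y : Ck k U f -> U y -> {for y, continuous f}.
Proof. by case: k => [[]|k []] fc _ Uy; exact: fc. Qed.

Lemma Ck_partial k U f i : Ck k.+1 U f -> Ck k U (partial i f).
Proof. by case=> _ /(_ i) []. Qed.

Lemma CkS k U f : Ck k.+1 U f -> Ck k U f.
Proof.
elim: k f => [|k IH] f; first by case.
case=> fc fd; split=> // i; have [df dk] := fd i.
by split=> //; exact: IH.
Qed.

Lemma Ck_leq k k' U f : (k <= k')%N -> Ck k' U f -> Ck k U f.
Proof.
move=> /subnK <-; elim: (k' - k)%N => [//|j IH] fk.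
by apply: IH; apply: CkS.
Qed.

Lemma Ck_ext k U f g : open U -> (forall y, U y -> f y = g y) ->
  Ck k U f -> Ck k U g.
Proof.
move=> oU; elim: k f g => [|k IH] f g fg [fc fd].
  by split=> // y Uy; apply: continuous_near (fc y Uy); exact: near_open Uy fg.
have nfg y : U y -> \near y, f y = g y.
  by move=> Uy; exact: (near_open oU Uy fg).
split.
  by move=> y Uy; apply: continuous_near (fc y Uy); exact: nfg.
move=> i; have [df dk] := fd i; split.
  by move=> y Uy; apply: (near_eq_derivable (nfg y Uy)); exact: df.
by apply: IH dk => y Uy; exact: partial_open Uy _.
Qed.

Lemma Ck_subset k U U' f : U' `<=` U -> Ck k U f -> Ck k U' f.
Proof.
move=> U'U; elim: k f => [|k IH] f [fc fd].
  by split=> // y /U'U Uy; exact: fc.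
split=> [y /U'U Uy|i]; first exact: fc.
by have [df dk] := fd i; split=> [y /U'U|]; [exact: df|exact: IH].
Qed.

(** [Ck] speaks of the total function [partial i f]; this lets a formula that is correct on [U] only
    take its place. *)
Lemma Ck_intro k U f (df : 'I_n -> 'rV[R]_n -> R) : open U ->
  (forall y, U y -> {for y, continuous f}) ->
  (forall i y, U y -> is_derive y (delta_mx 0 i) f (df i y)) ->
  (forall i, Ck k U (df i)) -> Ck k.+1 U f.
Proof.
move=> oU fc dfi dk; split=> // i; split=> [y /(dfi i)[]//|].
by apply: Ck_ext (dk i) => // y /(dfi i)[].
Qed.

Lemma Ck_cst k U (c : R) : Ck k U (fun=> c).
Proof.
elim: k c => [|k IH] c; first by split=> // y _; exact: continuous_const.
split=> [y _|i]; first exact: continuous_const.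
split=> [y _|]; first exact: derivable_cst.
suff -> : partial i (fun=> c) = fun=> 0 by exact: IH.
by apply/funext => y; exact: derive_cst.
Qed.

Lemma CkD k U f g : open U -> Ck k U f -> Ck k U g ->
  Ck k U (fun y => f y + g y).
Proof.
move=> oU; elim: k f g => [|k IH] f g fk gk.
  by split=> // y Uy; apply: continuous_add; [exact: (Ck_continuous fk)|exact: (Ck_continuous gk)].
apply: (@Ck_intro k U _ (fun i y => partial i f y + partial i g y)) => //.
- by move=> y Uy; apply: continuous_add; [exact: (Ck_continuous fk)|exact: (Ck_continuous gk)].
- by move=> i y Uy; apply: is_derive_add;
  [exact: (Ck_is_derive i fk)|exact: (Ck_is_derive i gk)].
- by move=> i; apply: IH; exact: Ck_partial.
Qed.

Lemma CkM k U f g : open U -> Ck k U f -> Ck k U g ->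
  Ck k U (fun y => f y * g y).
Proof.
move=> oU; elim: k f g => [|k IH] f g fk gk.
  by split=> // y Uy; apply: continuous_mul; [exact: (Ck_continuous fk)|exact: (Ck_continuous gk)].
apply: (@Ck_intro k U _ (fun i y => partial i f y * g y + f y * partial i g y)) => //.
- by move=> y Uy; apply: continuous_mul; [exact: (Ck_continuous fk)|exact: (Ck_continuous gk)].
- by move=> i y Uy; apply: is_derive_mul;
  [exact: (Ck_is_derive i fk)|exact: (Ck_is_derive i gk)].
- move=> i; apply: CkD => //; apply: IH; do ? exact: Ck_partial; exact: CkS.
Qed.

Lemma CkN k U f : open U -> Ck k U f -> Ck k U (fun y => - f y).
Proof.
move=> oU fk; apply: Ck_ext (CkM oU (Ck_cst k U (-1)) fk) => // y _.
by rewrite mulN1r.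
Qed.

Lemma CkB k U f g : open U -> Ck k U f -> Ck k U g ->
  Ck k U (fun y => f y - g y).
Proof. by move=> oU fk gk; apply: CkD => //; exact: CkN. Qed.

Lemma Ck_sum k U (I : Type) (r : seq I) (P : pred I) (F : I -> 'rV[R]_n -> R) :
  open U -> (forall i, P i -> Ck k U (F i)) ->
  Ck k U (fun y => \sum_(i <- r | P i) F i y).
Proof.
move=> oU Fk; elim: r => [|i r IH].
  by apply: Ck_ext (Ck_cst k U 0) => // y _; rewrite big_nil.
case Pi : (P i); last by apply: Ck_ext IH => // y _; rewrite big_cons Pi.
by apply: Ck_ext (CkD oU (Fk i Pi) IH) => // y _; rewrite big_cons Pi.
Qed.

Lemma Ck_prod k U (I : Type) (r : seq I) (P : pred I) (F : I -> 'rV[R]_n -> R) :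
  open U -> (forall i, P i -> Ck k U (F i)) ->
  Ck k U (fun y => \prod_(i <- r | P i) F i y).
Proof.
move=> oU Fk; elim: r => [|i r IH].
  by apply: Ck_ext (Ck_cst k U 1) => // y _; rewrite big_nil.
case Pi : (P i); last by apply: Ck_ext IH => // y _; rewrite big_cons Pi.
by apply: Ck_ext (CkM oU (Fk i Pi) IH) => // y _; rewrite big_cons Pi.
Qed.

Lemma is_derive_coord y v (i : 'I_n) :
  is_derive y v (fun z : 'rV[R]_n => z 0 i) (v 0 i).
Proof.
have [H D] := @is_derive_id R 'rV[R]_n y v.
have := (derivable_mxP id y v).1 H 0 i; split=> //.
by rewrite -[in RHS]D derive_mx// mxE.
Qed.

Lemma Ck_coord k U (i : 'I_n) : open U -> Ck k U (fun y => y 0 i).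
Proof.
move=> oU; case: k => [|k].
  by split=> // y _; exact: coord_continuous.
apply: (@Ck_intro k U _ (fun j _ => (delta_mx 0 j : 'rV[R]_n) 0 i)) => //.
- by move=> y _; exact: coord_continuous.
- by move=> j y _; exact: is_derive_coord.
- by move=> j; exact: Ck_cst.
Qed.

Lemma CkV k U f : open U -> (forall y, U y -> f y != 0) -> Ck k U f ->
  Ck k U (fun y => (f y)^-1).
Proof.
move=> oU f0; elim: k => [|k IH] fk.
  by split=> // y Uy; apply: continuous_inv; [exact: f0|exact: (Ck_continuous fk)].
apply: (@Ck_intro k U _ (fun i y => - (f y ^- 2 * partial i f y))) => //.
- by move=> y Uy; apply: continuous_inv; [exact: f0|exact: (Ck_continuous fk)].
- by move=> i y Uy; apply: is_derive_inv; [exact: f0|exact: (Ck_is_derive i fk)].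
- move=> i; apply: CkN => //; apply: CkM => //; last exact: Ck_partial.
  have fV := IH (CkS fk).
  by apply: Ck_ext (CkM oU fV fV) => // y _; rewrite -invfM -expr2.
Qed.

Lemma Ck_sqrt k U f : open U -> (forall y, U y -> 0 < f y) -> Ck k U f ->
  Ck k U (fun y => Num.sqrt (f y)).
Proof.
move=> oU f0.
have fcont k' : Ck k' U f -> forall y, U y ->
    {for y, continuous (fun y => Num.sqrt (f y))}.
  move=> fk y Uy.
  exact: (continuous_comp (Ck_continuous fk Uy) (@sqrt_continuous R (f y))).
elim: k => [|k IH] fk; first by split=> //; exact: fcont fk.
apply: (@Ck_intro k U _
  (fun i y => partial i f y * (2 * Num.sqrt (f y))^-1)) => //.
- exact: fcont fk.
- by move=> i y Uy; apply: is_derive_sqrt; [exact: f0|exact: (Ck_is_derive i fk)].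
- move=> i; apply: CkM => //; first exact: Ck_partial.
  apply: CkV => //.
    by move=> y Uy; rewrite mulf_neq0// gt_eqF// sqrtr_gt0; exact: f0.
  by apply: CkM => //; [exact: Ck_cst|exact/IH/CkS].
Qed.

End Ck.

(** * Mean value theorem and chain rule in several variables *)

Section Calculus.
Context (R : realType) (n : nat).
Implicit Types (U W : set 'rV[R]_n) (f : 'rV[R]_n -> R) (x y z v : 'rV[R]_n).

Lemma rV_ballP x (e : R) z : 0 < e ->
  ball x e z <-> (forall i, `|x 0 i - z 0 i| < e).
Proof.
move=> e0; split => [[_ H] i|H]; first exact: H.
by split=> // i j; rewrite (ord1 i); exact: H.
Qed.

(** The segment is unordered because the coordinates of two points may compare in either way. *)
Definition between (a b t : R) := (a <= t <= b) || (b <= t <= a).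

(** The substitute for convexity suited to paths parallel to the axes; balls of the sup norm have
    it. *)
Definition boxed W := forall x x' z, W x -> W x' ->
  (forall i, between (x 0 i) (x' 0 i) (z 0 i)) -> W z.

Lemma ball_boxed x0 (e : R) : 0 < e -> boxed (ball x0 e).
Proof.
move=> e0 x x' z /(rV_ballP _ _ e0) Wx /(rV_ballP _ _ e0) Wx' B.
apply/rV_ballP => // i; have := Wx i; have := Wx' i; have := B i.
rewrite /between !ltr_norml => /orP[] /andP[] ? ? /andP[] ? ? /andP[] ? ?;
  apply/andP; split; lra.
Qed.

Lemma between_ball x x' z (e : R) : 0 < e -> ball x' e x ->
  (forall i, between (x 0 i) (x' 0 i) (z 0 i)) -> ball x' e z.
Proof.
by move=> e0 Bx B; apply: (ball_boxed e0 Bx _ B); exact: ballxx.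
Qed.

Lemma mvt_between (phi dphi : R -> R) (a b : R) :
  (forall t, between a b t -> is_derive t 1 phi (dphi t)) ->
  exists2 t, between a b t & phi b - phi a = dphi t * (b - a).
Proof.
have main (c d : R) : c < d ->
    (forall t, between c d t -> is_derive t 1 phi (dphi t)) ->
    exists2 t, between c d t & phi d - phi c = dphi t * (d - c).
  move=> cd H.
  have [||t] := @MVT R phi dphi c d cd.
  - move=> t; rewrite in_itv/= => /andP[ct td]; apply: H.
    by rewrite /between (ltW ct) (ltW td).
  - apply: derivable_within_continuous => t; rewrite in_itv/= => ctd.
    by have [] : is_derive t 1 phi (dphi t) by apply: H; rewrite /between ctd.
  rewrite in_itv/= => /andP[ct td] E.
  by exists t => //; rewrite /between (ltW ct) (ltW td).
have bC c d t : between c d t = between d c t by rewrite /between orbC.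
case: (ltgtP a b) => [ab|ba|->] H; first exact: main.
- have [|t tab E] := main _ _ ba; first by move=> t; rewrite bC; exact: H.
  exists t; first by rewrite bC.
  by rewrite -opprB E -mulrN opprB.
- by exists b; rewrite ?subrr ?mulr0// /between lexx.
Qed.

Lemma is_derive_line (V : normedModType R) (f : V -> R) (g : R -> V)
    (v : V) (t a : R) :
  (forall h, g (h + t) = h *: v + g t) ->
  is_derive (g t) v f a -> is_derive t 1 (fun s => f (g s)) a.
Proof.
move=> gE [df <-].
have E : (fun h : R => h^-1 *: (f (g (h *: 1 + t)) - f (g t))) =
         (fun h : R => h^-1 *: (f (h *: v + g t) - f (g t))).
  by apply/funext => h; rewrite [h *: 1]mulr1 gE.
by split; [rewrite /derivable/= E|rewrite /derive/= E].
Qed.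

(** The path from [x'] to [x] changes one coordinate at a time, and each leg is a mean value theorem
    in one variable. Hence a separate point [xi k] for each partial derivative. *)
Lemma mean_value W f x x' : boxed W ->
  (forall y i, W y -> derivable f y (delta_mx 0 i)) -> W x -> W x' ->
  exists xi : 'I_n -> 'rV[R]_n,
    (forall k, W (xi k) /\ forall i, between (x 0 i) (x' 0 i) (xi k 0 i)) /\
    f x - f x' = \sum_k partial k f (xi k) * (x 0 k - x' 0 k).
Proof.
move=> bW df Wx Wx'.
pose path (k : nat) : 'rV[R]_n := \row_i (if (i < k)%N then x 0 i else x' 0 i).
have step (k : 'I_n) : exists z : 'rV[R]_n,
    (W z /\ forall i, between (x 0 i) (x' 0 i) (z 0 i)) /\
    f (path k.+1) - f (path k) = partial k f z * (x 0 k - x' 0 k).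
  pose g (t : R) : 'rV[R]_n := \row_i (if i == k then t else path k 0 i).
  have gE t h : g (h + t) = h *: delta_mx 0 k + g t.
    apply/rowP => i; rewrite !mxE eqxx; case: eqVneq => _ /=.
      by rewrite mulr1.
    by rewrite mulr0 add0r.
  have gB t : between (x' 0 k) (x 0 k) t ->
      forall i, between (x 0 i) (x' 0 i) (g t 0 i).
    move=> tB i; rewrite !mxE; case: (eqVneq i k) => [->|_].
      by rewrite /between orbC.
    by case: ifP => _; rewrite /between lexx ?andbT/= ?andbT le_total.
  have Wg t : between (x' 0 k) (x 0 k) t -> W (g t).
    by move=> tB; apply: (bW x x') => //; exact: gB.
  have [|t tB E] := @mvt_between (fun t => f (g t))
      (fun t => partial k f (g t)) (x' 0 k) (x 0 k).
    move=> t tB; apply: (is_derive_line (gE t)).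
    by apply/derivableP/df; exact: Wg.
  exists (g t); split; first by split; [exact: Wg|exact: gB].
  rewrite -E; congr (f _ - f _); apply/rowP => i; rewrite !mxE.
    rewrite ltnS leq_eqVlt; case: (eqVneq i k) => [->|nik]; first by rewrite eqxx.
    by rewrite (_ : (_ == _ :> nat) = false)//; apply/negbTE.
  by case: (eqVneq i k) => [->|//]; rewrite ltnn.
have [xi xiP] := fin_all_exists step; exists xi; split; first by move=> k; case: (xiP k).
rewrite -(eq_bigr _ (fun k _ => (xiP k).2)) -(big_mkord xpredT (fun k => f (path k.+1) - f (path k))).
rewrite telescope_sumr//; congr (f _ - f _); apply/rowP => i; rewrite !mxE//.
by rewrite ltn_ord.
Qed.

(* The slopes [q] are a Caratheodory form of differentiability. *)
Lemma slopes_exist U f x : open U -> U x -> Ck 1 U f ->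
  exists q : 'I_n -> 'rV[R]_n -> R,
    (forall k, q k z @[z --> x] --> partial k f x) /\
    (\forall z \near x, f z - f x = \sum_k q k z * (z 0 k - x 0 k)).
Proof.
move=> oU Ux fC.
have /nbhs_ballP[e /= e0 eU] : nbhs x U by exact: open_nbhs_nbhs.
have df y i : ball x e y -> derivable f y (delta_mx 0 i).
  by move=> /eU Uy; case: fC => _ /(_ i)[+ _]; apply.
have H z : exists xi : 'I_n -> 'rV[R]_n, ball x e z ->
    (forall k i, between (z 0 i) (x 0 i) (xi k 0 i)) /\
    f z - f x = \sum_k partial k f (xi k) * (z 0 k - x 0 k).
  (* Outside the ball the intermediate points get a default value; only the germ at [x] counts. *)
  have [Bz|nBz] := pselect (ball x e z); last by exists (fun=> 0).
  have [xi [B E]] := mean_value (ball_boxed e0) df Bz (ballxx x e0).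
  by exists xi => _; split=> // k; case: (B k).
have [xi xiP] := choice H.
exists (fun k z => partial k f (xi z k)); split; last first.
  near=> z; have Bz : ball x e z by near: z; exact: (nbhsx_ballx x).
  exact: (xiP z Bz).2.
move=> k; have pc : {for x, continuous (partial k f)}.
  by apply: (Ck_continuous (k := 0) (U := U)) => //; exact: Ck_partial.
apply/(@cvgrPdist_lt _ _ _ (nbhs x)) => d d0.
have /(@cvgrPdist_lt _ _ _ (nbhs x))/(_ d d0) : partial k f z @[z --> x] --> partial k f x by exact: pc.
move=> /nbhs_ballP[r /= r0 rP]; near=> z; apply: rP => /=.
apply: (between_ball (x := z)) => //; first by near: z; exact: (nbhsx_ballx x).
have Bz : ball x e z by near: z; exact: (nbhsx_ballx x).
exact: (xiP z Bz).1.
Unshelve. all: by end_near. Qed.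

Lemma cvg_bigsum (T : Type) (F : set_system T) {FF : Filter F} (I : Type)
    (r : seq I) (f : I -> T -> R) (l : I -> R) :
  (forall i, f i t @[t --> F] --> l i) ->
  \sum_(i <- r) f i t @[t --> F] --> \sum_(i <- r) l i.
Proof.
move=> fl; elim: r => [|i r IH].
  by under eq_fun do rewrite big_nil; rewrite big_nil; exact: cvg_cst.
by under eq_fun do rewrite big_cons; rewrite big_cons; exact: cvgD.
Qed.

Lemma cvg_rowP (T : Type) (F : set_system T) {FF : Filter F}
    (g : T -> 'rV[R]_n) (l : 'rV[R]_n) :
  (forall i, g t 0 i @[t --> F] --> l 0 i) -> g t @[t --> F] --> l.
Proof.
move=> gl; apply/cvg_ballP => e e0.
have : \forall t \near F, forall i, `|l 0 i - g t 0 i| < e.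
  apply: filter_forall => i.
  by have /cvgrPdist_lt/(_ e e0) := gl i.
by apply: filterS => t tP; apply/rV_ballP.
Qed.

(** Slopes write the increment of [f] along [g] as an exact sum of products, so the difference
    quotient converges term by term. For [g], derivability in the single direction [v] suffices. *)
Lemma is_derive_comp (V : normedModType R) U f (g : V -> 'rV[R]_n) (y v : V)
    (a : 'I_n -> R) : open U -> U (g y) -> Ck 1 U f ->
  (forall k, is_derive y v (fun w => g w 0 k) (a k)) ->
  is_derive y v (fun w => f (g w)) (\sum_k partial k f (g y) * a k).
Proof.
move=> oU Ugy fC dg.
have [q [qc qE]] := slopes_exist oU Ugy fC.
have gc : g (h *: v + y) @[h --> 0^'] --> g y.
  apply: cvg_rowP => i; have [dgi _] := dg i.
  exact: derivable_line_continuous dgi.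
suff H : h^-1 *: (f (g (h *: v + y)) - f (g y)) @[h --> 0^'] -->
    \sum_k partial k f (g y) * a k.
  by split; [apply/cvg_ex; exists (\sum_k partial k f (g y) * a k)|exact/cvg_lim].
have H : \sum_k q k (g (h *: v + y)) *
    (h^-1 *: (g (h *: v + y) 0 k - g y 0 k)) @[h --> 0^'] -->
    \sum_k partial k f (g y) * a k.
  apply: cvg_bigsum => k; apply: cvgM; first exact: cvg_comp gc (qc k).
  by case: (dg k) => dgk <-; exact: dgk.
apply: cvg_trans H; apply: near_eq_cvg; near=> h.
have -> : f (g (h *: v + y)) - f (g y) =
    \sum_k q k (g (h *: v + y)) * (g (h *: v + y) 0 k - g y 0 k).
  by near: h; exact: gc qE.
by rewrite scaler_sumr; apply: eq_bigr => k _; rewrite scalerAr.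
Unshelve. all: by end_near. Qed.

End Calculus.

Section Composition.
Context (R : realType).

Lemma row_continuous m n (g : 'rV[R]_m -> 'rV[R]_n) y :
  (forall i, {for y, continuous (fun z => g z 0 i)}) -> {for y, continuous g}.
Proof. by move=> gc; apply: (@cvg_rowP _ _ _ (nbhs y)) => i; exact: gc. Qed.

Lemma Ck_comp m n k (U : set 'rV[R]_n) (V : set 'rV[R]_m) f
    (g : 'rV[R]_m -> 'rV[R]_n) : open U -> open V ->
  (forall y, V y -> U (g y)) -> Ck k U f ->
  (forall i, Ck k V (fun y => g y 0 i)) -> Ck k V (fun y => f (g y)).
Proof.
move=> oU oV gU.
have cfg k' (f' : 'rV[R]_n -> R) : Ck k' U f' ->
    (forall i, Ck k' V (fun y => g y 0 i)) ->
    forall y, V y -> {for y, continuous (fun y => f' (g y))}.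
  move=> fk gk y Vy; have gc : {for y, continuous g}.
    by apply: row_continuous => i; exact: (Ck_continuous (gk i)).
  exact: (continuous_comp gc (Ck_continuous fk (gU _ Vy))).
elim: k f => [|k IH] f fk gk; first by split=> //; exact: cfg fk gk.
apply: (@Ck_intro _ _ _ _ _ (fun i y => \sum_j partial j f (g y) *
   partial i (fun z => g z 0 j) y)) => //.
- exact: cfg fk gk.
- move=> i y Vy; apply: (is_derive_comp oU) => //; first exact: gU.
    by apply: Ck_leq fk.
  by move=> j; exact: (Ck_is_derive i (gk j)).
- move=> i; apply: Ck_sum => // j _; apply: CkM => //.
    by apply: IH => [|j']; [exact: Ck_partial|exact/CkS].
  exact: Ck_partial.
Qed.

End Composition.

(** * Symmetry of second derivatives, functions with zero gradient, Gronwall's inequality *)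

Section MixedPartials.
Context (R : realType) (n : nat).
Implicit Types (U W : set 'rV[R]_n) (f : 'rV[R]_n -> R) (x y z : 'rV[R]_n).

(** Two successive mean value theorems, in direction [i] and then in direction [j]. The left-hand
    side is symmetric in [i] and [j], the right-hand side is not visibly so. *)
Lemma second_difference f y (i j : 'I_n) (h d : R) : 0 < h -> 2 * h < d ->
  Ck 2 (ball y d) f ->
  exists2 z, ball y d z &
    f (h *: delta_mx 0 j + (h *: delta_mx 0 i + y)) - f (h *: delta_mx 0 i + y) -
    (f (h *: delta_mx 0 j + y) - f y) = h ^+ 2 * partial j (partial i f) z.
Proof.
move=> h0 hd f2; have d0 : 0 < d by lra.
have ballP s t : between 0 h s -> between 0 h t ->
    ball y d (t *: delta_mx 0 j + (s *: delta_mx 0 i + y)).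
  move=> sB tB; apply/rV_ballP => // l; rewrite !mxE eqxx.
  move: sB tB; rewrite /between => sB tB.
  by case: (l == j); case: (l == i); rewrite /= ltr_norml; apply/andP;
    case/orP: sB => /andP[? ?]; case/orP: tB => /andP[? ?]; split; lra.
have lineE (k : 'I_n) (w : 'rV[R]_n) (s t : R) : (t + s) *: (delta_mx 0 k : 'rV[R]_n) + w =
    t *: delta_mx 0 k + (s *: delta_mx 0 k + w) by rewrite scalerDl addrA.
have B0 : between 0 h 0 by rewrite /between lexx (ltW h0).
have Bh : between 0 h h by rewrite /between lexx (ltW h0).
have [|s sB E] := @mvt_between R
  (fun s => f (h *: delta_mx 0 j + (s *: delta_mx 0 i + y)) - f (s *: delta_mx 0 i + y))
  (fun s => partial i f (h *: delta_mx 0 j + (s *: delta_mx 0 i + y)) -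
            partial i f (s *: delta_mx 0 i + y)) 0 h.
  move=> s sB; apply: is_derive_add; last apply: is_derive_opp.
    apply: (is_derive_line (g := fun s => h *: delta_mx 0 j + (s *: delta_mx 0 i + y))).
      by move=> t; rewrite lineE addrCA.
    by apply: (Ck_is_derive i f2); exact: ballP.
  apply: (is_derive_line (g := fun s => s *: delta_mx 0 i + y)) => //.
  by apply: (Ck_is_derive i f2); have := ballP s 0 sB B0; rewrite scale0r add0r.
have [|t tB E'] := @mvt_between R
  (fun t => partial i f (t *: delta_mx 0 j + (s *: delta_mx 0 i + y)))
  (fun t => partial j (partial i f) (t *: delta_mx 0 j + (s *: delta_mx 0 i + y))) 0 h.
  move=> t tB.
  apply: (is_derive_line (g := fun t => t *: delta_mx 0 j + (s *: delta_mx 0 i + y))) => //.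
  by apply: (Ck_is_derive j (Ck_partial i f2)); exact: ballP.
exists (t *: delta_mx 0 j + (s *: delta_mx 0 i + y)); first exact: ballP.
move: E E'; rewrite !scale0r !add0r !subr0 => -> ->; ring.
Qed.

Lemma half_dist_absurd (a b c : R) :
  `|b - c| < `|a - b| / 2 -> `|a - c| < `|a - b| / 2 -> False.
Proof.
have := ler_normD (a - c) (c - b).
rewrite [a - c + _]addrA subrK [ `|c - b|]distrC; lra.
Qed.

Lemma second_difference_eq (q a a' b b' c P P' : R) : q != 0 -> a = a' ->
  a - b - (b' - c) = q * P -> a' - b' - (b - c) = q * P' -> P = P'.
Proof. by move=> q0 -> E E'; apply: (mulfI q0); rewrite -E -E'; ring. Qed.

(** Evaluating one second difference in both orders makes the two mixed derivatives equal at two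
    points arbitrarily close to [y]; continuity then excludes a gap at [y]. *)
Lemma partialC U f y (i j : 'I_n) : open U -> U y -> Ck 2 U f ->
  partial i (partial j f) y = partial j (partial i f) y.
Proof.
move=> oU Uy f2.
have /nbhs_ballP[e /= e0 eU] : nbhs y U by exact: open_nbhs_nbhs.
have pc k l : {for y, continuous (partial k (partial l f))}.
  by apply: (Ck_continuous (k := 0) (U := U)) => //; do 2 apply: Ck_partial.
have near_pc k l (eps : R) : 0 < eps -> exists2 d, 0 < d &
    forall z, ball y d z -> `|partial k (partial l f) y - partial k (partial l f) z| < eps.
  move=> eps0.
  have /(@cvgrPdist_lt _ _ _ (nbhs y))/(_ eps eps0) : 
    partial k (partial l f) z @[z --> y] --> partial k (partial l f) y by exact: pc.
  by move=> /nbhs_ballP[d /= d0 dP]; exists d.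
apply/eqP/negP => /negP ne.
have eps0 : 0 < `|partial i (partial j f) y - partial j (partial i f) y| / 2.
  by rewrite divr_gt0// normr_gt0 subr_eq0.
have [d1 d10 H1] := near_pc i j _ eps0; have [d2 d20 H2] := near_pc j i _ eps0.
have [d [d0 de dd1 dd2]] : exists d, [/\ 0 < d, d <= e, d <= d1 & d <= d2].
  exists (Num.min e (Num.min d1 d2)).
  by rewrite !lt_min e0 d10 d20 !ge_min !lexx !orbT.
have f2d : Ck 2 (ball y d) f.
  by apply: Ck_subset f2; apply: subset_trans eU; exact: le_ball.
have h0 : 0 < d / 3 by rewrite divr_gt0.
have hd : 2 * (d / 3) < d by rewrite mulrCA gtr_pMr// ltr_pdivrMr// mul1r ltr_nat.
have [z Bz Ez] := second_difference i j h0 hd f2d.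
have [z' Bz' Ez'] := second_difference j i h0 hd f2d.
have {}H1 := H1 z' (le_ball dd1 Bz').
have {}H2 := H2 z (le_ball dd2 Bz).
have h2 : (d / 3) ^+ 2 != 0 by rewrite expf_neq0// gt_eqF.
have E := second_difference_eq h2 (congr1 f (addrCA _ _ _)) Ez Ez'.
move: H1 H2; rewrite E.
by move=> H1 H2; exact: half_dist_absurd H2 H1.
Qed.

Lemma gradient0_constant W f x x' : open W -> boxed W -> Ck 1 W f ->
  (forall k y, W y -> partial k f y = 0) -> W x -> W x' -> f x = f x'.
Proof.
move=> oW bW f1 f0 Wx Wx'.
have [|xi [Wxi E]] := mean_value (f := f) bW _ Wx Wx'.
  by move=> y i Wy; have [] := Ck_is_derive i f1 Wy.
apply/eqP; rewrite -subr_eq0 E big1// => k _.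
by rewrite f0 ?mul0r//; case: (Wxi k).
Qed.

(** On the segment from [x'] to [x] the function [phi t * expR (- (K * t))] starts at zero and has
    nonpositive derivative, so [f x] is at most zero. *)
Lemma gronwall_zero W f (C : R) x x' : open W -> boxed W -> Ck 1 W f -> 0 <= C ->
  (forall y, W y -> 0 <= f y) ->
  (forall k y, W y -> `|partial k f y| <= C * f y) ->
  W x -> W x' -> f x' = 0 -> f x = 0.
Proof.
move=> oW bW f1 C0 f0 df Wx Wx' fx'.
pose g (t : R) : 'rV[R]_n := t *: (x - x') + x'.
have Wg t : between 0 1 t -> W (g t).
  move=> tB; apply: (bW x x') => // i; rewrite !mxE.
  have {}tB : 0 <= t <= 1 by move: tB; rewrite /between => /orP[//|/andP[? ?]]; lra.
  by rewrite /between; case: (lerP (x 0 i) (x' 0 i)) => ?; apply/orP;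
    [left|right]; apply/andP; split; nra.
pose K := C * \sum_k `|(x - x') 0 k|.
pose phi t := f (g t).
pose dphi t := \sum_k partial k f (g t) * (x - x') 0 k.
have dphiP t : between 0 1 t -> is_derive t 1 phi (dphi t).
  move=> tB; apply: (is_derive_comp oW) => //; first exact: Wg.
  move=> k; rewrite (_ : (fun _ => _) = (fun t => t * (x - x') 0 k + x' 0 k)).
    apply: is_derive_eq (is_derive_add (is_derive_mul (is_derive_id t 1)
      (is_derive_cst _ _ _)) (is_derive_cst _ _ _)) _.
    by rewrite mulr0 !addr0 mul1r.
  by apply/funext => s; rewrite !mxE.
have dphi_le t : between 0 1 t -> dphi t <= K * phi t.
  move=> tB; apply: le_trans (ler_norm _) _; apply: le_trans (ler_norm_sum _ _ _) _.
  rewrite /K mulrAC mulr_sumr; apply: ler_sum => k _.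
  by rewrite normrM ler_wpM2r//; apply: df; exact: Wg.
have [|t tB] := @mvt_between R (fun t => phi t * expR (- (K * t)))
   (fun t => dphi t * expR (- (K * t)) + phi t * (expR (- (K * t)) * - K)) 0 1.
  move=> t tB; apply: is_derive_mul; first exact: dphiP.
  have := @is_derive1_comp R expR (fun t => - (K * t)) t _ (- K) (is_derive_expR _).
  apply; apply: is_derive_opp.
  apply: is_derive_eq (is_derive_mul (is_derive_cst _ _ _) (is_derive_id t 1)) _.
  by rewrite mul0r add0r mulr1.
have phi0 : phi 0 = 0 by rewrite /phi /g scale0r add0r.
have phi1 : phi 1 = f x by rewrite /phi /g scale1r subrK.
rewrite subr0 mulr1 phi0 mul0r subr0 phi1 mulr1 => E.
have fx0 : f x * expR (- K) <= 0.
  rewrite E (_ : _ + _ = (dphi t - K * phi t) * expR (- (K * t))); last by ring.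
  by rewrite mulr_le0_ge0 ?expR_ge0// subr_le0; exact: dphi_le.
apply/eqP; rewrite eq_le f0// andbT.
by rewrite -(pmulr_lle0 _ (expR_gt0 (- K))).
Qed.

End MixedPartials.

(** * Smooth matrix-valued functions *)

Section MatrixFunctions.
Context (R : realType) (n : nat).
Implicit Types (U : set 'rV[R]_n) (y : 'rV[R]_n).

Definition Cmx p q k U (X : 'rV[R]_n -> 'M[R]_(p, q)) :=
  forall i j, Ck k U (fun y => X y i j).
Definition smx p q U (X : 'rV[R]_n -> 'M[R]_(p, q)) := forall k, Cmx k U X.

Definition mpartial p q k (X : 'rV[R]_n -> 'M[R]_(p, q)) y : 'M[R]_(p, q) :=
  \matrix_(i, j) partial k (fun z => X z i j) y.
(** A relation that includes derivability, unlike the total function [mpartial], so that the rules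
    of calculus chain without side conditions. *)
Definition mderiv p q k (X : 'rV[R]_n -> 'M[R]_(p, q)) y (D : 'M[R]_(p, q)) :=
  forall i j, is_derive y (delta_mx 0 k) (fun z => X z i j) (D i j).

Section Closure.
Context (k : nat) (U : set 'rV[R]_n) (oU : open U).

Lemma Cmx_cst p q (A : 'M[R]_(p, q)) : Cmx k U (fun=> A).
Proof. by move=> i j; exact: Ck_cst. Qed.

Lemma CmxD p q (X Y : 'rV[R]_n -> 'M[R]_(p, q)) : Cmx k U X -> Cmx k U Y ->
  Cmx k U (fun y => X y + Y y).
Proof.
by move=> Xk Yk i j; apply: Ck_ext (CkD oU (Xk i j) (Yk i j)) => // y _; rewrite mxE.
Qed.

Lemma CmxN p q (X : 'rV[R]_n -> 'M[R]_(p, q)) : Cmx k U X ->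
  Cmx k U (fun y => - X y).
Proof.
by move=> Xk i j; apply: Ck_ext (CkN oU (Xk i j)) => // y _; rewrite mxE.
Qed.

Lemma CmxM p q r (X : 'rV[R]_n -> 'M[R]_(p, q)) (Y : 'rV[R]_n -> 'M[R]_(q, r)) :
  Cmx k U X -> Cmx k U Y -> Cmx k U (fun y => X y *m Y y).
Proof.
move=> Xk Yk i j.
apply: (@Ck_ext _ _ _ _ (fun y => \sum_l X y i l * Y y l j)) => //.
  by move=> y _; rewrite mxE.
by apply: Ck_sum => // l _; exact: CkM (Xk i l) (Yk l j).
Qed.

Lemma CmxZ p q (f : 'rV[R]_n -> R) (X : 'rV[R]_n -> 'M[R]_(p, q)) :
  Ck k U f -> Cmx k U X -> Cmx k U (fun y => f y *: X y).
Proof.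
by move=> fk Xk i j; apply: Ck_ext (CkM oU fk (Xk i j)) => // y _; rewrite mxE.
Qed.

Lemma CmxT p q (X : 'rV[R]_n -> 'M[R]_(p, q)) : Cmx k U X ->
  Cmx k U (fun y => (X y)^T).
Proof. by move=> Xk i j; apply: Ck_ext (Xk j i) => // y _; rewrite mxE. Qed.

Lemma Cmx_sum p q (I : Type) (r : seq I) (F : I -> 'rV[R]_n -> 'M[R]_(p, q)) :
  (forall i, Cmx k U (F i)) -> Cmx k U (fun y => \sum_(i <- r) F i y).
Proof.
move=> Fk i j.
apply: (@Ck_ext _ _ _ _ (fun y => \sum_(l <- r) F l y i j)) => //.
  by move=> y _; rewrite summxE.
by apply: Ck_sum => // l _; exact: Fk.
Qed.

Lemma Cmx_block p q p' q' (A : 'rV[R]_n -> 'M[R]_(p, q))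
    (B : 'rV[R]_n -> 'M[R]_(p, q')) (C : 'rV[R]_n -> 'M[R]_(p', q))
    (D : 'rV[R]_n -> 'M[R]_(p', q')) :
  Cmx k U A -> Cmx k U B -> Cmx k U C -> Cmx k U D ->
  Cmx k U (fun y => block_mx (A y) (B y) (C y) (D y)).
Proof.
move=> Ak Bk Ck' Dk i j.
case: (split_ordP i) => i' ->; case: (split_ordP j) => j' ->.
- by apply: Ck_ext (Ak i' j') => // y _; rewrite block_mxEul.
- by apply: Ck_ext (Bk i' j') => // y _; rewrite block_mxEur.
- by apply: Ck_ext (Ck' i' j') => // y _; rewrite block_mxEdl.
- by apply: Ck_ext (Dk i' j') => // y _; rewrite block_mxEdr.
Qed.

Lemma Ck_det p (X : 'rV[R]_n -> 'M[R]_p) : Cmx k U X ->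
  Ck k U (fun y => \det (X y)).
Proof.
move=> Xk; apply: Ck_sum => // s _; apply: CkM => //; first exact: Ck_cst.
by apply: Ck_prod => // i _; exact: Xk.
Qed.

Lemma Cmx_inv p (X : 'rV[R]_n -> 'M[R]_p) : Cmx k U X ->
  (forall y, U y -> X y \in unitmx) -> Cmx k U (fun y => invmx (X y)).
Proof.
move=> Xk Xu i j.
apply: (@Ck_ext _ _ _ _ (fun y => (\det (X y))^-1 * cofactor (X y) j i)) => //.
  by move=> y Uy; rewrite /invmx Xu// !mxE.
apply: CkM => //; first apply: CkV => //; last apply: CkM => //.
- by move=> y /Xu; rewrite unitmxE unitfE.
- exact: Ck_det.
- exact: Ck_cst.
apply: Ck_det => a b.
by apply: Ck_ext (Xk (lift j a) (lift i b)) => // y _; rewrite !mxE.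
Qed.

End Closure.

Section SmoothClosure.
Context (U : set 'rV[R]_n) (oU : open U).

Lemma smooth_partial (f : 'rV[R]_n -> R) i : smooth U f -> smooth U (partial i f).
Proof. by move=> fs k; exact: Ck_partial (fs k.+1). Qed.

Lemma smx_entry p q (X : 'rV[R]_n -> 'M[R]_(p, q)) i j :
  smx U X -> smooth U (fun y => X y i j).
Proof. by move=> Xs k; exact: Xs. Qed.

Lemma smx_intro p q (X : 'rV[R]_n -> 'M[R]_(p, q)) :
  (forall i j, smooth U (fun y => X y i j)) -> smx U X.
Proof. by move=> Xs k i j; exact: Xs. Qed.

Lemma smx_subset p q (V : set 'rV[R]_n) (X : 'rV[R]_n -> 'M[R]_(p, q)) :
  V `<=` U -> smx U X -> smx V X.
Proof. by move=> VU Xs k i j; apply: Ck_subset (Xs k i j). Qed.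

Lemma smx_cst p q (A : 'M[R]_(p, q)) : smx U (fun=> A).
Proof. by move=> k; exact: Cmx_cst. Qed.

Lemma smxD p q (X Y : 'rV[R]_n -> 'M[R]_(p, q)) : smx U X -> smx U Y ->
  smx U (fun y => X y + Y y).
Proof. by move=> Xs Ys k; exact: CmxD. Qed.

Lemma smxN p q (X : 'rV[R]_n -> 'M[R]_(p, q)) : smx U X -> smx U (fun y => - X y).
Proof. by move=> Xs k; exact: CmxN. Qed.

Lemma smxM p q r (X : 'rV[R]_n -> 'M[R]_(p, q)) (Y : 'rV[R]_n -> 'M[R]_(q, r)) :
  smx U X -> smx U Y -> smx U (fun y => X y *m Y y).
Proof. by move=> Xs Ys k; exact: CmxM. Qed.

Lemma smxZ p q (f : 'rV[R]_n -> R) (X : 'rV[R]_n -> 'M[R]_(p, q)) :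
  smooth U f -> smx U X -> smx U (fun y => f y *: X y).
Proof. by move=> fs Xs k; exact: CmxZ. Qed.

Lemma smxT p q (X : 'rV[R]_n -> 'M[R]_(p, q)) : smx U X -> smx U (fun y => (X y)^T).
Proof. by move=> Xs k; exact: CmxT. Qed.

Lemma smx_sum p q (I : Type) (r : seq I) (F : I -> 'rV[R]_n -> 'M[R]_(p, q)) :
  (forall i, smx U (F i)) -> smx U (fun y => \sum_(i <- r) F i y).
Proof. by move=> Fs k; apply: Cmx_sum => // i; exact: Fs. Qed.

Lemma smx_block p q p' q' (A : 'rV[R]_n -> 'M[R]_(p, q))
    (B : 'rV[R]_n -> 'M[R]_(p, q')) (C : 'rV[R]_n -> 'M[R]_(p', q))
    (D : 'rV[R]_n -> 'M[R]_(p', q')) :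
  smx U A -> smx U B -> smx U C -> smx U D ->
  smx U (fun y => block_mx (A y) (B y) (C y) (D y)).
Proof. by move=> ? ? ? ? k; exact: Cmx_block. Qed.

Lemma smx_mpartial p q k (X : 'rV[R]_n -> 'M[R]_(p, q)) :
  smx U X -> smx U (mpartial k X).
Proof.
move=> Xs; apply: smx_intro => i j.
have := smooth_partial k (smx_entry i j Xs); move=> H k'.
by apply: Ck_ext (H k') => // y _; rewrite mxE.
Qed.

Section MDeriv.
Context (y : 'rV[R]_n) (Uy : U y) (k : 'I_n).

Lemma mderivE p q (X : 'rV[R]_n -> 'M[R]_(p, q)) D :
  mderiv k X y D -> mpartial k X y = D.
Proof. by move=> XD; apply/matrixP => i j; rewrite mxE; case: (XD i j). Qed.

Lemma mderiv_unique p q (X : 'rV[R]_n -> 'M[R]_(p, q)) D D' :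
  mderiv k X y D -> mderiv k X y D' -> D = D'.
Proof. by move=> /mderivE <- /mderivE <-. Qed.

Lemma smx_mderiv p q (X : 'rV[R]_n -> 'M[R]_(p, q)) :
  smx U X -> mderiv k X y (mpartial k X y).
Proof. by move=> Xs i j; rewrite mxE; exact: (Ck_is_derive k (Xs 1 i j)). Qed.

Lemma mderiv_ext p q (X Y : 'rV[R]_n -> 'M[R]_(p, q)) D :
  (forall z, U z -> X z = Y z) -> mderiv k X y D -> mderiv k Y y D.
Proof.
move=> XY XD i j; have [dX <-] := XD i j.
have XYij : \near y, X y i j = Y y i j by apply: (near_open oU Uy) => z /XY ->.
split; first exact: near_eq_derivable XYij dX.
by rewrite -(near_eq_derive (delta_mx 0 k) XYij).
Qed.

Lemma mderiv_cst p q (A : 'M[R]_(p, q)) : mderiv k (fun=> A) y 0.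
Proof. by move=> i j; rewrite mxE; exact: is_derive_cst. Qed.

Lemma mderivD p q (X Y : 'rV[R]_n -> 'M[R]_(p, q)) D E :
  mderiv k X y D -> mderiv k Y y E -> mderiv k (fun y => X y + Y y) y (D + E).
Proof.
move=> XD YE i j; rewrite mxE.
rewrite (_ : (fun _ => _) = (fun z => X z i j + Y z i j)); first exact: is_derive_add.
by apply/funext => z; rewrite mxE.
Qed.

Lemma mderivN p q (X : 'rV[R]_n -> 'M[R]_(p, q)) D :
  mderiv k X y D -> mderiv k (fun y => - X y) y (- D).
Proof.
move=> XD i j; rewrite mxE.
rewrite (_ : (fun _ => _) = (fun z => - X z i j)); first exact: is_derive_opp.
by apply/funext => z; rewrite mxE.
Qed.

Lemma mderivB p q (X Y : 'rV[R]_n -> 'M[R]_(p, q)) D E :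
  mderiv k X y D -> mderiv k Y y E -> mderiv k (fun y => X y - Y y) y (D - E).
Proof. by move=> XD YE; apply: mderivD => //; exact: mderivN. Qed.

Lemma mderivM p q r (X : 'rV[R]_n -> 'M[R]_(p, q)) (Y : 'rV[R]_n -> 'M[R]_(q, r)) D E :
  mderiv k X y D -> mderiv k Y y E ->
  mderiv k (fun y => X y *m Y y) y (D *m Y y + X y *m E).
Proof.
move=> XD YE i j; rewrite !mxE -big_split/=.
rewrite (_ : (fun _ => _) = (fun z => \sum_l X z i l * Y z l j)).
  by apply: is_derive_bigsum => l _; exact: is_derive_mul.
by apply/funext => z; rewrite mxE.
Qed.

Lemma mderivZ p q (f : 'rV[R]_n -> R) (X : 'rV[R]_n -> 'M[R]_(p, q)) d D :
  is_derive y (delta_mx 0 k) f d -> mderiv k X y D ->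
  mderiv k (fun y => f y *: X y) y (d *: X y + f y *: D).
Proof.
move=> fd XD i j; rewrite !mxE.
rewrite (_ : (fun _ => _) = (fun z => f z * X z i j)); first exact: is_derive_mul.
by apply/funext => z; rewrite mxE.
Qed.

Lemma mderivT p q (X : 'rV[R]_n -> 'M[R]_(p, q)) D :
  mderiv k X y D -> mderiv k (fun y => (X y)^T) y D^T.
Proof.
move=> XD i j; rewrite mxE (_ : (fun _ => _) = (fun z => X z j i)) //.
by apply/funext => z; rewrite mxE.
Qed.

Lemma mderiv_sum p q (I : Type) (r : seq I) (F : I -> 'rV[R]_n -> 'M[R]_(p, q)) D :
  (forall i, mderiv k (F i) y (D i)) ->
  mderiv k (fun y => \sum_(i <- r) F i y) y (\sum_(i <- r) D i).
Proof.
move=> FD i j; rewrite summxE.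
rewrite (_ : (fun _ => _) = (fun z => \sum_(l <- r) F l z i j)).
  by apply: is_derive_bigsum => l _; exact: FD.
by apply/funext => z; rewrite summxE.
Qed.

Lemma mderiv_block p q p' q' (A : 'rV[R]_n -> 'M[R]_(p, q))
    (B : 'rV[R]_n -> 'M[R]_(p, q')) (C : 'rV[R]_n -> 'M[R]_(p', q))
    (D : 'rV[R]_n -> 'M[R]_(p', q')) dA dB dC dD :
  mderiv k A y dA -> mderiv k B y dB -> mderiv k C y dC -> mderiv k D y dD ->
  mderiv k (fun y => block_mx (A y) (B y) (C y) (D y)) y (block_mx dA dB dC dD).
Proof.
move=> HA HB HC HD i j.
case: (split_ordP i) => i' ->; case: (split_ordP j) => j' ->.
- rewrite block_mxEul (_ : (fun _ => _) = fun z => A z i' j')//.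
  by apply/funext => z; rewrite block_mxEul.
- rewrite block_mxEur (_ : (fun _ => _) = fun z => B z i' j')//.
  by apply/funext => z; rewrite block_mxEur.
- rewrite block_mxEdl (_ : (fun _ => _) = fun z => C z i' j')//.
  by apply/funext => z; rewrite block_mxEdl.
- rewrite block_mxEdr (_ : (fun _ => _) = fun z => D z i' j')//.
  by apply/funext => z; rewrite block_mxEdr.
Qed.

Lemma mpartialC p q l (X : 'rV[R]_n -> 'M[R]_(p, q)) : smx U X ->
  mpartial k (mpartial l X) y = mpartial l (mpartial k X) y.
Proof.
move=> Xs; apply/matrixP => i j.
have E k' l' : mpartial k' (mpartial l' X) y i j =
    partial k' (partial l' (fun z => X z i j)) y.
  rewrite /mpartial mxE; congr (partial k' _ y); apply/funext => z; exact: mxE.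
exact: etrans (E k l) (etrans (partialC k l oU Uy (Xs 2%N i j)) (esym (E l k))).
Qed.

End MDeriv.
End SmoothClosure.

End MatrixFunctions.

(** * Uniqueness for linear systems *)

Lemma near_continuous_bound (R : realType) n (f : 'rV[R]_n -> R) y (C : R) :
  {for y, continuous f} -> `|f y| < C -> \forall z \near y, `|f z| <= C.
Proof.
move=> fc fC.
have {fc} : f z @[z --> y] --> f y by exact: fc.
move=> /(@cvgrPdist_lt _ _ _ (nbhs y))/(_ (C - `|f y|)).
rewrite subr_gt0 => /(_ fC); apply: filterS => z.
rewrite distrC => H; have := ler_normD (f z - f y) (f y).
by rewrite subrK => /le_trans; apply; rewrite -lerBrDr ltW.
Qed.

Section LinearSystems.
Context (R : realType) (n p q : nat).
Implicit Types (U W : set 'rV[R]_n) (x y z : 'rV[R]_n) (X : 'rV[R]_n -> 'M[R]_(p, q)).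

Lemma linear_mx_sum (L : 'M[R]_(p, q) -> 'M[R]_(p, q)) : linear L ->
  forall A i j, L A i j = \sum_(a : 'I_p * 'I_q) A a.1 a.2 * L (delta_mx a.1 a.2) i j.
Proof.
move=> linL A i j.
have L0 : L 0 = 0 by have := linL (-1) 0 0; rewrite scaler0 addr0 scaleN1r addNr.
have LD u v : L (u + v) = L u + L v by have := linL 1 u v; rewrite !scale1r.
have LZ c u : L (c *: u) = c *: L u by have := linL c u 0; rewrite !addr0 L0 addr0.
rewrite {1}(matrix_sum_delta A) pair_bigA/= (big_morph L LD L0) summxE.
by apply: eq_bigr => a _; rewrite LZ mxE.
Qed.

Lemma cross_bound (u v C d : R) : `|d| <= C -> `|u * (v * d) *+ 2| <= C * (u ^+ 2 + v ^+ 2).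
Proof.
move=> dC; have C0 := le_trans (normr_ge0 d) dC.
rewrite normrMn !normrM mulrA.
have H : `|u| * `|v| *+ 2 <= u ^+ 2 + v ^+ 2.
  have := sqr_ge0 (`|u| - `|v|); rewrite -[u ^+ 2]real_normK ?num_real// -[v ^+ 2]real_normK ?num_real//.
  by rewrite sqrrB; lra.
rewrite mulrC -mulrnAr; apply: le_trans (_ : C * (`|u| * `|v| *+ 2) <= _).
  by rewrite ler_wpM2r// mulrn_wge0// mulr_ge0.
by rewrite ler_wpM2l.
Qed.

(** Gronwall applied to the sum of squares of the entries: with [N] entries, each partial derivative
    of this sum is at most 2 C N times the sum. *)
Lemma bounded_linear_system_zero (W : set 'rV[R]_n) (C : R)
    (L : 'I_n -> 'rV[R]_n -> 'M[R]_(p, q) -> 'M[R]_(p, q)) X x x' :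
  open W -> boxed W -> 0 <= C -> (forall k y, linear (L k y)) ->
  (forall k y i j i' j', W y -> `|L k y (delta_mx i j) i' j'| <= C) ->
  Cmx 1 W X -> (forall k y, W y -> mpartial k X y = L k y (X y)) ->
  W x -> W x' -> X x' = 0 -> X x = 0.
Proof.
move=> oW bW C0 linL LC X1 dX Wx Wx' Xx'.
pose f y := \sum_(a : 'I_p * 'I_q) X y a.1 a.2 ^+ 2.
have f1 : Ck 1 W f.
  by apply: Ck_sum => // a _; apply: (CkM oW (X1 a.1 a.2) (X1 a.1 a.2)).
have fx' : f x' = 0 by rewrite /f big1// => a _; rewrite Xx' mxE expr0n.
have f0 y : 0 <= f y by apply: sumr_ge0 => a _; exact: sqr_ge0.
pose N : R := #|{: 'I_p * 'I_q}|%:R.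
have df k y : W y -> `|partial k f y| <= C * (N *+ 2) * f y.
  move=> Wy.
  have -> : partial k f y =
      \sum_(a : 'I_p * 'I_q) \sum_(b : 'I_p * 'I_q)
        X y a.1 a.2 * (X y b.1 b.2 * L k y (delta_mx b.1 b.2) a.1 a.2) *+ 2.
    apply: is_derive_partial; apply: is_derive_bigsum => a _.
    have D := Ck_is_derive k (X1 a.1 a.2) Wy.
    apply: is_derive_eq (is_derive_mul D D) _.
    have -> : partial k (fun y => X y a.1 a.2) y = L k y (X y) a.1 a.2.
      by rewrite -dX// mxE.
    by rewrite linear_mx_sum// mulrC -mulr2n mulr_sumr -sumrMnl.
  apply: le_trans (ler_norm_sum _ _ _) _.
  apply: le_trans (ler_sum _ (fun a _ => ler_norm_sum _ _ _)) _.
  apply: le_trans (ler_sum _ (fun a _ => ler_sum _ (fun b _ =>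
     cross_bound _ _ (LC k y b.1 b.2 a.1 a.2 Wy)))) _.
  rewrite le_eqVlt; apply/orP; left; apply/eqP.
  under eq_bigr do rewrite -mulr_sumr big_split/= sumr_const -/(f y).
  rewrite -mulr_sumr big_split/= sumr_const -mulrA; congr (C * _).
  by rewrite sumrMnl -/(f y) /N mulrnAl mulr_natl mulr2n.
have fx : f x = 0.
  apply: (gronwall_zero oW bW f1 _ _ df Wx Wx' fx') => //.
  by rewrite mulr_ge0// mulrn_wge0.
apply/matrixP => i j; rewrite mxE; apply/eqP; rewrite -sqrf_eq0.
have /psumr_eq0P : f x = 0 by [].
by move=> /(_ (fun _ _ => sqr_ge0 _)) /(_ (i, j) isT)/= ->.
Qed.

(** The radius depends on a bound for the coefficients alone. It therefore serves all solutions,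
    also those defined on a smaller ball only. *)
Lemma linear_system_unique U y0 (L : 'I_n -> 'rV[R]_n -> 'M[R]_(p, q) -> 'M[R]_(p, q)) :
  open U -> U y0 -> (forall k y, linear (L k y)) ->
  (forall k i j, Cmx 0 U (fun y => L k y (delta_mx i j))) ->
  exists2 e : R, 0 < e & ball y0 e `<=` U /\
    forall e' X x x', 0 < e' -> e' <= e -> Cmx 1 (ball y0 e') X ->
      (forall k y, ball y0 e' y -> mpartial k X y = L k y (X y)) ->
      ball y0 e' x -> ball y0 e' x' -> X x' = 0 -> X x = 0.
Proof.
move=> oU Uy0 linL Lc.
pose c (a : 'I_n * (('I_p * 'I_q) * ('I_p * 'I_q))) y :=
  L a.1 y (delta_mx a.2.1.1 a.2.1.2) a.2.2.1 a.2.2.2.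
(* The summand 1 makes the bound strict at [y0], so that it persists nearby by continuity. *)
pose C : R := 1 + \sum_a `|c a y0|.
have cC a : `|c a y0| < C.
  rewrite /C (bigD1 a)//= addrCA ltrDl ltr_wpDr//.
  by apply: sumr_ge0.
have : \forall y \near y0, U y /\ forall a, `|c a y| <= C.
  apply: filterI; first exact: open_nbhs_nbhs.
  apply: (@filter_forall _ _ (fun a => [set y | `|c a y| <= C]) (nbhs y0)) => a.
  apply: near_continuous_bound (cC a).
  exact: (Ck_continuous (Lc a.1 a.2.1.1 a.2.1.2 a.2.2.1 a.2.2.2)).
move=> /nbhs_ballP[e /= e0 eP]; exists e => //; split; first by move=> y /eP[].
move=> e' X x x' e'0 e'e X1 dX Bx Bx' Xx'.
have eP' y : ball y0 e' y -> forall a, `|c a y| <= C.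
  by move=> By; case: (eP y (le_ball e'e By)).
apply: (bounded_linear_system_zero (W := ball y0 e') (C := C) (L := L) _ _ _ _ _ X1 dX Bx Bx' Xx') => //.
- exact: ball_open.
- exact: ball_boxed.
- by rewrite ltW// (le_lt_trans _ (ltr_pwDl ltr01 (lexx _)))//; apply: sumr_ge0.
- by move=> k y i j i' j' /eP' /(_ (k, ((i, j), (i', j')))).
Qed.

End LinearSystems.

(** * The inverse function theorem *)

Section CvgMatrix.
Context (R : realType) (T : Type) (F : set_system T) {FF : Filter F}.

Lemma cvg_bigprod (I : Type) (r : seq I) (f : I -> T -> R) (l : I -> R) :
  (forall i, f i t @[t --> F] --> l i) ->
  \prod_(i <- r) f i t @[t --> F] --> \prod_(i <- r) l i.
Proof.
move=> fl; elim: r => [|i r IH].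
  by under eq_fun do rewrite big_nil; rewrite big_nil; exact: cvg_cst.
by under eq_fun do rewrite big_cons; rewrite big_cons; exact: cvgM.
Qed.

Lemma cvg_det n (Q : T -> 'M[R]_n) (L : 'M[R]_n) :
  (forall i j, Q t i j @[t --> F] --> L i j) -> \det (Q t) @[t --> F] --> \det L.
Proof.
move=> QL; apply: cvg_bigsum => s; apply: cvgM; first exact: cvg_cst.
by apply: cvg_bigprod => i; exact: QL.
Qed.

Lemma cvg_invmx n (Q : T -> 'M[R]_n) (L : 'M[R]_n) : L \in unitmx ->
  (forall i j, Q t i j @[t --> F] --> L i j) ->
  (\forall t \near F, Q t \in unitmx) /\
  forall i j, invmx (Q t) i j @[t --> F] --> invmx L i j.
Proof.
move=> Lu QL; have dQ := cvg_det QL.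
have dL : \det L != 0 by rewrite -unitfE -unitmxE.
have Qu : \forall t \near F, Q t \in unitmx.
  near=> t; rewrite unitmxE unitfE; near: t; exact: cvgr_neq0 dL.
split=> // i j.
have H : (\det (Q t))^-1 * cofactor (Q t) j i @[t --> F] --> invmx L i j.
  rewrite /invmx Lu !mxE; apply: cvgM; first exact: cvgV.
  apply: cvgM; first exact: cvg_cst.
  by apply: cvg_det => a b; rewrite !mxE; under eq_fun do rewrite !mxE; exact: QL.
apply: cvg_trans H; apply: near_eq_cvg; near=> t.
by rewrite /invmx (_ : Q t \in unitmx) ?mxE ?mxE//; near: t.
Unshelve. all: by end_near. Qed.

End CvgMatrix.

Section InverseFunction.
Context (R : realType) (n : nat).
Implicit Types (x y z v : 'rV[R]_n).

Lemma rV_norm_coord v i : `|v 0 i| <= `|v|.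
Proof.
by rewrite [leRHS]/Num.Def.normr/= mx_normrE (le_bigmax _ (fun ij => `|v ij.1 ij.2|) (0, i)).
Qed.

Lemma rV_norm_le v (c : R) : 0 <= c -> (forall i, `|v 0 i| <= c) -> `|v| <= c.
Proof.
move=> c0 H; rewrite [leLHS]/Num.Def.normr/= mx_normrE bigmax_le// => -[a b] _ /=.
by rewrite (ord1 a).
Qed.

Lemma rV_norm_mul v (P : 'M[R]_n) : `|v *m P| <= (1 + \sum_i \sum_j `|P i j|) * `|v|.
Proof.
have P0 : 0 <= \sum_i \sum_j `|P i j| by apply: sumr_ge0 => i _; exact: sumr_ge0.
apply: rV_norm_le => [|j]; first by rewrite mulr_ge0// addr_ge0.
rewrite mxE; apply: le_trans (ler_norm_sum _ _ _) _.
rewrite mulrDl mul1r; apply: ler_wpDl => //.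
rewrite mulr_suml; apply: ler_sum => i _; rewrite normrM mulrC.
apply: ler_pM => //; last exact: rV_norm_coord.
by rewrite (bigD1 j)//= lerDl; exact: sumr_ge0.
Qed.

Definition jacobian (F : 'rV[R]_n -> 'rV[R]_n) y : 'M[R]_n :=
  \matrix_(i, k) partial k (fun z => F z 0 i) y.

Lemma jacobian_Cmx k (U : set 'rV[R]_n) (F : 'rV[R]_n -> 'rV[R]_n) : open U -> (forall i, Ck k.+1 U (fun z => F z 0 i)) ->
  Cmx k U (jacobian F).
Proof.
move=> oU FC i j; have := Ck_partial j (FC i).
by apply: Ck_ext => // y _; rewrite mxE.
Qed.

Section Local.
Context (U : set 'rV[R]_n) (F : 'rV[R]_n -> 'rV[R]_n) (y0 : 'rV[R]_n).
Hypotheses (oU : open U) (Uy0 : U y0) (FC : forall i, smooth U (fun z => F z 0 i)).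
Hypothesis (J0 : jacobian F y0 \in unitmx).

(** Points are rows, so the inverse of the derivative acts on the right by its transpose. The map
    [S] below is the Newton correction with frozen derivative; its own derivative vanishes at
    [y0]. *)
Let P := (invmx (jacobian F y0))^T.
Let S y := y - F y *m P.
(** A sum of n terms bounded by [eta] is at most 1/2; the successor keeps the denominator nonzero
    for n = 0. *)
Let eta : R := (2 * n.+1%:R)^-1.
Let eta0 : 0 < eta. Proof. by rewrite invr_gt0 mulr_gt0. Qed.

Let S1 i : Ck 1 U (fun z => S z 0 i).
Proof.
apply: (@Ck_ext _ _ _ _ (fun z => z 0 i - \sum_j F z 0 j * P j i)) => //.
  by move=> z _; rewrite !mxE.
apply: CkB => //; first exact: Ck_coord.
apply: Ck_sum => // j _; apply: CkM => //; first exact: FC.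
exact: Ck_cst.
Qed.

Let dS0 k i : partial k (fun z => S z 0 i) y0 = 0.
Proof.
rewrite (_ : (fun z => S z 0 i) = (fun z => z 0 i - \sum_j F z 0 j * P j i)); last first.
  by apply/funext => z; rewrite !mxE.
have D : is_derive y0 (delta_mx 0 k) (fun z => z 0 i - \sum_j F z 0 j * P j i)
    ((delta_mx 0 k : 'rV[R]_n) 0 i - \sum_j (partial k (fun z => F z 0 j) y0 * P j i + F y0 0 j * 0)).
  apply: is_derive_add; first exact: is_derive_coord.
  apply: is_derive_opp; apply: is_derive_bigsum => j _.
  exact: (is_derive_mul (Ck_is_derive k (FC j 1%N) Uy0) (is_derive_cst _ _ _)).
rewrite (is_derive_partial D) mxE eqxx/=.
have -> : \sum_j (partial k (fun z => F z 0 j) y0 * P j i + F y0 0 j * 0) =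
    (invmx (jacobian F y0) *m jacobian F y0) i k.
  rewrite mxE; apply: eq_bigr => j _; rewrite mulr0 addr0 mulrC.
  by rewrite /P mxE [in RHS]/jacobian [in X in _ = _ * X]mxE.
by rewrite mulVmx// mxE eq_sym subrr.
Qed.

Let good_ball : exists2 e : R, 0 < e & forall y, ball y0 e y ->
  [/\ U y, jacobian F y \in unitmx & forall k i, `|partial k (fun z => S z 0 i) y| <= eta].
Proof.
have H : \forall y \near y0, (U y /\ jacobian F y \in unitmx) /\
   forall ki : 'I_n * 'I_n, `|partial ki.1 (fun z => S z 0 ki.2) y| <= eta.
  apply: filterI; first apply: filterI; first exact: open_nbhs_nbhs.
    have dc : {for y0, continuous (fun y => \det (jacobian F y))}.
      apply: (Ck_continuous (k := 0) (U := U)) => //; apply: Ck_det => //.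
      by apply: jacobian_Cmx => // i; exact: FC.
    have {dc} dc : \det (jacobian F y) @[y --> y0] --> \det (jacobian F y0) by exact: dc.
    have d0 : \det (jacobian F y0) != 0 by rewrite -unitfE -unitmxE.
    have : nbhs y0 [set y | \det (jacobian F y) != 0] by exact: cvgr_neq0 dc d0.
    by apply: filterS => y /=; rewrite unitmxE unitfE.
  apply: (@filter_forall _ _ (fun ki : 'I_n * 'I_n =>
    [set y | `|partial ki.1 (fun z => S z 0 ki.2) y| <= eta]) (nbhs y0)) => -[k i].
  have B : `|partial k (fun z => S z 0 i) y0| < eta by rewrite dS0 normr0.
  exact: (near_continuous_bound (Ck_continuous (Ck_partial k (S1 i)) Uy0) B).
have /nbhs_ballP[e /= e0 eP] := H.
by exists e => // y /eP[[Uy Ju] dS]; split=> // k i; exact: (dS (k, i)).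
Qed.

(** On a small ball [S] contracts by 1/2, so [F] is injective with Lipschitz inverse. That the image
    is open follows from a minimum over a compact ball instead of a fixed point iteration. *)
Lemma inverse_function : exists V g, [/\ open V, V y0, V `<=` U, open (F @` V) &
  [/\ forall y, V y -> g (F y) = y,
      forall z, (F @` V) z -> {for z, continuous g} &
      forall i, smooth (F @` V) (fun z => g z 0 i)]].
Proof.
have [e e0 eP] := good_ball.
pose V := ball y0 e.
have oV : open V by exact: ball_open.
have bV : boxed V by exact: ball_boxed.
have Slip x x' : V x -> V x' -> `|S x - S x'| <= 2^-1 * `|x - x'|.
  move=> Vx Vx'; apply: rV_norm_le => [|i]; first by rewrite mulr_ge0.
  have SiD y k : V y -> derivable (fun z => S z 0 i) y (delta_mx 0 k).
    by move=> /eP[Uy _ _]; have [] := Ck_is_derive k (S1 i) Uy.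
  have [xi [Vxi E]] := mean_value bV SiD Vx Vx'.
  have -> : (S x - S x') 0 i = S x 0 i - S x' 0 i by rewrite mxE [X in _ + X]mxE.
  rewrite E.
  apply: le_trans (ler_norm_sum _ _ _) _.
  apply: (@le_trans _ _ (\sum_(k < n) eta * `|x - x'|)).
    apply: ler_sum => k _; rewrite normrM; apply: ler_pM => //.
      by have [/eP[_ _ dS] _] := Vxi k; exact: dS.
    by have := rV_norm_coord (x - x') k; rewrite !mxE.
  rewrite sumr_const card_ord -[leLHS]mulr_natl mulrA ler_wpM2r// /eta invfM mulrCA.
  by rewrite ler_piMr// ler_pdivrMr// mul1r ler_nat.
have FP x x' : (F x - F x') *m P = (x - x') - (S x - S x').
  by rewrite mulmxBl /S [X in _ = _ - X](_ : _ = x - x' - (F x *m P - F x' *m P));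
    [rewrite subKr|rewrite opprD addrACA -opprD].
pose c := 1 + \sum_i \sum_j `|P i j|.
have c0 : 0 < c by apply: ltr_pwDl => //; apply: sumr_ge0 => i _; exact: sumr_ge0.
have Fexp x x' : V x -> V x' -> `|x - x'| <= 2 * `|(F x - F x') *m P|.
  move=> Vx Vx'; have := Slip _ _ Vx Vx'; rewrite FP.
  have := ler_normB (x - x' - (S x - S x')) (- (S x - S x')).
  rewrite opprK subrK normrN; move: `|_ - _ - _| `|S x - S x'| `|x - x'|.
  by move=> a b d ? ?; lra.
have Fexp' x x' : V x -> V x' -> `|x - x'| <= 2 * c * `|F x - F x'|.
  move=> Vx Vx'; apply: le_trans (Fexp _ _ Vx Vx') _.
  by rewrite -mulrA ler_wpM2l//; exact: rV_norm_mul.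
have Finj x x' : V x -> V x' -> F x = F x' -> x = x'.
  move=> Vx Vx' FE; apply/eqP; rewrite -subr_eq0 -normr_le0.
  by apply: le_trans (Fexp' _ _ Vx Vx') _; rewrite FE subrr normr0 mulr0.
have Pu : P \in unitmx by rewrite unitmx_tr unitmx_inv.
have oFV : open (F @` V).
  rewrite openE => _ [x1 Vx1 <-].
  have /nbhs_ballP[r /= r0 rV] : nbhs x1 V by exact: open_nbhs_nbhs.
  pose rho := r / 2; have rho0 : 0 < rho by rewrite divr_gt0.
  have KV x : `|x - x1| <= rho -> V x.
    move=> xrho; apply: rV; rewrite mx_norm_ball /ball_/= distrC.
    by apply: le_lt_trans xrho _; rewrite /rho ltr_pdivrMr// ltr_pMr// ltr1n.
  apply/nbhs_ballP; exists (rho / (2 * c)) => /=; first by rewrite divr_gt0// mulr_gt0.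
  move=> z; rewrite mx_norm_ball /ball_/= => Bz.
  pose K : set 'rV[R]_n := [set x | `|x - x1| <= rho].
  pose h x := `|F x *m P - z *m P|.
  have Kcompact : compact K.
    apply: bounded_closed_compact.
      exists (`|x1| + rho); split; first exact: num_real.
      move=> M ltM x Kx; apply: ltW; apply: le_lt_trans ltM.
      by rewrite -(subrKC x1 x); apply: le_trans (ler_normD _ _) _; rewrite lerD2l.
    have -> : K = closed_ball x1 rho.
      by rewrite closed_ballE//; apply/seteqP; split=> x /=; rewrite /closed_ball_/= distrC.
    exact: closed_ball_closed.
  have hc : {within K, continuous h}.
    apply: continuous_in_subspaceT => x; rewrite inE => /KV/eP[Ux _ _].
    have Fc : {for x, continuous (fun y => F y *m P - z *m P)}.
      apply: row_continuous => i.
      have : Ck 0 U (fun y => (F y *m P + - (z *m P)) 0 i).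
        apply: CmxD => //; last exact: Cmx_cst.
        by apply: CmxM => //; [move=> a b; rewrite (ord1 a); exact: FC|exact: Cmx_cst].
      by move=> /Ck_continuous; apply.
    exact: (continuous_comp Fc (@norm_continuous _ _ _)).
  have [|x] := EVT_min_rV _ Kcompact hc.
    by exists x1; rewrite /K/= subrr normr0 ltW.
  rewrite inE => Kx hmin; have Vx := KV _ Kx.
  (* One Newton step from the minimizer [x] towards the target [z]. It stays in [K] and at least
     halves the residual [h], so minimality leaves only residual zero. *)
  pose x' := S x + z *m P.
  have Kx' : K x'.
    rewrite /K/= (_ : x' - x1 = (S x - S x1) + (z - F x1) *m P); last first.
      have -> : S x1 = x1 - F x1 *m P by [].
      by rewrite mulmxBl /x' opprB addrACA [_ - x1 - _]addrAC subrr sub0r.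
    apply: le_trans (ler_normD _ _) _; rewrite [leRHS](splitr rho); apply: lerD.
      apply: le_trans (Slip _ _ Vx Vx1) _.
      by rewrite mulrC ler_wpM2r.
    apply: le_trans (rV_norm_mul _ _) _; rewrite -/c distrC mulrC -ler_pdivlMr//.
    by rewrite -mulrA -invfM ltW.
  have hx' : h x' <= 2^-1 * h x.
    have E1 : F x' *m P - z *m P = S x - S x'.
      have -> : S x' = x' - F x' *m P by [].
      by rewrite {2}/x' -[_ + _ - F x' *m P]addrA [X in _ = _ + X]opprD addrA subrr sub0r opprB.
    have E2 : F x *m P - z *m P = x - x'.
      have SE : x - S x = F x *m P by rewrite /S subKr.
      by rewrite /x' opprD addrA SE.
    by rewrite /h E1 E2; apply: Slip => //; exact: KV.
  have hx : h x = 0.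
    have : h x <= h x' by apply: hmin; rewrite inE.
    have : 0 <= h x by exact: normr_ge0.
    by move: hx' {hmin}; move: (h x) (h x') => a b; lra.
  exists x => //; apply/eqP; rewrite -subr_eq0; apply/eqP.
  apply: (can_inj (mulmxK Pu)); rewrite mul0mx mulmxBl.
  exact: normr0_eq0.
have /choice[g gP] : forall z, exists y, (F @` V) z -> V y /\ F y = z.
  move=> z; have [[y Vy <-]|nz] := pselect ((F @` V) z); first by exists y.
  by exists 0.
have gK y : V y -> g (F y) = y.
  by move=> Vy; have [|Vg Fg] := gP (F y); [exists y|exact: Finj].
have glip z z' : (F @` V) z -> (F @` V) z' -> `|g z - g z'| <= 2 * c * `|z - z'|.
  move=> /gP[Vz Ez] /gP[Vz' Ez']; have := Fexp' _ _ Vz Vz'.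
  by rewrite Ez Ez'.
have gc z : (F @` V) z -> {for z, continuous g}.
  move=> Fz; apply/(@cvgrPdist_lt _ _ _ (nbhs z)) => d d0.
  have cd : 0 < d / (2 * c) by rewrite divr_gt0// mulr_gt0.
  have : nbhs z (ball z (d / (2 * c)) `&` (F @` V)).
    by apply: filterI; [exact: nbhsx_ballx|exact: open_nbhs_nbhs].
  apply: filterS => w [Bw Fw]; apply: le_lt_trans (glip _ _ Fz Fw) _.
  by move: Bw; rewrite mx_norm_ball /ball_/= ltr_pdivlMr ?mulr_gt0// mulrC.
exists V, g; split=> //; [exact: ballxx|by move=> y /eP[]|].
split=> // i k; move: i.
(* The matrix of slopes of [F] at [g z], evaluated at [g (w h)], maps the increment of [g] to [h]
   times a basis vector. Its inverse gives the difference quotient of [g] and converges to the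
   inverse jacobian. *)
have gderiv i j z : (F @` V) z -> is_derive z (delta_mx 0 j) (fun z => g z 0 i)
   (invmx (jacobian F (g z)) i j).
  move=> Fz; have [Vgz Fgz] := gP _ Fz; have [Ugz Jgz _] := eP _ Vgz.
  have [q qP] := fin_all_exists (fun l => slopes_exist oU Ugz (FC l 1%N)).
  pose w (h : R) := h *: delta_mx 0 j + z.
  have wz : w h @[h --> 0^'] --> z.
    apply: cvg_rowP => l; have [dl _] := is_derive_coord z (delta_mx 0 j) l.
    exact: derivable_line_continuous dl.
  have gw : g (w h) @[h --> 0^'] --> g z by exact: cvg_comp wz (gc z Fz).
  have QL a b : (\matrix_(l, k) q l k (g (w h))) a b @[h --> 0^'] -->
      jacobian F (g z) a b.
    rewrite mxE; under eq_fun do rewrite mxE.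
    exact: (cvg_comp _ _ gw ((qP a).1 b)).
  have [Qu Qinv] := cvg_invmx Jgz QL.
  have nFw : \forall h \near 0^', (F @` V) (w h).
    exact: (wz _ (open_nbhs_nbhs (conj oFV Fz))).
  have nslope l : \forall h \near 0^', F (g (w h)) 0 l - F (g z) 0 l =
        \sum_k q l k (g (w h)) * (g (w h) 0 k - g z 0 k).
    exact: (gw _ (qP l).2).
  have H : h^-1 *: (g (w h) 0 i - g z 0 i) @[h --> 0^'] --> invmx (jacobian F (g z)) i j.
    apply: cvg_trans (Qinv i j); apply: near_eq_cvg; near=> h.
    have h0 : h != 0 by near: h; exact: nbhs_dnbhs_neq.
    have Fw : (F @` V) (w h) by near: h.
    have Qh : (\matrix_(l, k) q l k (g (w h))) \in unitmx by near: h.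
    have slope : forall l, F (g (w h)) 0 l - F (g z) 0 l =
        \sum_k q l k (g (w h)) * (g (w h) 0 k - g z 0 k).
      near: h; exact: filter_forall nslope.
    have E : (\matrix_(l, k) q l k (g (w h))) *m (g (w h) - g z)^T =
        h *: (delta_mx 0 j)^T.
      apply/colP => l; rewrite !mxE.
      transitivity (F (g (w h)) 0 l - F (g z) 0 l).
        by rewrite slope; apply: eq_bigr => m _; rewrite !mxE.
      by rewrite Fgz (gP _ Fw).2 /w !mxE addrK.
    have : (g (w h) - g z)^T = h *: (invmx (\matrix_(l, k) q l k (g (w h))) *m (delta_mx 0 j)^T).
      by rewrite scalemxAr -E mulKmx.
    move=> /matrixP/(_ i 0); rewrite 3!mxE => ->; rewrite 2!mxE.
    rewrite [_ *: _]mulrA mulVf// mul1r (bigD1 j)//= big1 => [|a aj].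
      by rewrite !mxE !eqxx mulr1 addr0.
    by rewrite !mxE (negbTE aj) mulr0.
  by split; [apply/cvg_ex; exists (invmx (jacobian F (g z)) i j)|exact/cvg_lim].
(* Bootstrap: the derivative of [g] is the inverse jacobian of [F] composed with [g], so it has the
   regularity already known for [g]. *)
elim: k => [|k IH] i.
  split=> // z Fz; exact: (continuous_comp (gc z Fz) (@coord_continuous _ _ _ 0 i _)).
apply: (@Ck_intro _ _ _ _ _ (fun j z => invmx (jacobian F (g z)) i j)) => //.
- move=> z Fz; exact: (continuous_comp (gc z Fz) (@coord_continuous _ _ _ 0 i _)).
- move=> j; apply: (@Ck_comp _ _ _ _ V _ (fun y => invmx (jacobian F y) i j) g) => //.
    by move=> z /gP[].
  apply: Cmx_inv => //; last by move=> y /eP[].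
  by apply: jacobian_Cmx => // l; apply: Ck_subset (FC l k.+1) => y /eP[].
Unshelve. all: by end_near. Qed.

End Local.
End InverseFunction.

(** * Tensors invariant under the orthogonal Lie algebra *)

Section InvariantIndices.
Context (R : realType) (n : nat) (n_ge3 : (3 <= n)%N) (eps : 'I_n -> R).
Hypothesis eps_neq0 : forall i, eps i != 0.

Lemma third_index (a b : 'I_n) : exists c, (c != a) && (c != b).
Proof.
have : (0 < #|predC (pred2 a b)|)%N.
  rewrite -(ltn_add2l #|pred2 a b|) addn0 cardC card_ord card2.
  by apply: leq_ltn_trans n_ge3; case: (a != b).
by case/card_gt0P => c; rewrite !inE negb_or; exists c.
Qed.

(* Action of the infinitesimal rotation in the plane of [a] and [b] on the slot
   holding [i] of a covariant tensor; [F] is the tensor as a function of that slot. *)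
Definition rot (a b i : 'I_n) (F : 'I_n -> R) : R :=
  (i == b)%:R * eps b * F a - (i == a)%:R * eps a * F b.

Lemma neqF (a b : 'I_n) : a != b -> ((a == b) = false) * ((b == a) = false).
Proof. by move=> ab; rewrite [b == a]eq_sym (negbTE ab). Qed.

Lemma invariant2 (h : 'I_n -> 'I_n -> R) :
  (forall a b i j, a != b -> rot a b i (h^~ j) + rot a b j (h i) = 0) ->
  exists lam, forall i j, h i j = lam * (i == j)%:R * eps i.
Proof.
move=> H.
have eps0 e x : eps e * x = 0 -> x = 0.
  by move/eqP; rewrite mulf_eq0 (negbTE (eps_neq0 e))/= => /eqP.
have offdiag i j : i != j -> h i j = 0.
  move=> ij; have [c /andP[ci cj]] := third_index i j.
  have := H i c c j; rewrite eq_sym => /(_ ci).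
  rewrite /rot !eqxx !(neqF ci) !(neqF cj) ?(neqF ij).
  by rewrite !mul0r mul1r !subr0 addr0 => /eps0.
have diag i j : h i i * eps j = h j j * eps i.
  have [->//|ij] := eqVneq i j.
  have := H i j i j ij; rewrite /rot !eqxx !(neqF ij) !mul0r !mul1r sub0r subr0.
  by rewrite addrC => /eqP; rewrite subr_eq0 [eps i * _]mulrC [eps j * _]mulrC => /eqP.
exists (h (Ordinal (leq_trans (isT : 0 < 3)%N n_ge3)) (Ordinal (leq_trans (isT : 0 < 3)%N n_ge3)) / eps (Ordinal (leq_trans (isT : 0 < 3)%N n_ge3))).
move=> i j; set o := Ordinal _; have [->|ij] := eqVneq i j; last first.
  by rewrite offdiag// mulr0 mul0r.
by rewrite mulr1 mulrAC -diag mulfK.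
Qed.

(** Entries with a repeated index die by a plane through an auxiliary index. On distinct indices
    invariance makes [T] skew in its first two slots, which clashes with symmetry in the last
    two. *)
Lemma invariant3 (T : 'I_n -> 'I_n -> 'I_n -> R) :
  (forall i j k, T i j k = T i k j) ->
  (forall a b i j k, a != b ->
     rot a b i (fun m => T m j k) + rot a b j (fun m => T i m k) + rot a b k (T i j) = 0) ->
  forall i j k, T i j k = 0.
Proof.
move=> sym H.
have eps0 e x : eps e * x = 0 -> x = 0.
  by move/eqP; rewrite mulf_eq0 (negbTE (eps_neq0 e))/= => /eqP.
have simp := (mul0r, mul1r, subr0, oppr0, sub0r, addr0, add0r).
have T1 b i : i != b -> T b i i = 0.
  move=> ib; have [a /andP[ai ab]] := third_index i b.
  have := H b a a i i; rewrite eq_sym => /(_ ab).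
  by rewrite /rot !eqxx !(neqF ab) !(neqF ai) !(neqF ib) !simp => /eps0.
have T2 i j : i != j -> T i i j = 0.
  move=> ij; have [a /andP[ai aj]] := third_index i j.
  have := H j a i i a; rewrite eq_sym => /(_ aj).
  by rewrite /rot !eqxx !(neqF aj) !(neqF ai) !(neqF ij) !simp  => /eps0.
have T3 b : T b b b = 0.
  have [a /andP[ab _]] := third_index b b.
  have := H a b a b b ab; rewrite /rot !eqxx !(neqF ab) !simp (sym a b a) !(T2 a b ab) !mulr0 !addr0.
  by move/eqP; rewrite oppr_eq0 => /eqP/eps0.
have T4 b i j : i != b -> j != b -> i != j -> T b i j = - T i b j.
  move=> ib jb ij; have := H i b i i j ib.
  rewrite /rot !eqxx !(neqF ib) !(neqF jb) !(neqF ij) !simp -opprD -mulrDr.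
  by move=> /eqP; rewrite oppr_eq0 => /eqP/eps0/eqP; rewrite addr_eq0 => /eqP.
move=> i j k; have [->|jk] := eqVneq j k.
  by have [->|ki] := eqVneq k i; [exact: T3|exact: T1].
have [->|ij] := eqVneq i j; first exact: T2.
have [->|ik] := eqVneq i k; first by rewrite sym T2// eq_sym.
(* Alternating the skew and the symmetric exchange returns to the same order of indices after three
   sign changes. *)
have E : T i j k = - T i j k.
  have ji : j != i by rewrite eq_sym.
  have ki : k != i by rewrite eq_sym.
  have kj : k != j by rewrite eq_sym.
  rewrite {1}(T4 i j k ji ki jk) (sym j i) (T4 j k i kj ij ki) (sym k j).
  by rewrite (T4 k i j ik jk ij) (sym i k) opprK.
apply/eqP; have := congr1 (fun x => x + T i j k) E; rewrite addNr -mulr2n => /eqP.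
by rewrite mulrn_eq0.
Qed.

(** This is Schur's statement for algebraic curvature tensors: components not of sectional type
    vanish, and the sectional curvatures all agree. On four distinct indices [T] is totally skew, so
    the Bianchi sum becomes 3 T. *)
Lemma invariant4 (T : 'I_n -> 'I_n -> 'I_n -> 'I_n -> R) :
  (forall i s q r, T i s q r = - T s i q r) ->
  (forall i s q r, T i s q r = - T i s r q) ->
  (forall i s q r, T i s q r + T i q r s + T i r s q = 0) ->
  (forall a b i s q r, a != b ->
     rot a b i (fun m => T m s q r) + rot a b s (fun m => T i m q r) +
     rot a b q (fun m => T i s m r) + rot a b r (T i s q) = 0) ->
  exists kap, forall i s q r, T i s q r =
    kap * ((i == q)%:R * (s == r)%:R - (i == r)%:R * (s == q)%:R) * (eps i * eps s).
Proof.
move=> A1 A2 Bi H.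
have eps0 e x : eps e * x = 0 -> x = 0.
  by move/eqP; rewrite mulf_eq0 (negbTE (eps_neq0 e))/= => /eqP.
have simp := (mul0r, mul1r, subr0, oppr0, sub0r, addr0, add0r).
have self0 (x : R) : x = - x -> x = 0.
  by move=> /eqP; rewrite -addr_eq0 -mulr2n mulrn_eq0 => /eqP.
have Z1 s q r : T s s q r = 0 by apply: self0; exact: A1.
have Z2 i s q : T i s q q = 0 by apply: self0; exact: A2.
have F1 q s r : q != s -> q != r -> s != r -> T q s q r = 0.
  move=> qs qr sr; have := H q s q s s r qs.
  by rewrite /rot !eqxx !(neqF qs) !(neqF qr) !(neqF sr) !Z1 !mulr0 !simp => /eps0.
have F2 i s q r : i != s -> i != q -> i != r -> s != q -> s != r -> q != r ->
    T i s q r = 0.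
  have swap i' s' q' r' : i' != s' -> i' != q' -> i' != r' -> s' != q' -> s' != r' ->
      q' != r' -> T i' s' q' r' = - T i' q' s' r'.
    move=> i_s iq ir sq sr qr; have := H q' s' i' q' q' r'; rewrite eq_sym => /(_ sq).
    rewrite /rot !eqxx ?(neqF i_s) ?(neqF iq) ?(neqF ir) ?(neqF sq) ?(neqF sr) ?(neqF qr) !simp.
    rewrite -opprD -mulrDr => /eqP; rewrite oppr_eq0 => /eqP/eps0/eqP.
    by rewrite addr_eq0 => /eqP.
  move=> i_s iq ir sq sr qr.
  have rs : r != s by rewrite eq_sym.
  have rq : r != q by rewrite eq_sym.
  have := Bi i s q r; rewrite (A2 i q r s) -(swap i s q r)// (swap i r s q)//.
  rewrite (A2 i s r q) opprK => E.
  have /eqP : T i s q r *+ 3 = 0 by rewrite -[RHS]E !mulrS mulr0n addr0 addrA.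
  by rewrite mulrn_eq0 => /eqP.
have F3 a b r : a != b -> a != r -> b != r -> eps b * T a r a r = eps a * T b r b r.
  move=> ab ar br; have := H a b a r b r ab.
  rewrite /rot !eqxx !(neqF ab) !(neqF ar) !(neqF br) !simp addrC.
  by move=> /eqP; rewrite subr_eq0 => /eqP.
(* The sectional curvature of the plane of [a] and [r]. [F3] allows one index to be exchanged; [kk]
   connects any two planes by such exchanges. *)
pose k a r := T a r a r / (eps a * eps r).
have kC a r : k a r = k r a by rewrite /k A1 A2 opprK [eps a * _]mulrC.
have kl a b r : a != r -> b != r -> k a r = k b r.
  have [->//|ab] := eqVneq a b; move=> ar br.
  apply/eqP; rewrite /k eqr_div ?mulf_neq0// !mulrA [T a r a r * _]mulrC.
  by rewrite F3// [T b r b r * _]mulrC.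
have kk a r c d : a != r -> c != d -> k a r = k c d.
  move=> ar cd; have [cr|cr] := eqVneq c r.
    rewrite cr in cd *; have [->|da] := eqVneq d a; first by rewrite kC.
    by rewrite (kC r d); apply: kl => //; rewrite eq_sym.
  by rewrite (kl a c)// kC (kl r d) 1?eq_sym// kC.
(* [n_ge3] is convertible to 2 < n, so [Ordinal n_ge3] is the index 2; with [j1] it spans a
   reference plane. *)
have [j1 /andP[j10 _]] := third_index (Ordinal n_ge3) (Ordinal n_ge3).
set j0 := Ordinal _ in j10.
have F4 a r : a != r -> T a r a r = k j1 j0 * (eps a * eps r).
  by move=> ar; rewrite (kk j1 j0 a r j10 ar) /k divfK// mulf_neq0.
exists (k j1 j0) => i s q r.
have [->|i_s] := eqVneq i s.
  by rewrite Z1 [(s == q)%:R * _]mulrC subrr mulr0 mul0r.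
have [->|qr] := eqVneq q r; first by rewrite Z2 subrr mulr0 mul0r.
have [iq|iq] := eqVneq i q.
  subst q; rewrite (neqF qr) mul0r subr0 mul1r.
  have [sr|sr] := eqVneq s r; first by subst r; rewrite mulr1 F4.
  by rewrite mulr0 mul0r F1.
have [ir|ir] := eqVneq i r.
  subst r; rewrite mul1r mul0r sub0r A2.
  have [sq|sq] := eqVneq s q; first by subst q; rewrite mulrN1 mulNr F4.
  by rewrite oppr0 mulr0 mul0r F1 ?oppr0.
rewrite !mul0r subrr mulr0 mul0r.
have si : s != i by rewrite eq_sym.
have [sq|sq] := eqVneq s q; first by subst q; rewrite A1 F1 ?oppr0.
have [sr|sr] := eqVneq s r; last exact: F2.
by subst r; rewrite A1 A2 opprK F1.
Qed.

End InvariantIndices.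

(** * Diagonalization of symmetric bilinear forms by congruence *)

Section Diagonalization.
Context (R : realType).

Definition diagonalizable_form n (g : 'M[R]_n) :=
  exists (E : 'M[R]_n) (d : 'rV[R]_n), E \in unitmx /\ E^T *m g *m E = diag_mx d.

Lemma diagonalizable_congr n (g P : 'M[R]_n) : P \in unitmx ->
  diagonalizable_form (P^T *m g *m P) -> diagonalizable_form g.
Proof.
move=> Pu [E [d [Eu Ed]]]; exists (P *m E), d; rewrite unitmx_mul Pu Eu; split=> //.
by rewrite -Ed trmx_mul !mulmxA.
Qed.

Lemma symmetric_diagonalizable n (g : 'M[R]_n) : g^T = g -> diagonalizable_form g.
Proof.
elim: n g => [|n IH] g gs.
  by exists 1%:M, 0; rewrite unitmx1; split=> //; apply/matrixP => -[].
rewrite -[n.+1]/(1 + n)%N in g gs *.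
have sym_congr (P : 'M[R]_(1 + n)) : (P^T *m g *m P)^T = P^T *m g *m P.
  by rewrite !trmx_mul trmxK gs mulmxA.
have main (h : 'M[R]_(1 + n)) : h^T = h -> h 0 0 != 0 -> diagonalizable_form h.
  move=> hs h0; set a := h 0 0 in h0.
  pose u := ursubmx h; pose d := drsubmx h.
  have hE : h = block_mx a%:M u u^T d.
    rewrite -[LHS]submxK; congr block_mx.
      by rewrite [LHS]mx11_scalar !mxE; congr (h _ _)%:M; apply: val_inj.
    by rewrite /u trmx_ursub hs.
  (* Clears the first row and column; the Schur complement [h'] is left for the induction. *)
  pose L : 'M[R]_(1 + n) := block_mx 1%:M (- a^-1 *: u) 0 1%:M.
  have Lu : L \in unitmx by rewrite unitmxE det_ublock !det1 mulr1 unitr1.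
  apply: (diagonalizable_congr Lu).
  pose h' := d - a^-1 *: (u^T *m u).
  have -> : L^T *m h *m L = block_mx a%:M 0 0 h'.
    rewrite hE tr_block_mx !mulmx_block !trmx1 !trmx0 !mul1mx !mulmx1 !mul0mx ?mulmx0 ?addr0 ?add0r.
    have e1 : a%:M *m (- a^-1 *: u) + u = 0.
      by rewrite mul_scalar_mx scalerA mulrN divff// scaleN1r addNr.
    have e2 : (- a^-1 *: u)^T *m a%:M + u^T = 0.
      by rewrite -[a%:M]tr_scalar_mx -trmx_mul -linearD/= e1 trmx0.
    rewrite e1 e2 mul0mx add0r; congr block_mx.
    by rewrite linearZ/= -scalemxAl scaleNr addrC.
  have h's : h'^T = h'.
    by rewrite /h' linearB/= linearZ/= trmx_mul trmxK /d trmx_drsub hs.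
  have [E [e [Eu Ee]]] := IH _ h's.
  exists (block_mx 1%:M 0 0 E), (row_mx a%:M e).
  split; first by rewrite unitmxE det_ublock det1 mul1r -unitmxE.
  rewrite tr_block_mx !mulmx_block !trmx1 !trmx0 !mul1mx !mulmx1 !mul0mx ?mulmx0 ?addr0 ?add0r ?mul0mx.
  rewrite Ee diag_mx_row; congr block_mx; apply/matrixP => i j; by rewrite !ord1 !mxE !eqxx.
have diag_case (h : 'M[R]_(1 + n)) i : h^T = h -> h i i != 0 -> diagonalizable_form h.
  move=> hs hi; apply: (@diagonalizable_congr _ _ (tperm_mx 0 i)); first exact: unitmx_perm.
  apply: main; first by rewrite !trmx_mul trmxK hs mulmxA.
  by rewrite tr_tperm_mx -xcolE -xrowE !mxE perm.tpermL.
have [g0|] := pselect (g = 0).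
  by exists 1%:M, 0; rewrite unitmx1 g0 mulmx0 mul0mx; split=> //; rewrite linear0.
move=> /eqP/matrix0Pn[i [j gij]].
have [gii|gii] := eqVneq (g i i) 0; last exact: diag_case gs gii.
have [gjj|gjj] := eqVneq (g j j) 0; last exact: diag_case gs gjj.
have ij : i != j by apply/eqP => ij; move: gij; rewrite -ij gii eqxx.
(* Both diagonal entries are zero, so the i-th basis vector is replaced by the sum of the i-th and
   j-th, whose square is twice [g i j]. *)
pose P : 'M[R]_(1 + n) := 1%:M + delta_mx j i.
have Pu : P \in unitmx.
  suff : P *m (1%:M - delta_mx j i) = 1%:M by case/mulmx1_unit.
  rewrite mulmxDl mul1mx mulmxBr mulmx1 mul_delta_mx_0// subr0.
  by rewrite subrK.
apply: (diagonalizable_congr Pu); apply: (diag_case _ i); first exact: sym_congr.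
have -> : (P^T *m g *m P) i i = g i j *+ 2.
  have dl (X : 'M[R]_(1 + n)) k : (X *m delta_mx j i) k i = X k j.
    rewrite mxE (bigD1 j)//= big1 => [|l lj]; first by rewrite mxE !eqxx mulr1 addr0.
    by rewrite mxE (negbTE lj) mulr0.
  have dr (X : 'M[R]_(1 + n)) k : (delta_mx i j *m X) i k = X j k.
    rewrite mxE (bigD1 j)//= big1 => [|l lj]; first by rewrite mxE !eqxx mul1r addr0.
    by rewrite mxE (negbTE lj) andbF mul0r.
  have PT : P^T = 1%:M + delta_mx i j by rewrite /P linearD/= trmx1 trmx_delta.
  rewrite PT /P mulmxDr mulmx1 mxE dl mulmxDl mul1mx.
  rewrite mxE [X in _ + X]mxE !dr gii gjj add0r addr0 mulr2n; congr (_ + _).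
  by rewrite -{1}gs mxE.
by rewrite mulrn_eq0.
Qed.

Lemma orthonormal_basis n (g : 'M[R]_n) : g^T = g -> g \in unitmx ->
  exists (E : 'M[R]_n) (eps : 'I_n -> R), [/\ E \in unitmx,
    forall i, eps i = 1 \/ eps i = -1 & E^T *m g *m E = diag_mx (\row_i eps i)].
Proof.
move=> gs gu; have [E [d [Eu Ed]]] := symmetric_diagonalizable gs.
have d0 i : d 0 i != 0.
  have : diag_mx d \in unitmx by rewrite -Ed !unitmx_mul unitmx_tr Eu gu.
  by rewrite unitmxE det_diag unitfE => /prodf_neq0; apply.
pose s : 'rV[R]_n := \row_i (Num.sqrt `|d 0 i|)^-1.
have s0 i : Num.sqrt `|d 0 i| != 0 by rewrite sqrtr_eq0 -ltNge normr_gt0.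
exists (E *m diag_mx s), (fun i => Num.sg (d 0 i)); split.
- rewrite unitmx_mul Eu unitmxE det_diag unitfE; apply/prodf_neq0 => i _.
  by rewrite mxE invr_eq0.
- by move=> i; case: (sgrP (d 0 i)) => [d00||]; [have := d0 i; rewrite d00 eqxx|left|right].
rewrite trmx_mul tr_diag_mx !mulmxA -[_ *m E^T *m g]mulmxA -[_ *m _ *m E]mulmxA Ed.
apply/matrixP => i j; rewrite mul_diag_mx mul_mx_diag !mxE.
case: eqVneq => [<-|_]; last by rewrite !mulr0n mulr0 mul0r.
rewrite !mulr1n mulrC mulrA -invfM -expr2 sqr_sqrtr// {2}[d 0 i]numEsg.
by rewrite mulrCA mulVf ?mulr1// normr_eq0.
Qed.

End Diagonalization.

(** * The same invariants for matrices, with respect to a symmetric form g *)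

Section InvariantTensors.
Context (R : realType) (n : nat) (n_ge3 : (3 <= n)%N) (g : 'M[R]_n).
Hypotheses (g_sym : g^T = g) (g_unit : g \in unitmx).

Definition skew (J : 'M[R]_n) := J^T *m g + g *m J = 0.

Lemma skewE J : skew J -> J^T *m g = - (g *m J).
Proof. by move/eqP; rewrite addr_eq0 => /eqP. Qed.

Definition bil (X : 'M[R]_n) (u v : 'cV[R]_n) : R := (u^T *m X *m v) 0 0.

Lemma bilDX X Y u v : bil (X + Y) u v = bil X u v + bil Y u v.
Proof. by rewrite /bil mulmxDr mulmxDl mxE. Qed.
Lemma bilNX X u v : bil (- X) u v = - bil X u v.
Proof. by rewrite /bil mulmxN mulNmx mxE. Qed.
Lemma bil_sumX (I : Type) (r : seq I) (c : I -> R) (X : I -> 'M[R]_n) u v :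
  bil (\sum_(i <- r) c i *: X i) u v = \sum_(i <- r) c i * bil (X i) u v.
Proof.
rewrite /bil mulmx_sumr mulmx_suml summxE; apply: eq_bigr => i _.
by rewrite -scalemxAr -scalemxAl mxE.
Qed.
Lemma bilBl X x y u u' v : bil X (x *: u - y *: u') v = x * bil X u v - y * bil X u' v.
Proof.
by rewrite /bil [(_ - _)^T]linearB/= ![(_ *: _)^T]linearZ/= !mulmxBl -!scalemxAl mxE [X in X + _]mxE
  [X in _ + X]mxE [X in _ - X]mxE.
Qed.
Lemma bilBr X x y u v v' : bil X u (x *: v - y *: v') = x * bil X u v - y * bil X u v'.
Proof. by rewrite /bil mulmxBr -!scalemxAr mxE [X in X + _]mxE
  [X in _ + X]mxE [X in _ - X]mxE. Qed.
Lemma bil_mull X J u v : bil X (J *m u) v = bil (J^T *m X) u v.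
Proof. by rewrite /bil trmx_mul !mulmxA. Qed.
Lemma bil_mulr X J u v : bil X u (J *m v) = bil (X *m J) u v.
Proof. by rewrite /bil !mulmxA. Qed.

Section Basis.
Context (E : 'M[R]_n) (eps : 'I_n -> R).
Hypotheses (E_unit : E \in unitmx) (eps_neq0 : forall i, eps i != 0).
Hypothesis EgE : E^T *m g *m E = diag_mx (\row_i eps i).

Let f a := col a E.

Lemma bil_basis X a b : bil X (col a E) (col b E) = (E^T *m X *m E) a b.
Proof.
transitivity (((delta_mx 0 a : 'rV[R]_n) *m (E^T *m X *m E) *m (delta_mx b 0 : 'cV[R]_n)) 0 0).
  by rewrite /bil /f !colE trmx_mul trmx_delta !mulmxA.
by rewrite -rowE -colE mxE mxE.
Qed.

(** The infinitesimal rotation in the plane of two columns of [E]. By [rotation_basis] it acts on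
    the basis as [rot] prescribes, which reduces the matrix statements to those on indices. *)
Definition rotation a b : 'M[R]_n :=
  col a E *m (col b E)^T *m g - col b E *m (col a E)^T *m g.

Lemma rotation_skew a b : skew (rotation a b).
Proof.
rewrite /skew /rotation linearB/= !trmx_mul !trmxK g_sym.
by rewrite mulmxBl mulmxBr !mulmxA addrC addrA subrK subrr.
Qed.

Lemma rotation_basis a b c : rotation a b *m col c E =
  ((c == b)%:R * eps b) *: col a E - ((c == a)%:R * eps a) *: col b E.
Proof.
have H d e : f d *m (f e)^T *m g *m f c = ((c == e)%:R * eps e) *: f d.
  rewrite -!mulmxA [(f e)^T *m _]mx11_scalar mul_mx_scalar; congr (_ *: _).
  rewrite mulmxA -/(bil g (f e) (f c)) bil_basis EgE !mxE eq_sym.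
  by case: eqVneq => _; rewrite ?mul1r ?mul0r ?mulr1n ?mulr0n.
by rewrite /rotation mulmxBl !H.
Qed.

Let rot_form a b c (F : 'cV[R]_n -> R) :
  (forall x y u v, F (x *: u - y *: v) = x * F u - y * F v) ->
  F (rotation a b *m f c) = rot eps a b c (fun m => F (f m)).
Proof. by move=> linF; rewrite rotation_basis linF. Qed.

Let basis_inj (X : 'I_n -> 'M[R]_n) :
  (forall c, \sum_q E q c *: X q = 0) -> forall q, X q = 0.
Proof.
move=> H q.
have : \sum_c invmx E c q *: (\sum_l E l c *: X l) = 0.
  by rewrite big1// => c _; rewrite H scaler0.
under eq_bigr do rewrite scaler_sumr.
rewrite exchange_big/= (bigD1 q)//= [X in _ + X]big1 => [|l lq].
  under eq_bigr do rewrite scalerA mulrC.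
  rewrite -scaler_suml (_ : \sum_i _ = (E *m invmx E) q q); last by rewrite mxE.
  by rewrite mulmxV// mxE eqxx scale1r addr0.
under eq_bigr do rewrite scalerA mulrC.
rewrite -scaler_suml (_ : \sum_i _ = (E *m invmx E) l q); last by rewrite mxE.
by rewrite mulmxV// mxE (negbTE lq) scale0r.
Qed.

Let congr_inj (X : 'M[R]_n) : E^T *m X *m E = 0 -> X = 0.
Proof.
move=> /(congr1 (fun Y => invmx E^T *m Y *m invmx E)).
by rewrite mulmx0 mul0mx !mulmxA mulVmx ?unitmx_tr// mul1mx mulmxK.
Qed.

(** Commuting with skew matrices makes the bilinear form of [g *m A] invariant, hence a multiple of
    g. *)
Lemma commutant_scalar_basis (A : 'M[R]_n) :
  (forall J, skew J -> J *m A = A *m J) -> exists lam, A = lam%:M.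
Proof.
move=> AJ.
have [|lam hE] := invariant2 n_ge3 eps_neq0 (h := fun i j => bil (g *m A) (f i) (f j)).
  move=> a b i j ab.
  have lin1 := rot_form a b i (F := fun u => bil (g *m A) u (f j)) (fun x y u v => bilBl (g *m A) x y u v (f j)).
  have lin2 := rot_form a b j (F := fun v => bil (g *m A) (f i) v) (fun x y u v => bilBr (g *m A) x y (f i) u v).
  rewrite -lin1 -lin2.
  rewrite bil_mull bil_mulr -bilDX -!mulmxA -AJ; last exact: rotation_skew.
  rewrite !mulmxA -mulmxDl rotation_skew mul0mx.
  by rewrite /bil mulmx0 mul0mx mxE.
exists lam; suff : g *m (A - lam%:M) = 0.
  move=> /(congr1 (mulmx (invmx g))); rewrite mulKmx// mulmx0 => /eqP.
  by rewrite subr_eq0 => /eqP.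
apply: congr_inj; rewrite mulmxBr mulmxBr mulmxBl mul_mx_scalar -scalemxAr -scalemxAl EgE.
apply/matrixP => i j; rewrite mxE -bil_basis hE !mxE.
by case: eqVneq => _; rewrite ?mulr1n ?mulr0n ?mulr1 ?mulr0 ?mul0r subrr.
Qed.

Lemma invariant_form3_basis (T : 'I_n -> 'M[R]_n) : (forall l, (T l)^T = T l) ->
  (forall J, skew J -> forall l,
     \sum_k J k l *: T k + J^T *m T l + T l *m J = 0) ->
  forall l, T l = 0.
Proof.
move=> Ts TJ.
(* The family [T] as a trilinear form on vectors, so that invariance can be evaluated on the columns
   of [E]. *)
pose tri (u v w : 'cV[R]_n) := \sum_l u l 0 * bil (T l) v w.
have triB1 v w (x y : R) (u u' : 'cV[R]_n) : tri (x *: u - y *: u') v w = x * tri u v w - y * tri u' v w.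
  rewrite /tri !mulr_sumr -sumrB; apply: eq_bigr => l _; rewrite !mxE; ring.
have triB2 u w (x y : R) (v v' : 'cV[R]_n) : tri u (x *: v - y *: v') w = x * tri u v w - y * tri u v' w.
  rewrite /tri !mulr_sumr -sumrB; apply: eq_bigr => l _; rewrite bilBl; ring.
have triB3 u v (x y : R) (w w' : 'cV[R]_n) : tri u v (x *: w - y *: w') = x * tri u v w - y * tri u v w'.
  rewrite /tri !mulr_sumr -sumrB; apply: eq_bigr => l _; rewrite bilBr; ring.
have triJ J u v w : skew J ->
    tri (J *m u) v w + tri u (J *m v) w + tri u v (J *m w) = 0.
  move=> Js.
  have -> : tri (J *m u) v w = \sum_l u l 0 * bil (\sum_k J k l *: T k) v w.
    rewrite /tri; under eq_bigr do rewrite mxE mulr_suml.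
    rewrite exchange_big/=; apply: eq_bigr => l _; rewrite bil_sumX mulr_sumr.
    by apply: eq_bigr => k _; ring.
  rewrite /tri -!big_split big1// => l _ /=.
  rewrite bil_mull bil_mulr -!mulrDr -!bilDX TJ//.
  by rewrite /bil mulmx0 mul0mx mxE mulr0.
have T0 : forall i j k, tri (f i) (f j) (f k) = 0.
  apply: (invariant3 n_ge3 eps_neq0) => [i j k|a b i j k ab].
    apply: eq_bigr => l _; congr (_ * _).
    by rewrite /bil -[RHS]trace_mx11 -[in RHS]mxtrace_tr !trmx_mul trmxK Ts mulmxA trace_mx11.
  rewrite -(rot_form a b i (F := fun u => tri u (f j) (f k)) (triB1 (f j) (f k))).
  rewrite -(rot_form a b j (F := fun u => tri (f i) u (f k)) (triB2 (f i) (f k))).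
  rewrite -(rot_form a b k (F := fun u => tri (f i) (f j) u) (triB3 (f i) (f j))).
  exact/triJ/rotation_skew.
apply: basis_inj => c; apply: congr_inj; apply/matrixP => i j.
rewrite -bil_basis bil_sumX mxE -[RHS](T0 c i j); apply: eq_bigr => l _.
by rewrite [f c]lock -lock mxE.
Qed.

(** Lowering the upper index by g turns [K] into a quadrilinear form with the symmetries required by
    [invariant4]. Its value on the orthogonal basis is then carried back to coordinates by stripping
    [E] from both index slots. *)
Lemma invariant_curvature_basis (K : 'I_n -> 'I_n -> 'M[R]_n) :
  (forall q r, skew (K q r)) -> (forall q r, K q r = - K r q) ->
  (forall i s q r, K q r i s + K r s i q + K s q i r = 0) ->
  (forall J, skew J -> forall q r, J *m K q r - K q r *m J =
     \sum_k J k q *: K k r + \sum_k J k r *: K q k) ->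
  exists kap, forall q r, K q r =
    kap *: (delta_mx q 0 *m (delta_mx r 0 : 'cV[R]_n)^T *m g -
            delta_mx r 0 *m (delta_mx q 0 : 'cV[R]_n)^T *m g).
Proof.
move=> Ks Ka Kb KJ.
pose tri (L : 'I_n -> 'I_n -> 'M[R]_n) (u v w z : 'cV[R]_n) :=
  \sum_q \sum_r w q 0 * z r 0 * bil (g *m L q r) u v.
have triB1 v w z (x y : R) (u u' : 'cV[R]_n) :
    tri K (x *: u - y *: u') v w z = x * tri K u v w z - y * tri K u' v w z.
  rewrite /tri !mulr_sumr -sumrB; apply: eq_bigr => q _.
  by rewrite !mulr_sumr -sumrB; apply: eq_bigr => r _; rewrite bilBl; ring.
have triB2 u w z (x y : R) (v v' : 'cV[R]_n) :
    tri K u (x *: v - y *: v') w z = x * tri K u v w z - y * tri K u v' w z.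
  rewrite /tri !mulr_sumr -sumrB; apply: eq_bigr => q _.
  by rewrite !mulr_sumr -sumrB; apply: eq_bigr => r _; rewrite bilBr; ring.
have triB3 u v z (x y : R) (w w' : 'cV[R]_n) :
    tri K u v (x *: w - y *: w') z = x * tri K u v w z - y * tri K u v w' z.
  rewrite /tri !mulr_sumr -sumrB; apply: eq_bigr => q _.
  by rewrite !mulr_sumr -sumrB; apply: eq_bigr => r _; rewrite !mxE; ring.
have triB4 u v w (x y : R) (z z' : 'cV[R]_n) :
    tri K u v w (x *: z - y *: z') = x * tri K u v w z - y * tri K u v w z'.
  rewrite /tri !mulr_sumr -sumrB; apply: eq_bigr => q _.
  by rewrite !mulr_sumr -sumrB; apply: eq_bigr => r _; rewrite !mxE; ring.
have triJ J u v w z : skew J -> tri K (J *m u) v w z + tri K u (J *m v) w z +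
    tri K u v (J *m w) z + tri K u v w (J *m z) = 0.
  move=> Js.
  have -> : tri K u v (J *m w) z = tri (fun q r => \sum_k J k q *: K k r) u v w z.
    rewrite /tri; under eq_bigr do under eq_bigr do rewrite mxE !mulr_suml.
    under eq_bigr do rewrite exchange_big/=.
    rewrite exchange_big/=; apply: eq_bigr => q _; rewrite exchange_big/=; apply: eq_bigr => r _.
    rewrite mulmx_sumr; under [in RHS]eq_bigr do rewrite -scalemxAr.
    by rewrite bil_sumX mulr_sumr; apply: eq_bigr => k _; ring.
  have -> : tri K u v w (J *m z) = tri (fun q r => \sum_k J k r *: K q k) u v w z.
    rewrite /tri; apply: eq_bigr => q _; under eq_bigr do rewrite mxE mulr_sumr mulr_suml.
    rewrite exchange_big/=; apply: eq_bigr => r _.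
    rewrite mulmx_sumr; under [in RHS]eq_bigr do rewrite -scalemxAr.
    by rewrite bil_sumX mulr_sumr; apply: eq_bigr => k _; ring.
  rewrite /tri -!big_split big1// => q _; rewrite -!big_split big1// => r _ /=.
  rewrite bil_mull bil_mulr -!mulrDr -!bilDX -addrA -mulmxDr -KJ//.
  rewrite mulmxBr !mulmxA (skewE Js) mulNmx [- _ + _]addrC addrA subrK subrr.
  by rewrite /bil mulmx0 mul0mx mxE mulr0.
have swap12 u v w z : tri K u v w z = - tri K v u w z.
  rewrite /tri -sumrN; apply: eq_bigr => q _; rewrite -sumrN; apply: eq_bigr => r _.
  rewrite -mulrN -bilNX -(skewE (Ks q r)); congr (_ * _).
  by rewrite /bil -[RHS]trace_mx11 -[in RHS]mxtrace_tr !trmx_mul !trmxK g_sym trace_mx11 !mulmxA.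
have swap34 u v w z : tri K u v w z = - tri K u v z w.
  rewrite /tri exchange_big/= -sumrN; apply: eq_bigr => q _; rewrite -sumrN; apply: eq_bigr => r _.
  by rewrite -mulrN -bilNX -mulmxN -Ka [w _ _ * _]mulrC.
have rotate3 (H : 'I_n -> 'I_n -> 'I_n -> R) :
    \sum_a \sum_b \sum_c H a b c = \sum_c \sum_a \sum_b H a b c.
  by under eq_bigr do rewrite exchange_big/=; rewrite exchange_big.
have bianchi u v w z : tri K u v w z + tri K u w z v + tri K u z v w = 0.
  have E3 (v' w' z' : 'cV[R]_n) : tri K u v' w' z' =
      \sum_s \sum_q \sum_r v' s 0 * w' q 0 * z' r 0 * (\sum_i (u^T *m g) 0 i * K q r i s).
    rewrite [RHS]exchange_big/=; apply: eq_bigr => q _.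
    rewrite [RHS]exchange_big/=; apply: eq_bigr => r _.
    rewrite /bil !mulmxA mxE mulr_sumr; apply: eq_bigr => s _.
    by rewrite [(_ *m K q r) 0 s]mxE; ring.
  rewrite !E3 [X in _ + X + _]rotate3 [X in _ + _ + X]rotate3 [X in _ + _ + X]rotate3.
  rewrite -!big_split big1// => s _; rewrite -!big_split big1// => q _.
  rewrite -!big_split big1// => r _ /=.
  transitivity (v s 0 * w q 0 * z r 0 *
      (\sum_i (u^T *m g) 0 i * (K q r i s + K r s i q + K s q i r))).
    under [in RHS]eq_bigr do rewrite !mulrDr.
    by rewrite !big_split/=; ring.
  by rewrite big1 ?mulr0// => i _; rewrite Kb mulr0.
have [||||lam triE] := invariant4 n_ge3 eps_neq0
   (T := fun i s q r => tri K (f i) (f s) (f q) (f r)).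
- by move=> i s q r; exact: swap12.
- by move=> i s q r; exact: swap34.
- by move=> i s q r; exact: bianchi.
- move=> a b i s q r ab.
  rewrite -(rot_form a b i (F := fun u => tri K u (f s) (f q) (f r)) (triB1 _ _ _)).
  rewrite -(rot_form a b s (F := fun u => tri K (f i) u (f q) (f r)) (triB2 _ _ _)).
  rewrite -(rot_form a b q (F := fun u => tri K (f i) (f s) u (f r)) (triB3 _ _ _)).
  rewrite -(rot_form a b r (F := fun u => tri K (f i) (f s) (f q) u) (triB4 _ _ _)).
  exact/triJ/rotation_skew.
exists lam.
pose P q r := delta_mx q 0 *m (delta_mx r 0 : 'cV[R]_n)^T *m g -
              delta_mx r 0 *m (delta_mx q 0 : 'cV[R]_n)^T *m g.
have fE c : f c = \sum_q E q c *: delta_mx q 0.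
  apply/colP => i; rewrite summxE (bigD1 i)//= big1 => [|l li].
    by rewrite !mxE !eqxx mulr1 addr0.
  by rewrite !mxE eq_sym (negbTE li) mulr0.
have ffE c d : f c *m (f d)^T *m g =
    \sum_q E q c *: \sum_r E r d *: (delta_mx q 0 *m (delta_mx r 0 : 'cV[R]_n)^T *m g).
  rewrite (fE c) !mulmx_suml; apply: eq_bigr => q _; rewrite -!scalemxAl; congr (_ *: _).
  rewrite (fE d) linear_sum/= mulmx_sumr mulmx_suml; apply: eq_bigr => r _.
  by rewrite linearZ/= -scalemxAr -scalemxAl.
have sumP c d : \sum_q E q c *: (\sum_r E r d *: P q r) = rotation c d.
  rewrite /rotation !ffE [X in _ = _ - X](_ : _ = \sum_q E q c *: (\sum_r E r d *:
     (delta_mx r 0 *m (delta_mx q 0 : 'cV[R]_n)^T *m g))).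
    by rewrite -sumrB; apply: eq_bigr => q _; rewrite -scalerBr -sumrB; congr (_ *: _);
       apply: eq_bigr => r _; rewrite -scalerBr.
  under eq_bigr do rewrite scaler_sumr; rewrite exchange_big/=.
  by apply: eq_bigr => q _; rewrite scaler_sumr; apply: eq_bigr => r _; rewrite !scalerA mulrC.
have main c d : \sum_q E q c *: (\sum_r E r d *: (K q r - lam *: P q r)) = 0.
  have -> : \sum_q E q c *: (\sum_r E r d *: (K q r - lam *: P q r)) =
      \sum_q E q c *: (\sum_r E r d *: K q r) - lam *: rotation c d.
    rewrite -sumP scaler_sumr -sumrB; apply: eq_bigr => q _.
    rewrite scalerA mulrC -scalerA -scalerBr; congr (_ *: _); rewrite scaler_sumr -sumrB.
    by apply: eq_bigr => r _; rewrite scalerBr !scalerA mulrC.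
  suff H : g *m (\sum_q E q c *: (\sum_r E r d *: K q r) - lam *: rotation c d) = 0.
    by rewrite -[LHS](mulKmx g_unit) H mulmx0.
  apply: congr_inj; apply/matrixP => i s; rewrite -bil_basis mulmxBr bilDX bilNX [RHS]mxE.
  have -> : bil (g *m (\sum_q E q c *: (\sum_r E r d *: K q r))) (f i) (f s) =
      tri K (f i) (f s) (f c) (f d).
    rewrite mulmx_sumr; under eq_bigr do rewrite -scalemxAr.
    rewrite bil_sumX; apply: eq_bigr => q _.
    rewrite mulmx_sumr; under eq_bigr do rewrite -scalemxAr.
    by rewrite bil_sumX mulr_sumr; apply: eq_bigr => r _; rewrite !mxE mulrA.
  have -> : bil (g *m (lam *: rotation c d)) (f i) (f s) =
      lam * (bil g (f i) (rotation c d *m f s)).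
    by rewrite bil_mulr -scalemxAr /bil -scalemxAr -scalemxAl mxE.
  have es x : (s == x)%:R * eps x = (s == x)%:R * eps s.
    by case: eqVneq => [->//|_]; rewrite !mul0r.
  have ed x : eps i *+ (i == x) = eps i * (i == x)%:R by rewrite mulr_natr.
  by rewrite rotation_basis bilBr !bil_basis EgE triE !mxE !es !ed; ring.
move=> q r; apply/eqP; rewrite -subr_eq0 -/(P q r); apply/eqP.
have H c : \sum_r E r c *: (K q r - lam *: P q r) = 0.
  apply: (basis_inj (X := fun q => \sum_r E r c *: (K q r - lam *: P q r))) => d.
  exact: main.
exact: (basis_inj (X := fun r => K q r - lam *: P q r) H).
Qed.

End Basis.
Lemma sign_basis : exists (E : 'M[R]_n) (eps : 'I_n -> R),
  [/\ E \in unitmx, forall i, eps i != 0 & E^T *m g *m E = diag_mx (\row_i eps i)].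
Proof.
have [E [eps [Eu epsE EgE]]] := orthonormal_basis g_sym g_unit.
exists E, eps; split=> // i; case: (epsE i) => ->; first exact: oner_neq0.
by rewrite oppr_eq0 oner_neq0.
Qed.

Lemma commutant_scalar (A : 'M[R]_n) :
  (forall J, skew J -> J *m A = A *m J) -> exists lam, A = lam%:M.
Proof.
by have [E [eps [Eu eps0 EgE]]] := sign_basis; exact: commutant_scalar_basis Eu eps0 EgE _.
Qed.

Lemma invariant_form3 (T : 'I_n -> 'M[R]_n) : (forall l, (T l)^T = T l) ->
  (forall J, skew J -> forall l,
     \sum_k J k l *: T k + J^T *m T l + T l *m J = 0) ->
  forall l, T l = 0.
Proof.
by have [E [eps [Eu eps0 EgE]]] := sign_basis; exact: invariant_form3_basis Eu eps0 EgE _.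
Qed.

Lemma invariant_curvature (K : 'I_n -> 'I_n -> 'M[R]_n) :
  (forall q r, skew (K q r)) -> (forall q r, K q r = - K r q) ->
  (forall i s q r, K q r i s + K r s i q + K s q i r = 0) ->
  (forall J, skew J -> forall q r, J *m K q r - K q r *m J =
     \sum_k J k q *: K k r + \sum_k J k r *: K q k) ->
  exists kap, forall q r, K q r =
    kap *: (delta_mx q 0 *m (delta_mx r 0 : 'cV[R]_n)^T *m g -
            delta_mx r 0 *m (delta_mx q 0 : 'cV[R]_n)^T *m g).
Proof.
by have [E [eps [Eu eps0 EgE]]] := sign_basis; exact: invariant_curvature_basis Eu eps0 EgE _.
Qed.

End InvariantTensors.

(** * Stereographic coordinates in constant curvature *)

(** In a full rank factorization P = C Q, idempotence gives Q C = 1, so the trace is the rank; in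
    characteristic zero the rank is then one. *)
Lemma idempotent_trace1 (R : realType) m (P : 'M[R]_m) :
  P *m P = P -> \tr P = 1 -> exists (c : 'cV[R]_m) (t : 'rV[R]_m), P = c *m t.
Proof.
move=> PP trP.
have [r [C [Q [B [B' [PE BC QB]]]]]] : exists r (C : 'M[R]_(m, r)) (Q : 'M[R]_(r, m))
    (B : 'M[R]_(r, m)) (B' : 'M[R]_(m, r)),
    [/\ P = C *m Q, B *m C = 1%:M & Q *m B' = 1%:M].
  have /row_fullP[B BC] := col_base_full P.
  have /row_freeP[B' QB] := row_base_free P.
  by exists (\rank P), (col_base P), (row_base P), B, B'; rewrite mulmx_base.
have QC : Q *m C = 1%:M.
  have : B *m (P *m P) *m B' = B *m P *m B' by rewrite PP.
  by rewrite PE !mulmxA BC !mul1mx QB -mulmxA QB mulmx1.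
have trQC : r%:R = 1 :> R by rewrite -[RHS]trP PE mxtrace_mulC QC mxtrace1.
have r1 : r = 1%N by apply/eqP; rewrite -(eqr_nat R) trQC eqxx.
by subst r; exists C, Q.
Qed.

Lemma positive_ball (R : realType) n (f : 'rV[R]_n -> R) y (e : R) : 0 < e ->
  {for y, continuous f} -> 0 < f y ->
  exists2 d, 0 < d & d <= e /\ forall z, ball y d z -> 0 < f z.
Proof.
move=> e0 fc fy.
have {}fc : f z @[z --> y] --> f y by exact: fc.
have : nbhs y [set z | 0 < f z] by exact: cvgr_gt fc _ fy.
move=> /nbhs_ballP[d /= d0 dP]; exists (Num.min d e); first by rewrite lt_min d0.
by split=> [|z Bz]; [rewrite ge_min lexx orbT|apply/dP/(le_ball _ Bz); rewrite ge_min lexx].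
Qed.

Section StereographicIdentities.
Context (R : realType).

(** These identities remain once the sums over the first n coordinates are eliminated by the
    quadric: 1 - x0^2, - x0 a0 and g - a0 b0 are the values of those sums. Here [x0] is the
    coordinate along the pole, [a0] and [b0] its derivatives in two directions. *)
Lemma stereographic_conformal (c x0 : R) : 1 + x0 != 0 ->
  2^-1 * c ^+ 2 + 2^-1 * (c ^+ 2 * (1 + x0)^-1 ^+ 2 * (1 - x0 ^+ 2)) = c ^+ 2 / (1 + x0).
Proof. by move=> H; field. Qed.

Lemma stereographic_radial (c x0 a0 : R) : 1 + x0 != 0 ->
  c ^+ 2 * ((1 + x0)^-1 ^+ 2 * - (x0 * a0) - (1 + x0)^-1 ^+ 3 * a0 * (1 - x0 ^+ 2)) =
  - (c ^+ 2 * (1 + x0)^-1 ^+ 2 * a0).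
Proof. by move=> H; field. Qed.

Lemma stereographic_metric (c x0 a0 b0 g : R) : 1 + x0 != 0 ->
  c ^+ 2 * ((1 + x0)^-1 ^+ 2 * (g - a0 * b0) - (1 + x0)^-1 ^+ 3 * a0 * - (x0 * b0) -
    (1 + x0)^-1 ^+ 3 * b0 * - (x0 * a0) + (1 + x0)^-1 ^+ 4 * (a0 * b0) * (1 - x0 ^+ 2)) =
  c ^+ 2 * (1 + x0)^-1 ^+ 2 * g.
Proof. by move=> H; field. Qed.

(** [ga] and [ga0] are the connection terms of the Hessians of [x] and [x0]; the differences
    [ga - g * x] and [ga0 - g * x0] are the second derivatives, because a linear coordinate on the
    quadric has covariant Hessian - x G. *)
Lemma stereographic_geodesic (c x0 a0 b0 a b x g ga ga0 : R) : 1 + x0 != 0 -> c != 0 ->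
  let h := (1 + x0)^-1 in
  let Fa := c * (a * h - x * (h * h * a0)) in
  let Fb := c * (b * h - x * (h * h * b0)) in
  c * ((ga - g * x) * h + a * - (h * h * b0) -
     (b * (h * h * a0) + x * ((- (h * h * b0) * h + h * - (h * h * b0)) * a0 +
                              h * h * (ga0 - g * x0)))) -
  c * (ga * h - x * (h * h * ga0)) =
  (c ^+ 2 / (1 + x0))^-1 * (- (c ^+ 2 * h ^+ 2 * a0) * Fb - c ^+ 2 * h ^+ 2 * b0 * Fa -
     c * (x * h) * (c ^+ 2 * h ^+ 2 * g)).
Proof. by move=> H c0 /=; field; rewrite H c0. Qed.

End StereographicIdentities.

Lemma trmx_scalar11 (R : realType) (X : 'M[R]_1) : X^T = X.
Proof. by rewrite [X]mx11_scalar tr_scalar_mx. Qed.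

(* [C s k r] stands for Gamma^k_{sr}(y): the left-hand side is the covariant
   Hessian of the i-th component of [F]. *)
Definition stereographic_equation (R : realType) n (C : 'I_n -> 'M[R]_n)
    (eps : 'I_n -> R) (F : 'rV[R]_n -> 'rV[R]_n) y :=
  let d r i := partial r (fun z => F z 0 i) in forall r s i,
    partial s (d r i) y - \sum_k C s k r * d k i y =
    (normal_f eps (F y))^-1 *
      (\sum_p eps p * F y 0 p * (d r p y * d s i y + d s p y * d r i y) -
       F y 0 i * \sum_p eps p * d r p y * d s p y).

(** * Parallel endomorphisms of the cone bundle *)

Section Development.
Context (R : realType) (n : nat) (n_ge2 : (2 <= n)%N).
Context (y0 : 'rV[R]_n) (e : R) (e_gt0 : 0 < e).
Context (G : 'rV[R]_n -> 'M[R]_n) (Gam : 'I_n -> 'rV[R]_n -> 'M[R]_n).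

Definition ebase (r : 'I_n) : 'cV[R]_n := delta_mx r 0.

(** The matrix of the connection on TM + R sending (v, f) to the pair of the covariant derivative of
    v plus f e_r and the derivative of f minus G(e_r, v). In curvature one its own curvature
    vanishes. *)
Definition cone_connection r y : 'M[R]_(n + 1) :=
  block_mx (Gam r y) (ebase r) (- ((ebase r)^T *m G y)) 0.
Definition cone_metric y : 'M[R]_(n + 1) := block_mx (G y) 0 0 1%:M.

Definition parallel (X : 'rV[R]_n -> 'M[R]_(n + 1)) (W : set 'rV[R]_n) :=
  smx W X /\ forall r y, W y ->
    mderiv r X y (X y *m cone_connection r y - cone_connection r y *m X y).

Let W := ball y0 e.

Hypotheses (G_smooth : smx W G) (Gam_smooth : forall r, smx W (Gam r)).
Hypotheses (G_sym : forall y, W y -> (G y)^T = G y)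
  (G_unit : forall y, W y -> G y \in unitmx).
Hypothesis G_parallel : forall r y, W y ->
  mderiv r G y ((Gam r y)^T *m G y + G y *m Gam r y).
(** [B] is the covariant derivative of the Killing field [h], and the equation for [B] says that its
    covariant derivative is the curvature applied to the pair (e_r, h), for curvature one. *)
Hypothesis killing : forall (h0 : 'cV[R]_n) (B0 : 'M[R]_n), skew (G y0) B0 ->
  exists (h : 'rV[R]_n -> 'cV[R]_n) (B : 'rV[R]_n -> 'M[R]_n),
  [/\ smx W h, smx W B, h y0 = h0, B y0 = B0 &
    forall y, W y -> skew (G y) (B y) /\ forall r,
      mderiv r h y (B y *m ebase r - Gam r y *m h y) /\
      mderiv r B y (B y *m Gam r y - Gam r y *m B y +
                    (ebase r *m (h y)^T *m G y - h y *m (ebase r)^T *m G y))].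
Hypothesis parallel_unique : forall X, parallel X W -> X y0 = 0 ->
  forall y, W y -> X y = 0.

Let oW : open W. Proof. exact: ball_open. Qed.
Let bW : boxed W. Proof. exact: ball_boxed. Qed.
Let Wy0 : W y0. Proof. exact: ballxx. Qed.

Let N := cone_connection.
Let H := cone_metric.

Lemma parallelM X Y V : open V -> parallel X V -> parallel Y V ->
  parallel (fun y => X y *m Y y) V.
Proof.
move=> oV [Xs Xd] [Ys Yd]; split; first exact: smxM.
move=> r y Vy; have := mderivM (Xd r y Vy) (Yd r y Vy).
by rewrite mulmxBl mulmxBr !mulmxA addrC addrA subrK.
Qed.

Lemma parallelB X Y V : open V -> parallel X V -> parallel Y V ->
  parallel (fun y => X y - Y y) V.
Proof.
move=> oV [Xs Xd] [Ys Yd]; split; first by apply: smxD => //; exact: smxN.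
move=> r y Vy; have := mderivB (Xd r y Vy) (Yd r y Vy).
by rewrite mulmxBl mulmxBr !opprD !opprK addrACA.
Qed.

Lemma parallelZ c X V : open V -> parallel X V -> parallel (fun y => c *: X y) V.
Proof.
move=> oV [Xs Xd]; split; first by apply: smxZ => // k; exact: Ck_cst.
move=> r y Vy; have := mderivZ (is_derive_cst c _ _) (Xd r y Vy).
by rewrite scale0r add0r scalerBr -scalemxAl -scalemxAr.
Qed.

(* The second function is the adjoint of the first for the cone metric. *)
Definition parallel_pair (X X' : 'rV[R]_n -> 'M[R]_(n + 1)) :=
  [/\ parallel X W, parallel X' W & forall y, W y -> H y *m X y = (X' y)^T *m H y].

Lemma parallel_pairM X X' Y Y' : parallel_pair X X' -> parallel_pair Y Y' ->
  parallel_pair (fun y => X y *m Y y) (fun y => Y' y *m X' y).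
Proof.
move=> [X1 X2 XA] [Y1 Y2 YA]; split; try exact: parallelM.
by move=> y Wy; rewrite mulmxA XA// -mulmxA YA// trmx_mul mulmxA.
Qed.

Lemma parallel_pairZ c X X' : parallel_pair X X' ->
  parallel_pair (fun y => c *: X y) (fun y => c *: X' y).
Proof.
move=> [X1 X2 XA]; split; try exact: parallelZ.
by move=> y Wy; rewrite [(_ *: _)^T]linearZ/= -scalemxAl -scalemxAr XA.
Qed.

(** A skew matrix for the cone metric consists of a skew block and a free column; the bottom row is
    forced and the corner is zero. In this block form the Killing equations are precisely the
    equation for a parallel endomorphism. *)
Lemma parallel_skew (F0 : 'M[R]_(n + 1)) : skew (H y0) F0 ->
  exists2 X, parallel_pair X (fun y => - X y) & X y0 = F0.
Proof.
rewrite -[F0]submxK /H /cone_metric.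
set B0 := ulsubmx F0; set h0 := ursubmx F0; set c0 := dlsubmx F0; set d0 := drsubmx F0.
rewrite /skew tr_block_mx !mulmx_block !mulmx0 !mul0mx !mulmx1 !mul1mx !addr0 !add0r.
rewrite add_block_mx -[RHS](@block_mx0 R n 1 n 1) => /eq_block_mx[B0s E1 E2 E3].
have [h [B [hs Bs hy0 By0 hB]]] := killing h0 B0s.
pose F y := block_mx (B y) (h y) (- ((h y)^T *m G y)) 0.
have Fskew y : W y -> skew (H y) (F y).
  move=> Wy; have [Bsk _] := hB y Wy.
  rewrite /skew /F /H /cone_metric tr_block_mx !mulmx_block.
  rewrite !mulmx0 !mul0mx !mulmx1 !mul1mx !addr0 !add0r add_block_mx Bsk.
  rewrite [(- _)^T]linearN/= trmx_mul trmxK G_sym// addNr subrr trmx0 addr0.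
  by rewrite block_mx0.
have Fpar : parallel F W.
  split.
    apply: smx_block => //; last exact: smx_cst.
    by apply: smxN => //; apply: smxM => //; exact: smxT.
  move=> r y Wy; have [Bsk /(_ r)[hd Bd]] := hB y Wy.
  have -> : F y *m cone_connection r y - cone_connection r y *m F y =
     block_mx (B y *m Gam r y - Gam r y *m B y +
                    (ebase r *m (h y)^T *m G y - h y *m (ebase r)^T *m G y))
       (B y *m ebase r - Gam r y *m h y)
       (- ((B y *m ebase r - Gam r y *m h y)^T *m G y + (h y)^T *m ((Gam r y)^T *m G y + G y *m Gam r y))) 0.
    rewrite /F /cone_connection !mulmx_block opp_block_mx add_block_mx.
    congr block_mx.
    - by rewrite !mulmxN !mulmxA opprD opprK addrACA [in X in _ + X]addrC.
    - by rewrite mulmx0 addr0 mulmx0 addr0.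
    - rewrite !mul0mx !addr0 !mulNmx opprK [(_ - _)^T]linearB/= !trmx_mul.
      rewrite mulmxBl mulmxDr !mulmxA addrA subrK -!mulmxA (skewE Bsk) mulmxN.
      by rewrite opprD opprK addrC !mulmxA.
    - rewrite !mulmx0 !addr0 !mulNmx opprK addrC; apply/eqP; rewrite subr_eq0; apply/eqP.
      by rewrite -[RHS]trmx_scalar11 !trmx_mul trmxK G_sym// mulmxA.
  apply: mderiv_block => //; last exact: mderiv_cst.
  apply: mderivN; apply: mderivM; first exact: mderivT.
  exact: G_parallel.
exists F.
  split=> //; last by move=> y /Fskew; move/eqP; rewrite addrC addr_eq0 [(- _)^T]linearN mulNmx => /eqP.
  have := parallelZ (-1) oW Fpar; rewrite (_ : (fun _ => _) = fun y => - F y)//.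
  by apply/funext => y; rewrite scaleN1r.
rewrite /F hy0 By0; congr block_mx.
- by move/eqP: E2; rewrite addrC addr_eq0 => /eqP.
- by apply/matrixP => i j; move/matrixP: E3 => /(_ i j);
    rewrite !ord1 !mxE -mulr2n => /eqP; rewrite mulrn_eq0 => /eqP.
Qed.

Lemma cone_metric_sym y : W y -> (H y)^T = H y.
Proof. by move=> Wy; rewrite /H /cone_metric tr_block_mx !trmx0 trmx1 G_sym. Qed.

Lemma cone_metric_unit y : W y -> H y \in unitmx.
Proof.
by move=> Wy; rewrite unitmxE det_ublock det1 mulr1 -unitmxE G_unit.
Qed.

Lemma cone_metric_deriv r y : W y ->
  mderiv r H y ((N r y)^T *m H y + H y *m N r y).
Proof.
move=> Wy; have := mderiv_block (G_parallel r Wy) (mderiv_cst y r (0 : 'cV[R]_n))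
  (mderiv_cst y r (0 : 'rV[R]_n)) (mderiv_cst y r (1%:M : 'M[R]_1)).
rewrite /H /N /cone_metric /cone_connection tr_block_mx !mulmx_block add_block_mx.
rewrite ?trmx0 ?mulmx0 ?mul0mx ?mulmx1 ?mul1mx ?addr0 ?add0r.
by rewrite [(- _)^T]linearN/= trmx_mul trmxK G_sym// addNr subrr.
Qed.

(** * The parallel frame and the stereographic map *)

Section Frame.
Context (E : 'M[R]_n) (eps : 'I_n -> R).
Hypotheses (E_unit : E \in unitmx) (eps_neq0 : forall i, eps i != 0).
Hypothesis EgE : E^T *m G y0 *m E = diag_mx (\row_i eps i).

Definition cone_frame : 'M[R]_(n + 1) := block_mx E 0 0 1%:M.
Definition cone_sign (i : 'I_(n + 1)) : R :=
  match fintype.split i with inl j => eps j | inr _ => 1 end.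
Let U0 := cone_frame.
Let last : 'I_(n + 1) := rshift n ord0.

Let cone_sign_neq0 i : cone_sign i != 0.
Proof. by rewrite /cone_sign; case: fintype.split => [j|_]; rewrite ?eps_neq0 ?oner_neq0. Qed.

Lemma cone_signl i : cone_sign (lshift 1 i) = eps i.
Proof. by rewrite /cone_sign (unsplitK (inl _ i)). Qed.

Lemma cone_signr i : cone_sign (rshift n i) = 1.
Proof. by rewrite /cone_sign (unsplitK (inr _ i)). Qed.

Lemma cone_frame_orthonormal :
  U0^T *m H y0 *m U0 = diag_mx (\row_i cone_sign i).
Proof.
rewrite /U0 /H /cone_frame /cone_metric tr_block_mx !mulmx_block.
rewrite ?trmx0 ?trmx1 ?mulmx0 ?mul0mx ?mulmx1 ?mul1mx ?addr0 ?add0r ?mulmx0 ?mul0mx ?addr0 ?add0r EgE.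
apply/matrixP => i j.
case: (split_ordP i) => i' ->; case: (split_ordP j) => j' ->.
- by rewrite block_mxEul !mxE cone_signl eq_lshift.
- by rewrite block_mxEur !mxE eq_lrshift.
- by rewrite block_mxEdl !mxE eq_rlshift.
- by rewrite block_mxEdr !mxE cone_signr eq_rshift.
Qed.

(** For distinct [c], [d] and a third index [m], the product of the rotations in the planes (c, m)
    and (m, d) is, up to the sign of [m], the elementary endomorphism from [d] to [c]. The diagonal
    ones are products of two of these. *)
Let units (a b : 'I_(n + 1)) :
  exists X X', parallel_pair X X' /\ X y0 = col a U0 *m (col b U0)^T *m H y0.
Proof.
have n1_ge3 : (3 <= n + 1)%N by rewrite addn1.
have offdiag (c d : 'I_(n + 1)) : c != d ->
    exists X X', parallel_pair X X' /\ X y0 = col c U0 *m (col d U0)^T *m H y0.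
  move=> cd; have [m /andP[mc md]] := third_index n1_ge3 c d.
  have [X1 P1 X1E] := parallel_skew (rotation_skew (cone_metric_sym Wy0) U0 c m).
  have [X2 P2 X2E] := parallel_skew (rotation_skew (cone_metric_sym Wy0) U0 m d).
  have P12 := parallel_pairZ (cone_sign m)^-1 (parallel_pairM P1 P2).
  eexists; eexists; split; first exact: P12.
  rewrite /= X1E X2E [X in _ *m X]/rotation mulmxBr !mulmxA.
  rewrite !(rotation_basis cone_frame_orthonormal) !(neqF cd) !(neqF mc) !(neqF md) eqxx.
  rewrite !mul0r !scale0r mul1r subr0 subrr ?mul0mx subr0 -!scalemxAl scalerA mulVf ?scale1r//.
have [->|ab] := eqVneq a b; last exact: offdiag.
have [m /andP[mb _]] := third_index n1_ge3 b b.
have bm : b != m by rewrite eq_sym.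
have [X1 [X1' [P1 X1E]]] := offdiag _ _ bm.
have [X2 [X2' [P2 X2E]]] := offdiag _ _ mb.
have P12 := parallel_pairZ (cone_sign m)^-1 (parallel_pairM P1 P2).
eexists; eexists; split; first exact: P12.
rewrite /= X1E X2E !mulmxA -[_ *m (col m U0)^T *m H y0 *m col m U0]mulmxA -[_ *m (col m U0)^T *m _]mulmxA.
have -> : (col m U0)^T *m (H y0 *m col m U0) = (cone_sign m)%:M.
  rewrite mulmxA [LHS]mx11_scalar -/(bil (H y0) (col m U0) (col m U0)).
  by rewrite (bil_basis U0) cone_frame_orthonormal !mxE eqxx mulr1n.
by rewrite mul_mx_scalar -!scalemxAl scalerA mulVf// scale1r.
Qed.

Let dl : 'cV[R]_(n + 1) := delta_mx last 0.

Let lastE : col last U0 = dl.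
Proof.
apply/colP => i; rewrite mxE; case: (split_ordP i) => i' ->.
  by rewrite block_mxEur !mxE eq_lrshift.
by rewrite block_mxEdr !mxE eq_rshift andbT.
Qed.

Let H_last y : H y *m dl = dl.
Proof.
rewrite -colE; apply/colP => i; rewrite mxE; case: (split_ordP i) => i' ->.
  by rewrite block_mxEur !mxE eq_lrshift.
by rewrite block_mxEdr !mxE eq_rshift andbT.
Qed.

Let dl_norm : dl^T *m dl = 1%:M.
Proof. by rewrite /dl trmx_delta mul_delta_mx; apply/matrixP => i j; rewrite !ord1 !mxE. Qed.

(* [s ^+ 2] is the square of the coordinate in the direction of the vertex of
   the parallel section of the cone starting at the vertex; the columns of
   [X] at the vertex are the other parallel sections, multiplied by [s]. *)
Lemma parallel_frame : exists2 e', 0 < e' <= e & exists U : 'rV[R]_n -> 'M[R]_(n + 1),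
  [/\ smx (ball y0 e') U, U y0 = U0,
    forall r y, ball y0 e' y -> mderiv r U y (- (N r y *m U y)) &
    forall y, ball y0 e' y ->
      (U y)^T *m H y *m U y = diag_mx (\row_i cone_sign i)].
Proof.
have /fin_all_exists[X XP] : forall a : 'I_(n + 1), exists X X',
   parallel_pair X X' /\ X y0 = col a U0 *m dl^T.
  move=> a; have [X [X' [PX XE]]] := units a last; exists X, X'; split=> //.
  rewrite XE lastE -mulmxA; congr (_ *m _).
  by rewrite -{1}(cone_metric_sym Wy0) -trmx_mul H_last.
(* [P] will be the orthogonal projection onto the line of the parallel section starting at the
   vertex. The identities below hold at [y0] and spread because both sides are parallel. *)
pose P := X last.
have [P' [[Ppar P'par PA] P0]] : exists P', parallel_pair P P' /\ P y0 = dl *m dl^T.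
  by rewrite -[X in _ = X *m _]lastE; exact: XP.
have Xpar a : parallel (X a) W by have [? [[]]] := XP a.
have XX a y : W y -> X a y *m P y = X a y.
  move=> Wy; apply/eqP; rewrite -subr_eq0; apply/eqP.
  apply: (parallel_unique (X := fun y => X a y *m P y - X a y)) Wy.
    by apply: parallelB => //; exact: parallelM.
  have [X' [_ XE]] := XP a.
  by rewrite XE P0 mulmxA -[_ *m dl]mulmxA dl_norm mulmx1 subrr.
have P'E y : W y -> P' y = P y.
  move=> Wy; apply/eqP; rewrite -subr_eq0; apply/eqP.
  apply: (parallel_unique (X := fun y => P' y - P y)) Wy.
    exact: parallelB.
  have E0 : H y0 *m P' y0 = H y0 *m P y0.
    have := congr1 trmx (PA y0 Wy0); rewrite !trmx_mul trmxK (cone_metric_sym Wy0) => <-.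
    rewrite -/P P0 trmx_mul trmxK [RHS]mulmxA H_last -mulmxA -{1}(cone_metric_sym Wy0).
    by rewrite -trmx_mul H_last.
  by rewrite (can_inj (mulKmx (cone_metric_unit Wy0)) E0) subrr.
have trP y : W y -> \tr (P y) = 1.
  move=> Wy; transitivity (\tr (P y0)); last first.
    by rewrite P0 mxtrace_mulC dl_norm mxtrace1.
  apply: (gradient0_constant (f := fun y => \tr (P y)) oW bW _ _ Wy Wy0).
    by apply: Ck_sum => // i _; exact: Ppar.1.
  move=> r z Wz; have D := is_derive_bigsum (index_enum _) (P := predT) (fun i _ => Ppar.2 r z Wz i i).
  by rewrite (is_derive_partial D) -/(mxtrace _) linearB/= mxtrace_mulC subrr.
pose q y := P y last last.
have qs : smooth W q by apply: smx_entry; case: Ppar.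
have q1 : q y0 = 1 by rewrite /q P0 /dl trmx_delta mul_delta_mx mxE !eqxx.
pose a r y := (P y *m N r y) last last.
have dq r y : W y -> is_derive y (delta_mx 0 r) q (2 * a r y).
  move=> Wy; apply: is_derive_eq ((Ppar.2 r y Wy) last last) _.
  rewrite mxE [X in _ + X]mxE mulr2n mulrDl mul1r; congr (_ + _).
  (* Self-adjointness of [P] makes the two terms of the commutator contribute equally to this entry,
     hence the factor 2 in [dq]. *)
  have := PA y Wy; rewrite (P'E _ Wy) /a -[P y]submxK /H /N /cone_metric /cone_connection.
  rewrite tr_block_mx !mulmx_block ?mulmx0 ?mul0mx ?mulmx1 ?mul1mx ?addr0 ?add0r.
  move=> /eq_block_mx[_ GP _ _].
  rewrite ![block_mx _ _ _ _ last last]block_mxEdr mulNmx -mulmxA GP mxE opprK.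
  by rewrite -trmx_mul mxE.
have [e' e'0 [e'e qpos]] : exists2 e', 0 < e' & e' <= e /\ forall y, ball y0 e' y -> 0 < q y.
  by apply: positive_ball => //; [exact: (Ck_continuous (qs 0%N) Wy0)|rewrite q1].
have We' y : ball y0 e' y -> W y by exact: le_ball.
have e'W : open (ball y0 e') by exact: ball_open.
pose s y := Num.sqrt (q y).
have ss : smooth (ball y0 e') s by move=> k; apply: Ck_sqrt => //; apply: Ck_subset (qs k).
have ds r y : ball y0 e' y -> is_derive y (delta_mx 0 r) s (a r y / s y).
  move=> By; apply: is_derive_eq (is_derive_sqrt (qpos _ By) (dq r y (We' _ By))) _.
  by rewrite invfM mulrACA divff// mul1r.
pose Y y : 'M[R]_(n + 1) := \matrix_(i, j) X j y i last.
pose U y := (s y)^-1 *: Y y.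
have s0 y : ball y0 e' y -> s y != 0 by move=> /qpos; rewrite -sqrtr_gt0 => /lt0r_neq0.
have dU r y : ball y0 e' y -> mderiv r U y (- (N r y *m U y)).
  move=> By; have Wy := We' _ By.
  have PP : P y *m P y = P y := XX last y Wy.
  have [c [t PE]] := idempotent_trace1 PP (trP y Wy).
  (* Since [P] has rank one, its last column and that of [P y *m N r y] are proportional. The
     resulting multiple of [Y] in [dY] is what the derivative of the normalization cancels. *)
  have colPN : q y *: col last (P y *m N r y) = a r y *: col last (P y).
    rewrite /q /a PE -mulmxA; apply/colP => i; rewrite !mxE !big_ord1; ring.
  have q0 : q y != 0 by rewrite gt_eqF// qpos.
  have dY : mderiv r Y y ((a r y / q y) *: Y y - N r y *m Y y).
    move=> i j; rewrite (_ : (fun _ => _) = (fun z => X j z i last)); last first.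
      by apply/funext => z; rewrite mxE.
    apply: is_derive_eq ((Xpar j).2 r y Wy i last) _.
    rewrite mxE [X in _ + X]mxE [in RHS]mxE [X in _ = _ + X]mxE [X in _ = X + _]mxE.
    congr (_ - _); last first.
      by rewrite [LHS]mxE [RHS]mxE; apply: eq_bigr => m _; rewrite [Y y m j]mxE.
    have E1 : col last (X j y *m N r y) = (a r y / q y) *: col last (X j y).
      rewrite -{1}(XX j y Wy) -mulmxA colE -mulmxA -colE.
      apply: (scalerI q0); rewrite scalemxAr colPN -scalemxAr scalerA mulrCA divff// mulr1.
      by rewrite colE mulmxA XX// -colE.
    by have /colP/(_ i) := E1; rewrite !mxE.
  have ds' := is_derive_inv (s0 _ By) (ds r y By).
  have := mderivZ ds' dY; congr (mderiv _ _ _ _).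
  rewrite scalerBr scalerA addrA -scalerDl.
  rewrite [X in X *: _ - _ = _](_ : _ = 0); first by rewrite scale0r sub0r scalemxAr.
  have sq : q y = s y ^+ 2 by rewrite sqr_sqrtr// ltW// qpos.
  by rewrite sq; field; exact: s0.
have Us : smx (ball y0 e') U.
  apply: smxZ => //.
    by move=> k; apply: CkV => //; exact: ss.
  apply: smx_intro => i j k.
  have [Xs _] := Xpar j; apply: (@Ck_ext _ _ _ _ (fun y => X j y i last)) => //.
    by move=> y _; rewrite mxE.
  by apply: Ck_subset (Xs k i last).
have U0E : U y0 = U0.
  rewrite /U /s q1 sqrtr1 invr1 scale1r; apply/matrixP => i j; rewrite mxE.
  have [X' [_ ->]] := XP j.
  by rewrite mxE big_ord1 !mxE !eqxx mulr1.
exists e'; first by rewrite e'0.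
exists U; split=> // y By.
have BB : ball y0 e' y0 by exact: ballxx.
rewrite -cone_frame_orthonormal -U0E; apply/matrixP => i j.
apply: (gradient0_constant (W := ball y0 e')
   (f := fun y => ((U y)^T *m H y *m U y) i j)) => //.
- exact: ball_boxed.
- have T : smx (ball y0 e') (fun y => (U y)^T *m H y *m U y).
    apply: smxM => //; apply: smxM => //; first exact: smxT.
    apply: smx_block; [exact: e'W| |exact: smx_cst|exact: smx_cst|exact: smx_cst].
    by move=> k l m; apply: Ck_subset (G_smooth k l m); exact: le_ball.
  exact: T.
(* The frame and the cone metric are both parallel, so the Gram matrix keeps its value at [y0]. *)
move=> r z Bz; have D := mderivM (mderivM (mderivT (dU r z Bz)) (cone_metric_deriv r (We' _ Bz))) (dU r z Bz).
rewrite (is_derive_partial (D i j)) [(- _)^T]linearN/= trmx_mul.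
rewrite (_ : _ + _ = 0) ?mxE//.
rewrite mulmxDr !mulmxDl !mulmxN !mulNmx !mulmxA addrA addNr add0r subrr.
by [].
Qed.

Hypothesis eps_sqr : forall i, eps i ^+ 2 = 1.

Let Dm := diag_mx (\row_i cone_sign i).

Let DmK : Dm *m Dm = 1%:M.
Proof.
rewrite mulmx_diag -diag_const_mx; congr diag_mx; apply/rowP => i; rewrite !mxE -expr2.
by rewrite /cone_sign; case: fintype.split => [j|_]; rewrite ?eps_sqr ?expr1n.
Qed.

Let sum_last (f : 'I_(n + 1) -> R) : \sum_j f j = \sum_i f (lshift 1 i) + f last.
Proof. by rewrite big_split_ord/= big_ord1. Qed.

(** The last row [x j] of the parallel frame gives the linear coordinates of the immersion into the
    quadric. At [y0] all of them vanish but the last, which is 1, so projection from the opposite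
    pole is regular there. *)
Lemma stereographic : exists (e' : R) (F : 'rV[R]_n -> 'rV[R]_n), [/\ 0 < e' <= e,
  forall i, smooth (ball y0 e') (fun y => F y 0 i),
  jacobian F y0 \in unitmx &
  forall y, ball y0 e' y -> normal_f eps (F y) != 0 /\ stereographic_equation (Gam^~ y) eps F y].
Proof.
have [e1 /andP[e10 e1e] [U [Us Uy0 dU UHU]]] := parallel_frame.
have We1 y : ball y0 e1 y -> W y by exact: le_ball.
have oe1 : open (ball y0 e1) by exact: ball_open.
have Be1 : ball y0 e1 y0 by exact: ballxx.
pose x j y : R := U y last j.
pose u j y : 'cV[R]_n := \col_k U y (lshift 1 k) j.
pose p r j y : R := (G y *m u j y) r 0.
have pE r j y : p r j y = \sum_k G y r k * U y (lshift 1 k) j.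
  by rewrite /p mxE; apply: eq_bigr => k _; rewrite mxE.
have xs j : smooth (ball y0 e1) (x j) by apply: smx_entry.
have dx r j y : ball y0 e1 y -> is_derive y (delta_mx 0 r) (x j) (p r j y).
  move=> By; apply: is_derive_eq (dU r y By last j) _.
  rewrite mxE mxE sum_last block_mxEdr mxE mul0r addr0 pE -sumrN; apply: eq_bigr => k _.
  by rewrite block_mxEdl mxE mulNr opprK /ebase trmx_delta -rowE mxE.
have du s j y : ball y0 e1 y ->
    mderiv s (u j) y (- (Gam s y *m u j y) - x j y *: ebase s).
  move=> By k z; rewrite (ord1 z) (_ : (fun _ => _) = fun w => U w (lshift 1 k) j); last first.
    by apply/funext => w; rewrite mxE.
  apply: is_derive_eq (dU s y By (lshift 1 k) j) _.
  rewrite mxE mxE sum_last block_mxEur opprD !mxE; congr (- _ - _); last by rewrite mulrC.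
  by apply: eq_bigr => l _; rewrite block_mxEul mxE.
have dp s r j y : ball y0 e1 y ->
    is_derive y (delta_mx 0 s) (p r j) (\sum_k Gam s y k r * p k j y - G y r s * x j y).
  move=> By; apply: is_derive_eq (mderivM (G_parallel s (We1 _ By)) (du s j y By) r 0) _.
  rewrite mulmxDl mulmxBr mulmxN !mulmxA addrA addrK -scalemxAr -colE mxE -mulmxA.
  rewrite [X in X + _]mxE [X in _ + X]mxE [X in - X]mxE [X in _ * X]mxE [G y r s * _]mulrC.
  by congr (_ - _); apply: eq_bigr => k _; rewrite mxE.
(* Orthonormality of the columns, inverted into a relation between rows. Its blocks are the equation
   of the quadric, its first derivative, and the induced metric, proved below as [xx], [xp] and
   [pp]. *)
have UDU y : ball y0 e1 y -> U y *m Dm *m (U y)^T *m H y = 1%:M.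
  move=> By; have E1 : (Dm *m (U y)^T *m H y) *m U y = 1%:M.
    by rewrite -!mulmxA [(U y)^T *m _]mulmxA UHU.
  by have := mulmx1C E1; rewrite !mulmxA.
pose Q y i m := \sum_j U y i j * cone_sign j * U y m j.
have QE y i m : (U y *m Dm *m (U y)^T) i m = Q y i m.
  by rewrite mxE; apply: eq_bigr => j _; rewrite mul_mx_diag !mxE.
have Ql y i : ball y0 e1 y -> Q y i last = (i == last)%:R.
  move=> By; transitivity ((U y *m Dm *m (U y)^T *m H y) i last); last first.
    by rewrite UDU// mxE.
  rewrite mxE sum_last block_mxEdr big1 => [|k _].
    by rewrite [X in _ * X]mxE eqxx mulr1 add0r QE.
  by rewrite block_mxEur [X in _ * X]mxE mulr0.
have Qt y k s : ball y0 e1 y ->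
    \sum_l Q y (lshift 1 k) (lshift 1 l) * G y l s = (k == s)%:R.
  move=> By; transitivity ((U y *m Dm *m (U y)^T *m H y) (lshift 1 k) (lshift 1 s)).
    rewrite [RHS]mxE sum_last block_mxEdl [X in _ + _ * X]mxE mulr0 addr0.
    by apply: eq_bigr => l _; rewrite block_mxEul QE.
  by rewrite UDU// mxE eq_lshift.
have xx y : ball y0 e1 y -> \sum_i eps i * x (lshift 1 i) y ^+ 2 = 1 - x last y ^+ 2.
  move=> By; apply/eqP; rewrite eq_sym subr_eq; apply/eqP.
  transitivity (Q y last last); first by rewrite Ql// eqxx.
  rewrite /Q sum_last cone_signr mulr1 -expr2.
  by congr (_ + _); apply: eq_bigr => i _; rewrite cone_signl /x; ring.
have Qp y i r : ball y0 e1 y -> \sum_j cone_sign j * U y i j * p r j y =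
    \sum_k G y r k * Q y (lshift 1 k) i.
  move=> By; under eq_bigr do rewrite pE mulr_sumr.
  rewrite exchange_big/=; apply: eq_bigr => k _; rewrite mulr_sumr.
  by apply: eq_bigr => j _; ring.
have xp r y : ball y0 e1 y -> \sum_i eps i * x (lshift 1 i) y * p r (lshift 1 i) y = - (x last y * p r last y).
  move=> By; apply/eqP; rewrite -addr_eq0; apply/eqP.
  have := Qp y last r By; rewrite sum_last cone_signr mul1r.
  under eq_bigr do rewrite cone_signl.
  by move=> ->; rewrite big1// => k _; rewrite Ql// eq_lrshift mulr0.
have pp r s y : ball y0 e1 y -> \sum_i eps i * p r (lshift 1 i) y * p s (lshift 1 i) y =
    G y r s - p r last y * p s last y.
  move=> By; apply/eqP; rewrite eq_sym subr_eq; apply/eqP.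
  transitivity (\sum_j cone_sign j * p r j y * p s j y); last first.
    rewrite sum_last cone_signr mul1r; congr (_ + _).
    by apply: eq_bigr => i _; rewrite cone_signl.
  transitivity (\sum_k G y r k * (\sum_l Q y (lshift 1 k) (lshift 1 l) * G y l s)).
    under eq_bigr do rewrite Qt//.
    rewrite (bigD1 s)//= eqxx mulr1 big1 ?addr0// => k ks.
    by rewrite (negbTE ks) mulr0.
  transitivity (\sum_k G y r k * \sum_j cone_sign j * U y (lshift 1 k) j * p s j y).
    apply: eq_bigr => k _; congr (_ * _); rewrite Qp//; apply: eq_bigr => l _.
    rewrite mulrC; congr (_ * _); first by rewrite -{1}(G_sym (We1 _ By)) mxE.
    by apply: eq_bigr => j _; ring.
  under eq_bigr do rewrite mulr_sumr; rewrite exchange_big/=; apply: eq_bigr => j _.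
  by rewrite (pE r) mulr_sumr mulr_suml; apply: eq_bigr => k _; ring.
have xi0 i : x (lshift 1 i) y0 = 0.
  by rewrite /x Uy0 block_mxEdl mxE.
have x0 : x last y0 = 1.
  by rewrite /x Uy0 block_mxEdr mxE eqxx.
have [e2 e20 [e21 den]] : exists2 e2, 0 < e2 & e2 <= e1 /\ forall y, ball y0 e2 y -> 0 < 1 + x last y.
  apply: positive_ball => //; last by rewrite x0 addr_gt0.
  by apply: continuous_add; [exact: continuous_const|exact: (Ck_continuous (xs last 0%N))].
have We2 y : ball y0 e2 y -> ball y0 e1 y by exact: le_ball.
have oe2 : open (ball y0 e2) by exact: ball_open.
have n1 : 0 < n%:R - 1 :> R.
  by rewrite subr_gt0 ltr1n.
(* The scale for which c^2/2 is the constant term of [normal_f]; then [normal_f] becomes c^2/(1 + x)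
   for the polar coordinate x, as [fE] shows. *)
pose c : R := Num.sqrt (n%:R - 1)^-1.
have c0 : c != 0 by rewrite sqrtr_eq0 -ltNge invr_gt0.
have cc : c ^+ 2 = (n%:R - 1)^-1 by rewrite sqr_sqrtr// invr_ge0 ltW.
pose hh y := (1 + x last y)^-1.
pose F y : 'rV[R]_n := \row_i (c * (x (lshift 1 i) y * hh y)).
pose dF r i y := c * (p r (lshift 1 i) y * hh y -
   x (lshift 1 i) y * (hh y * hh y * p r last y)).
have FE i : (fun y => F y 0 i) = (fun y => c * (x (lshift 1 i) y * hh y)).
  by apply/funext => y; rewrite mxE.
have dden r y : ball y0 e2 y -> is_derive y (delta_mx 0 r) hh
    (- (hh y * hh y * p r last y)).
  move=> By; have dn : 1 + x last y != 0 by rewrite gt_eqF// den.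
  have D1 := is_derive_add (is_derive_cst (1 : R) y (delta_mx 0 r)) (dx r last y (We2 _ By)).
  have D2 := is_derive_inv (f := fun y => 1 + x last y) dn D1.
  by apply: is_derive_eq D2 _; rewrite add0r expr2 invfM.
have dFP r i y : ball y0 e2 y -> is_derive y (delta_mx 0 r) (fun y => F y 0 i) (dF r i y).
  move=> By; rewrite FE.
  apply: is_derive_eq (is_derive_mul (is_derive_cst c _ _)
    (is_derive_mul (dx r (lshift 1 i) y (We2 _ By)) (dden r y By))) _.
  by rewrite /dF mul0r add0r mulrN.
have pF r i y : ball y0 e2 y -> partial r (fun z => F z 0 i) y = dF r i y.
  by move=> By; exact: is_derive_partial (dFP r i y By).
exists e2, F; split.
- by rewrite e20 (le_trans e21).
- move=> i k; rewrite FE; apply: CkM => //; first exact: Ck_cst.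
  have xk j : Ck k (ball y0 e2) (x j) by apply: Ck_subset (xs j k).
  apply: CkM => //; apply: CkV => //; first by move=> y /den/lt0r_neq0.
  by apply: CkD => //; exact: Ck_cst.
- have -> : jacobian F y0 = (c / 2) *: (G y0 *m E)^T.
    apply/matrixP => i r; rewrite mxE pF; last exact: ballxx.
    rewrite /dF xi0 mul0r subr0 [in RHS]mxE [in RHS]mxE [in RHS]mxE pE /hh x0 mulrA mulrAC.
    congr (_ * _); apply: eq_bigr => k _; congr (_ * _).
    by rewrite Uy0 block_mxEul.
  rewrite unitmxZ ?unitfE ?mulf_neq0 ?invr_eq0//.
  by rewrite unitmx_tr unitmx_mul G_unit// E_unit.
move=> y By; have By1 := We2 _ By; have den0 : 1 + x last y != 0 by rewrite gt_eqF// den.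
have fE : normal_f eps (F y) = c ^+ 2 / (1 + x last y).
  rewrite /normal_f -(stereographic_conformal c den0) -(xx y By1) invfM cc; congr (_ + _ * _).
  by rewrite mulr_sumr; apply: eq_bigr => i _; rewrite mxE -cc /hh; ring.
split; first by rewrite fE mulf_neq0 ?expf_neq0// invr_eq0.
have SF r : \sum_q eps q * F y 0 q * dF r q y = - (c ^+ 2 * hh y ^+ 2 * p r last y).
  rewrite -(stereographic_radial _ _ den0) -(xx y By1) -(xp r y By1) !mulr_sumr -sumrB mulr_sumr.
  by apply: eq_bigr => q _; rewrite mxE /dF /hh; ring.
have SFF r s : \sum_q eps q * dF r q y * dF s q y = c ^+ 2 * hh y ^+ 2 * G y r s.
  rewrite -(stereographic_metric _ (p r last y) (p s last y) _ den0) -(xx y By1).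
  rewrite -(xp r y By1) -(xp s y By1) -(pp r s y By1) !mulr_sumr -!sumrB -big_split/= mulr_sumr.
  by apply: eq_bigr => q _; rewrite /dF /hh; ring.
move=> r s i; rewrite fE.
have ddF : partial s (partial r (fun z => F z 0 i)) y =
   c * ((\sum_k Gam s y k r * p k (lshift 1 i) y - G y r s * x (lshift 1 i) y) * hh y +
     p r (lshift 1 i) y * - (hh y * hh y * p s last y) -
     (p s (lshift 1 i) y * (hh y * hh y * p r last y) + x (lshift 1 i) y *
      ((- (hh y * hh y * p s last y) * hh y + hh y * - (hh y * hh y * p s last y)) * p r last y +
       hh y * hh y * (\sum_k Gam s y k r * p k last y - G y r s * x last y)))).
  rewrite (partial_open (f := partial r (fun z => F z 0 i)) (g := dF r i) s oe2 By); last first.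
    by move=> z Bz; exact: pF.
  apply: is_derive_partial.
  have D1 := is_derive_mul (dp s r (lshift 1 i) y By1) (dden s y By).
  have D2 := is_derive_mul (is_derive_mul (dden s y By) (dden s y By)) (dp s r last y By1).
  have D3 := is_derive_mul (dx s (lshift 1 i) y By1) D2.
  have D := is_derive_mul (is_derive_cst c y (delta_mx 0 s)) (is_derive_add D1 (is_derive_opp D3)).
  by apply: is_derive_eq D _; rewrite mul0r add0r.
have GdF : \sum_k Gam s y k r * partial k (fun z => F z 0 i) y =
    c * ((\sum_k Gam s y k r * p k (lshift 1 i) y) * hh y -
     x (lshift 1 i) y * (hh y * hh y * \sum_k Gam s y k r * p k last y)).
  rewrite mulr_suml !mulr_sumr -sumrB mulr_sumr; apply: eq_bigr => k _.
  by rewrite pF// /dF; ring.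
rewrite ddF GdF [LHS](stereographic_geodesic _ _ _ _ _ _ _ _ den0 c0); congr (_ * _).
rewrite -/(hh y) -/(dF r i y) -/(dF s i y) -(SFF r s) [F y 0 i]mxE.
have -> : - (c ^+ 2 * hh y ^+ 2 * p r last y) * dF s i y - c ^+ 2 * hh y ^+ 2 * p s last y * dF r i y =
   (\sum_q eps q * F y 0 q * dF r q y) * dF s i y + (\sum_q eps q * F y 0 q * dF s q y) * dF r i y.
  by rewrite !SF !mulNr.
rewrite !mulr_suml -big_split/=; congr (_ - _ * _).
  by apply: eq_bigr => q _; rewrite !pF// mulrDr !mulrA.
by apply: eq_bigr => q _; rewrite !pF.
Qed.

End Frame.
End Development.

(** * Infinitesimal symmetries *)

Lemma natr_sub1_neq0 (R : realType) n : (1 < n)%N -> (n%:R - 1 : R) != 0.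
Proof. by rewrite subr_eq0 (eqr_nat R n 1); case: eqP => // ->. Qed.

Lemma scale_half_twice (R : realType) (V : lmodType R) (X : V) : 2^-1 *: (X + X) = X.
Proof. by rewrite -mulr2n -[X *+ 2]scaler_nat scalerA mulVf ?scale1r// pnatr_eq0. Qed.

Lemma sum_kronecker (R : realType) n (i : 'I_n) (f : 'I_n -> R) : \sum_m (m == i)%:R * f m = f i.
Proof.
by rewrite (bigD1 i)//= big1 ?eqxx ?mul1r ?addr0// => m /negbTE ->; rewrite mul0r.
Qed.

Section LinearCombinations.
Context (R : realType) (n p q : nat).
Implicit Types (c : 'I_n -> R) (X Y : 'I_n -> 'M[R]_(p, q)).

(** Contraction over one index. In Lie derivatives the coefficients are those of a field or of a
    column of its jacobian. *)
Definition lc c X : 'M[R]_(p, q) := \sum_k c k *: X k.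

Lemma lcD c X Y : lc c (fun k => X k + Y k) = lc c X + lc c Y.
Proof. by rewrite /lc -big_split; apply: eq_bigr => k _; rewrite scalerDr. Qed.
Lemma lcN c X : lc c (fun k => - X k) = - lc c X.
Proof. by rewrite /lc -sumrN; apply: eq_bigr => k _; rewrite scalerN. Qed.
Lemma lcDl c c' X : lc (fun k => c k + c' k) X = lc c X + lc c' X.
Proof. by rewrite /lc -big_split; apply: eq_bigr => k _; rewrite scalerDl. Qed.
Lemma lcZl a c X : lc (fun k => a * c k) X = a *: lc c X.
Proof. by rewrite /lc scaler_sumr; apply: eq_bigr => k _; rewrite scalerA. Qed.
Lemma lc0 X : lc (fun=> 0) X = 0.
Proof. by rewrite /lc big1// => k _; rewrite scale0r. Qed.
Lemma lcE c X i j : lc c X i j = \sum_k c k * X k i j.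
Proof. by rewrite summxE; apply: eq_bigr => k _; rewrite mxE. Qed.
Lemma addmxE (M M' : 'M[R]_(p, q)) i j : (M + M') i j = M i j + M' i j.
Proof. exact: mxE. Qed.
Lemma oppmxE (M : 'M[R]_(p, q)) i j : (- M) i j = - M i j.
Proof. exact: mxE. Qed.

End LinearCombinations.

Lemma lcMl (R : realType) n p q r (c : 'I_n -> R) (M : 'M[R]_(r, p)) (X : 'I_n -> 'M[R]_(p, q)) :
  lc c (fun k => M *m X k) = M *m lc c X.
Proof. by rewrite /lc mulmx_sumr; apply: eq_bigr => k _; rewrite scalemxAr. Qed.
Lemma lcMr (R : realType) n p q r (c : 'I_n -> R) (M : 'M[R]_(q, r)) (X : 'I_n -> 'M[R]_(p, q)) :
  lc c (fun k => X k *m M) = lc c X *m M.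
Proof. by rewrite /lc mulmx_suml; apply: eq_bigr => k _; rewrite scalemxAl. Qed.

(** The hypothesis equates the two orders of second differentiation of the jacobian [J]. [Hq] and
    [Jq] are the contractions of the field with the derivatives of Gamma and of [J] with Gamma,
    [Dqr] a derivative of Gamma, and [X] the term symmetric in q and r. *)
Lemma lie_curvature_algebra (R : realType) n
    (J Gq Gr Hq Hr Jq Jr Dqr Drq S1qr S1rq S2qr S2rq H2qr H2rq X : 'M[R]_n) :
  ((J *m Gq - Gq *m J - Hq - Jq) *m Gr + J *m Dqr) -
    (Dqr *m J + Gr *m (J *m Gq - Gq *m J - Hq - Jq)) - (S1qr + H2qr) - (X + S2qr) =
  ((J *m Gr - Gr *m J - Hr - Jr) *m Gq + J *m Drq) -
    (Drq *m J + Gq *m (J *m Gr - Gr *m J - Hr - Jr)) - (S1rq + H2rq) - (X + S2rq) ->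
  H2qr - H2rq + (Hq *m Gr + Gq *m Hr) - (Hr *m Gq + Gr *m Hq) =
    J *m (Dqr - Drq + Gq *m Gr - Gr *m Gq) - (Dqr - Drq + Gq *m Gr - Gr *m Gq) *m J -
    (S1qr - S2rq + Jq *m Gr - Gr *m Jq) - (S2qr - S1rq + Gq *m Jr - Jr *m Gq).
Proof.
rewrite !(mulmxDl, mulmxDr, mulNmx, mulmxN, mulmxA) => E; apply/matrixP => i j.
have := congr1 (fun M : 'M[R]_n => M i j) E; rewrite !(addmxE, oppmxE); lra.
Qed.

Section Infinitesimal.
Context (R : realType) (n : nat) (U : set 'rV[R]_n) (oU : open U).
Context (Gam : 'I_n -> 'rV[R]_n -> 'M[R]_n) (A : 'rV[R]_n -> 'M[R]_n).
Hypotheses (Gam_smooth : forall r, smx U (Gam r)) (A_smooth : smx U A).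
Hypothesis Gam_sym : forall y, U y -> forall r s i, Gam r y i s = Gam s y i r.
Implicit Types (h : 'rV[R]_n -> 'cV[R]_n) (y : 'rV[R]_n).

Definition jac h y : 'M[R]_n := \matrix_(i, s) partial s (fun z => h z i 0) y.

(* [Gam r y i s] stands for Gamma^i_{rs}(y), and [K q r y i s] for R^i_{sqr}(y). *)
Definition K q r y : 'M[R]_n :=
  mpartial q (Gam r) y - mpartial r (Gam q) y + Gam q y *m Gam r y - Gam r y *m Gam q y.

Definition Ric y : 'M[R]_n := \matrix_(s, k) \sum_r K r k y r s.
Definition met y : 'M[R]_n := 2^-1 *: (Ric y + (Ric y)^T).

Definition comp h y k : R := h y k 0.

(** The determining equations in matrix form, the affine one solved for the second derivatives of
    [h]. Together with the definition of [jac] it is a closed linear first-order system for the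
    1-jet. *)
Definition infinitesimal h := smx U h /\ forall y, U y ->
  (forall r, mpartial r (jac h) y = jac h y *m Gam r y - Gam r y *m jac h y -
     lc (comp h y) (fun k => mpartial k (Gam r) y) -
     lc (fun k => jac h y k r) (fun k => Gam k y)) /\
  lc (comp h y) (fun k => mpartial k A y) - jac h y *m A y + A y *m jac h y = 0.

Lemma jac_smooth h : smx U h -> smx U (jac h).
Proof.
move=> hs; apply: smx_intro => i s k.
by apply: (Ck_ext oU) (Ck_partial s (hs k.+1 i 0)) => y _; rewrite mxE.
Qed.

Lemma mpartial_jac h r y k s : mpartial r (jac h) y k s =
  partial r (partial s (fun z => h z k 0)) y.
Proof. by rewrite mxE; congr (partial r _ y); apply/funext => z; rewrite mxE. Qed.

Lemma mpartial_jacC h r s y k : U y -> smx U h ->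
  mpartial r (jac h) y k s = mpartial s (jac h) y k r.
Proof.
move=> Uy hs; exact: etrans (mpartial_jac h r y k s)
  (etrans (partialC r s oU Uy (hs 2%N k 0)) (esym (mpartial_jac h s y k r))).
Qed.

Lemma K_smooth q r : smx U (K q r).
Proof.
have ds a b : smx U (mpartial a (Gam b)) by exact: smx_mpartial.
apply: smxD => //; last by apply: smxN => //; exact: smxM.
apply: smxD => //; last exact: smxM.
by apply: smxD => //; exact: smxN.
Qed.

Lemma K_anti q r y : K q r y = - K r q y.
Proof. by apply/matrixP => i j; rewrite /K !(addmxE, oppmxE); ring. Qed.

Lemma K_bianchi q r s i y : U y -> K q r y i s + K r s y i q + K s q y i r = 0.
Proof.
move=> Uy; have dsym a b c : mpartial a (Gam b) y i c = mpartial a (Gam c) y i b.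
  rewrite !mxE; apply: (partial_open _ oU Uy) => z Uz; exact: Gam_sym.
have msym a b c : (Gam a y *m Gam b y) i c = (Gam a y *m Gam c y) i b.
  by rewrite !mxE; apply: eq_bigr => m _; rewrite (Gam_sym Uy b c).
rewrite /K !(addmxE, oppmxE) (dsym q r s) (dsym r s q) (dsym s q r).
rewrite (msym q r s) (msym r s q) (msym s q r); ring.
Qed.

Lemma smx_lc p q (c : 'I_n -> 'rV[R]_n -> R) (X : 'I_n -> 'rV[R]_n -> 'M[R]_(p, q)) :
  (forall k, smooth U (c k)) -> (forall k, smx U (X k)) ->
  smx U (fun y => lc (c^~ y) (X^~ y)).
Proof. by move=> cs Xs; apply: smx_sum => // k; apply: smxZ. Qed.

Lemma mderiv_lc p q (c : 'I_n -> 'rV[R]_n -> R) (X : 'I_n -> 'rV[R]_n -> 'M[R]_(p, q))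
    l y dc dX :
  (forall k, is_derive y (delta_mx 0 l) (c k) (dc k)) -> (forall k, mderiv l (X k) y (dX k)) ->
  mderiv l (fun y => lc (c^~ y) (X^~ y)) y (lc dc (X^~ y) + lc (c^~ y) dX).
Proof.
move=> Dc DX; rewrite /lc -big_split/=.
by apply: mderiv_sum => k; exact: mderivZ.
Qed.

Section Equation.
Context (h : 'rV[R]_n -> 'cV[R]_n) (hinf : infinitesimal h).

Let hs : smx U h. Proof. by case: hinf. Qed.
Let Js : smx U (jac h). Proof. exact: jac_smooth. Qed.

Let dcomp l y : U y -> forall k, is_derive y (delta_mx 0 l) (fun y => comp h y k) (jac h y k l).
Proof. by move=> Uy k; rewrite mxE; exact: (Ck_is_derive l (hs 1%N k 0) Uy). Qed.

Let dGam a r y (Uy : U y) := smx_mderiv Uy a (Gam_smooth r).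

Lemma second_derivative q r y : U y ->
  mpartial q (mpartial r (jac h)) y =
    (mpartial q (jac h) y *m Gam r y + jac h y *m mpartial q (Gam r) y) -
    (mpartial q (Gam r) y *m jac h y + Gam r y *m mpartial q (jac h) y) -
    (lc (fun k => jac h y k q) (fun k => mpartial k (Gam r) y) +
     lc (comp h y) (fun k => mpartial q (mpartial k (Gam r)) y)) -
    (lc (fun k => mpartial q (jac h) y k r) (fun k => Gam k y) +
     lc (fun k => jac h y k r) (fun k => mpartial q (Gam k) y)).
Proof.
move=> Uy; apply: mderivE.
have dJ := smx_mderiv Uy q Js.
apply: (mderiv_ext oU Uy) (mderivB (mderivB (mderivB
  (mderivM dJ (dGam q r Uy)) (mderivM (dGam q r Uy) dJ))
  (mderiv_lc (dcomp q Uy) (fun k => smx_mderiv Uy q (smx_mpartial oU k (Gam_smooth r)))))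
  (mderiv_lc (fun k => dJ k r) (fun k => dGam q k Uy))).
by move=> z Uz; case: hinf => _ /(_ z Uz)[/(_ r) -> _].
Qed.

(** The compatibility condition of the affine equation: commuting the derivatives of [jac h] leaves
    exactly the vanishing of the Lie derivative of curvature. *)
Lemma lie_curvature q r y : U y ->
  lc (comp h y) (fun k => mpartial k (K q r) y) =
    jac h y *m K q r y - K q r y *m jac h y -
    lc (fun k => jac h y k q) (fun k => K k r y) -
    lc (fun k => jac h y k r) (fun k => K q k y).
Proof.
move=> Uy.
have -> : lc (comp h y) (fun k => mpartial k (K q r) y) =
    lc (comp h y) (fun k => mpartial q (mpartial k (Gam r)) y) -
    lc (comp h y) (fun k => mpartial r (mpartial k (Gam q)) y) +
    (lc (comp h y) (fun k => mpartial k (Gam q) y) *m Gam r y +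
     Gam q y *m lc (comp h y) (fun k => mpartial k (Gam r) y)) -
    (lc (comp h y) (fun k => mpartial k (Gam r) y) *m Gam q y +
     Gam r y *m lc (comp h y) (fun k => mpartial k (Gam q) y)).
  rewrite -!lcMl -!lcMr -!lcD -!lcN -!lcD; apply: eq_bigr => k _; congr (_ *: _).
  rewrite (mpartialC oU Uy q k (Gam_smooth r)) (mpartialC oU Uy r k (Gam_smooth q)).
  have dG a := smx_mderiv Uy k (Gam_smooth a).
  have ddG a b := smx_mderiv Uy k (smx_mpartial oU a (Gam_smooth b)).
  exact: mderivE (mderivB (mderivD (mderivB (ddG q r) (ddG r q)) (mderivM (dG q) (dG r)))
    (mderivM (dG r) (dG q))).
have -> : lc (fun k => jac h y k q) (fun k => K k r y) =
    lc (fun k => jac h y k q) (fun k => mpartial k (Gam r) y) -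
    lc (fun k => jac h y k q) (fun k => mpartial r (Gam k) y) +
    lc (fun k => jac h y k q) (fun k => Gam k y) *m Gam r y -
    Gam r y *m lc (fun k => jac h y k q) (fun k => Gam k y).
  by rewrite -lcMl -lcMr -!lcN -!lcD.
have -> : lc (fun k => jac h y k r) (fun k => K q k y) =
    lc (fun k => jac h y k r) (fun k => mpartial q (Gam k) y) -
    lc (fun k => jac h y k r) (fun k => mpartial k (Gam q) y) +
    Gam q y *m lc (fun k => jac h y k r) (fun k => Gam k y) -
    lc (fun k => jac h y k r) (fun k => Gam k y) *m Gam q y.
  by rewrite -lcMl -lcMr -!lcN -!lcD.
have Eq a : mpartial a (jac h) y = _ := (hinf.2 y Uy).1 a.
have := mpartialC oU Uy q r Js; rewrite (second_derivative q r Uy) (second_derivative r q Uy).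
(* The only terms with derivatives of the jacobian agree, being second derivatives of [h] in either
   order. *)
have -> : lc (fun k => mpartial q (jac h) y k r) (fun k => Gam k y) =
    lc (fun k => mpartial r (jac h) y k q) (fun k => Gam k y).
  by apply: eq_bigr => k _; congr (_ *: _); exact: (mpartial_jacC q r k Uy hs).
rewrite !Eq => E; exact: (lie_curvature_algebra E).
Qed.

End Equation.
End Infinitesimal.

Section Metric.
Context (R : realType) (n : nat) (U : set 'rV[R]_n) (oU : open U).
Context (Gam : 'I_n -> 'rV[R]_n -> 'M[R]_n) (A : 'rV[R]_n -> 'M[R]_n).
Hypotheses (Gam_smooth : forall r, smx U (Gam r)) (A_smooth : smx U A).
Implicit Types (h : 'rV[R]_n -> 'cV[R]_n) (y : 'rV[R]_n).

Lemma Ric_mderiv l y : U y ->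
  mderiv l (Ric Gam) y (\matrix_(s, k) \sum_r mpartial l (K Gam r k) y r s).
Proof.
move=> Uy s k; rewrite mxE.
rewrite (_ : (fun _ => _) = fun z => \sum_r K Gam r k z r s); last by apply/funext => z; rewrite mxE.
apply: is_derive_bigsum => r _.
exact: (smx_mderiv Uy l (K_smooth oU Gam_smooth r k)).
Qed.

Lemma Ric_smooth : smx U (Ric Gam).
Proof.
apply: smx_intro => s k.
rewrite (_ : (fun _ => _) = fun z => \sum_r K Gam r k z r s); last by apply/funext => z; rewrite mxE.
move=> m; apply: Ck_sum => // r _; exact: (K_smooth oU Gam_smooth r k).
Qed.

Lemma met_smooth : smx U (met Gam).
Proof.
apply: smxZ => //; first by move=> k; exact: Ck_cst.
by apply: smxD => //; [exact: Ric_smooth|apply: smxT => //; exact: Ric_smooth].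
Qed.

Lemma met_sym y : (met Gam y)^T = met Gam y.
Proof. by rewrite /met linearZ/= linearD/= trmxK addrC. Qed.

(** Trace of [lie_curvature]: the terms acting on the two contracted indices cancel. *)
Lemma lie_Ric h y : infinitesimal U Gam A h -> U y ->
  lc (comp h y) (fun k => mpartial k (Ric Gam) y) +
    (jac h y)^T *m Ric Gam y + Ric Gam y *m jac h y = 0.
Proof.
move=> hinf Uy; set J := jac h y; set c := comp h y.
have E k r : lc c (fun l => mpartial l (K Gam r k) y) = _ := lie_curvature oU Gam_smooth hinf r k Uy.
have -> : lc c (fun k => mpartial k (Ric Gam) y) =
  \matrix_(s, k) \sum_r lc c (fun l => mpartial l (K Gam r k) y) r s.
  apply/matrixP => s k; rewrite lcE mxE.
  under [RHS]eq_bigr do rewrite lcE.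
  rewrite exchange_big; apply: eq_bigr => l _; rewrite -mulr_sumr; congr (_ * _).
  by rewrite (mderivE (Ric_mderiv l Uy)) mxE.
apply/matrixP => s k; rewrite !addmxE mxE.
under eq_bigr do rewrite E !(addmxE, oppmxE).
rewrite !big_split/= !sumrN -/J.
have -> : \sum_r (J *m K Gam r k y) r s =
  \sum_r lc (fun l => J l r) (fun l => K Gam l k y) r s.
  under eq_bigr do rewrite mxE; under [RHS]eq_bigr do rewrite lcE.
  by rewrite exchange_big.
have -> : \sum_r (K Gam r k y *m J) r s = (J^T *m Ric Gam y) s k.
  rewrite mxE; under eq_bigr do rewrite mxE.
  rewrite exchange_big; apply: eq_bigr => m _; rewrite !mxE mulr_sumr.
  by apply: eq_bigr => r _; rewrite mulrC.
have -> : \sum_r lc (fun l => J l k) (fun l => K Gam r l y) r s = (Ric Gam y *m J) s k.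
  rewrite mxE; under eq_bigr do rewrite lcE.
  rewrite exchange_big; apply: eq_bigr => m _; rewrite !mxE mulr_suml.
  by apply: eq_bigr => r _; rewrite mulrC.
rewrite [RHS]mxE.
have cancel (u v w : R) : u - v - u - w + v + w = 0 by ring.
exact: cancel.
Qed.

Lemma lie_metric h y : infinitesimal U Gam A h -> U y ->
  lc (comp h y) (fun k => mpartial k (met Gam) y) +
    (jac h y)^T *m met Gam y + met Gam y *m jac h y = 0.
Proof.
move=> hinf Uy; have E := lie_Ric hinf Uy.
have dm k : mpartial k (met Gam) y = 2^-1 *: (mpartial k (Ric Gam) y + (mpartial k (Ric Gam) y)^T).
  have dR := smx_mderiv Uy k Ric_smooth.
  have := mderivE (mderivZ (is_derive_cst (2^-1 : R) y (delta_mx 0 k)) (mderivD dR (mderivT dR))).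
  by rewrite scale0r add0r.
have -> : lc (comp h y) (fun k => mpartial k (met Gam) y) =
    2^-1 *: (lc (comp h y) (fun k => mpartial k (Ric Gam) y) +
             (lc (comp h y) (fun k => mpartial k (Ric Gam) y))^T).
  rewrite /lc linear_sum/= -big_split/= scaler_sumr; apply: eq_bigr => k _.
  by rewrite dm [in RHS](linearZ (c:=comp h y k))/= -[in RHS]scalerDr !scalerA mulrC.
rewrite /met -scalemxAr -scalemxAl -!scalerDr mulmxDl mulmxDr.
have ET := congr1 trmx E; rewrite !linearD/= !trmx_mul trmxK trmx0 in ET.
apply/eqP; rewrite scaler_eq0; apply/orP; right; apply/eqP.
by rewrite -[RHS]addr0 -{2}E -ET; apply/matrixP => i j; rewrite !addmxE; ring.
Qed.

End Metric.

(** * Consequences of full isotropy *)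

Lemma trmxB (R : realType) p q (X Y : 'M[R]_(p, q)) : (X - Y)^T = X^T - Y^T.
Proof. by rewrite linearB. Qed.
Lemma trmxD (R : realType) p q (X Y : 'M[R]_(p, q)) : (X + Y)^T = X^T + Y^T.
Proof. by rewrite linearD. Qed.

(** [E] is the derivative of the equation for g at a zero of the field, with [L] and [Y] the
    contractions of [J] with dg and Gamma. Multiplying skewness of [J] by [C] on either side turns
    it into invariance of the covariant derivative of g. *)
Lemma form3_algebra (R : realType) n (g J C L dg Y : 'M[R]_n) :
  L + ((J *m C - C *m J - Y)^T *m g + J^T *m dg) +
    (dg *m J + g *m (J *m C - C *m J - Y)) = 0 -> skew g J ->
  L - Y^T *m g - g *m Y + J^T *m (dg - C^T *m g - g *m C) +
    (dg - C^T *m g - g *m C) *m J = 0.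
Proof.
rewrite /skew => E Js; have /= := congr1 (mulmx C^T) Js; have /= := congr1 (mulmx^~ C) Js.
move: E; rewrite !(trmxB, trmx_mul) !(mulmxDl, mulmxDr, mulNmx, mulmxN, mulmxA, mul0mx, mulmx0).
move=> E E1 E2; apply/matrixP => i j.
have:= congr1 (fun M : 'M[R]_n => M i j) E; have:= congr1 (fun M : 'M[R]_n => M i j) E1.
have:= congr1 (fun M : 'M[R]_n => M i j) E2; rewrite !(addmxE, oppmxE) ![(0 : 'M[R]_n) i j]mxE; lra.
Qed.

Lemma skew_curvature_algebra (R : realType) n (g Cq Cr Dqr Drq : 'M[R]_n) :
  Dqr^T *m g + Cr^T *m (Cq^T *m g + g *m Cq) + ((Cq^T *m g + g *m Cq) *m Cr + g *m Dqr) =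
  Drq^T *m g + Cq^T *m (Cr^T *m g + g *m Cr) + ((Cr^T *m g + g *m Cr) *m Cq + g *m Drq) ->
  skew g (Dqr - Drq + Cq *m Cr - Cr *m Cq).
Proof.
rewrite /skew !(trmxB, trmxD, trmx_mul) !(mulmxDl, mulmxDr, mulNmx, mulmxN, mulmxA) => E.
apply/matrixP => i j; have:= congr1 (fun M : 'M[R]_n => M i j) E.
rewrite !(addmxE, oppmxE) [(0 : 'M[R]_n) i j]mxE; lra.
Qed.

(** With [S] a partial derivative of g, this says that the jacobian - g^-1 S / 2 completes a
    coordinate direction to an admissible 1-jet. *)
Lemma half_inverse_sum (R : realType) n (g S : 'M[R]_n) : g \in unitmx ->
  S + (- (2^-1 *: (S *m invmx g))) *m g + g *m (- (2^-1 *: (invmx g *m S))) = 0.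
Proof.
move=> gu; rewrite mulNmx mulmxN -scalemxAl -scalemxAr (mulKVmx gu) (mulmxKV gu).
by rewrite -addrA -opprD -scalerDr scale_half_twice subrr.
Qed.

Lemma eq_mderiv (R : realType) n p q k (X : 'rV[R]_n -> 'M[R]_(p, q)) y D D' :
  mderiv k X y D -> D = D' -> mderiv k X y D'.
Proof. by move=> XD <-. Qed.

Section Homogeneous.
Context (R : realType) (n : nat) (n_ge3 : (3 <= n)%N) (U : set 'rV[R]_n) (oU : open U).
Context (Gam : 'I_n -> 'rV[R]_n -> 'M[R]_n) (A : 'rV[R]_n -> 'M[R]_n).
Hypotheses (Gam_smooth : forall r, smx U (Gam r)) (A_smooth : smx U A).
Hypothesis Gam_sym : forall y, U y -> forall r s i, Gam r y i s = Gam s y i r.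
Hypothesis met_unit : forall y, U y -> met Gam y \in unitmx.
Implicit Types (h : 'rV[R]_n -> 'cV[R]_n) (y : 'rV[R]_n).
Local Notation g := (met Gam).
Hypothesis full : forall y, U y -> forall (h0 : 'cV[R]_n) J0,
  lc (fun k => h0 k 0) (fun k => mpartial k g y) + J0^T *m g y + g y *m J0 = 0 ->
  exists h, [/\ infinitesimal U Gam A h, h y = h0 & jac h y = J0].

Lemma isotropy y J0 : U y -> skew (g y) J0 ->
  exists h, [/\ infinitesimal U Gam A h, comp h y = (fun=> 0) & jac h y = J0].
Proof.
move=> Uy J0s; have [|h [hinf h0 hJ]] := full Uy (h0 := 0) (J0 := J0).
  rewrite (_ : (fun _ => _) = fun=> 0); last by apply/funext => k; rewrite mxE.
  by rewrite lc0 add0r.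
by exists h; split=> //; apply/funext => k; rewrite /comp h0 mxE.
Qed.

(** At a zero of the field the Lie derivative of [A] is only its commutator with the jacobian, and
    every skew jacobian occurs. *)
Lemma operator_scalar y : U y -> exists a, A y = a%:M.
Proof.
move=> Uy; apply: (commutant_scalar n_ge3 (met_sym Gam y) (met_unit Uy)) => J Js.
have [h [[_ /(_ y Uy)[_ E]] hy hJ]] := isotropy Uy Js.
by move: E; rewrite hJ hy lc0 add0r addrC => /eqP; rewrite subr_eq0 => /eqP.
Qed.

(** The Lie equation for g is differentiated once at a zero of an isotropy field. This makes the
    covariant derivative of g an invariant 3-tensor, symmetric in two slots, hence zero. *)
Lemma metric_parallel y l : U y ->
  mpartial l g y = (Gam l y)^T *m g y + g y *m Gam l y.
Proof.
move=> Uy; apply/eqP; rewrite -subr_eq0 opprD addrA; apply/eqP.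
pose T l := mpartial l g y - (Gam l y)^T *m g y - g y *m Gam l y.
apply: (invariant_form3 n_ge3 (met_sym Gam y) (met_unit Uy) (T := T)) => {l} [l|J Js l].
  rewrite /T linearB/= linearB/= !trmx_mul trmxK met_sym addrAC; congr (_ - _ - _).
  apply: esym; apply/esym.
  exact: (etrans (esym (mderivE (mderivT (smx_mderiv Uy l (met_smooth oU Gam_smooth)))))
    (congr1 (fun X => mpartial l X y) (funext (met_sym Gam)))).
have [h [hinf hy hJ]] := isotropy Uy Js.
have [hs /(_ y Uy)[/(_ l) dJ _]] := hinf.
have gs := met_smooth oU Gam_smooth.
have Js' := jac_smooth oU hs.
have dh k : is_derive y (delta_mx 0 l) (fun y => comp h y k) (jac h y k l).
  by rewrite mxE; exact: (Ck_is_derive l (hs 1%N k 0) Uy).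
have dg k := smx_mderiv Uy l (smx_mpartial oU k gs).
have D0 := mderivD (mderivD (mderiv_lc dh dg) (mderivM (mderivT (smx_mderiv Uy l Js')) (smx_mderiv Uy l gs)))
  (mderivM (smx_mderiv Uy l gs) (smx_mderiv Uy l Js')).
have D1 := mderiv_ext oU Uy (fun z Uz => lie_metric oU Gam_smooth hinf Uz) D0.
have E := mderiv_unique D1 (mderiv_cst y l 0).
move: E; rewrite dJ hJ hy !lc0 subr0 addr0.
rewrite /T -/(lc (J^~ l) _) !lcD !lcN lcMl lcMr.
have -> : lc (J^~ l) (fun k => (Gam k y)^T) = (lc (J^~ l) (Gam^~ y))^T.
  by rewrite /lc linear_sum/=; apply: eq_bigr => k _; rewrite linearZ.
by move/form3_algebra; apply.
Qed.

(** The second partial derivatives of g commute; substituting the parallel equation twice leaves the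
    curvature acting on g. *)
Lemma curvature_skew y q r : U y -> skew (g y) (K Gam q r y).
Proof.
move=> Uy; apply: skew_curvature_algebra.
have gs := met_smooth oU Gam_smooth.
have dG a b := smx_mderiv Uy a (Gam_smooth b).
have D a b : mpartial a (mpartial b g) y = _ := mderivE (mderiv_ext oU Uy
  (fun z Uz => esym (metric_parallel b Uz))
  (mderivD (mderivM (mderivT (dG a b)) (smx_mderiv Uy a gs)) (mderivM (smx_mderiv Uy a gs) (dG a b)))).
have := mpartialC oU Uy q r gs; rewrite D D (metric_parallel q Uy) (metric_parallel r Uy).
exact.
Qed.

Lemma elementary_mulE q r (X : 'M[R]_n) i s :
  ((delta_mx q 0 : 'cV[R]_n) *m (delta_mx r 0 : 'cV[R]_n)^T *m X) i s = (i == q)%:R * X r s.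
Proof.
rewrite trmx_delta mul_delta_mx mxE (bigD1 r)//= big1 => [|j jr].
  by rewrite !mxE eqxx andbT addr0.
by rewrite !mxE (negbTE jr) andbF mul0r.
Qed.

Lemma curvature_constant y q r : U y -> K Gam q r y = (n%:R - 1)^-1 *:
  ((delta_mx q 0 : 'cV[R]_n) *m (delta_mx r 0 : 'cV[R]_n)^T *m g y -
   (delta_mx r 0 : 'cV[R]_n) *m (delta_mx q 0 : 'cV[R]_n)^T *m g y).
Proof.
move=> Uy.
have [||||kap KE] := invariant_curvature n_ge3 (met_sym Gam y) (met_unit Uy) (K := fun q r => K Gam q r y).
- by move=> a b; exact: curvature_skew.
- by move=> a b; exact: (K_anti Gam a b y).
- by move=> i s a b; exact: (K_bianchi oU Gam_sym a b s i Uy).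
- move=> J Js a b; have [h [hinf hy hJ]] := isotropy Uy Js.
  have := lie_curvature oU Gam_smooth hinf a b Uy; rewrite hy hJ lc0 /lc => /esym/eqP.
  by rewrite -addrA -opprD subr_eq0 => /eqP.
rewrite KE; congr (_ *: _).
have RicE : Ric Gam y = (kap * (n%:R - 1)) *: g y.
  have entryE a b i j : K Gam a b y i j = kap * ((i == a)%:R * g y b j - (i == b)%:R * g y a j).
    by rewrite KE -!elementary_mulE -oppmxE -addmxE [LHS]mxE.
  have gs a b : g y a b = g y b a by rewrite -[in LHS](met_sym Gam y) [LHS]mxE.
  apply/matrixP => s k; rewrite [LHS]mxE [RHS]mxE.
  under eq_bigr do rewrite entryE eqxx mul1r.
  rewrite -mulr_sumr sumrB sumr_const card_ord (bigD1 k)//= big1 => [|j jk].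
    by rewrite eqxx mul1r addr0 (gs s k) -[_ *+ n]mulr_natl; ring.
  by rewrite (negbTE jk) mul0r.
have n0 : (0 < n)%N by exact: leq_trans n_ge3.
pose i0 := Ordinal n0.
have gE : g y = (kap * (n%:R - 1)) *: g y.
  by rewrite {1}/met RicE [(_ *: g y)^T]linearZ/= met_sym scale_half_twice.
have g_neq0 : g y != 0.
  apply/eqP => g0; have := mulmxV (met_unit Uy); rewrite g0 mul0mx.
  by move=> /matrixP/(_ i0 i0)/eqP; rewrite !mxE eqxx mulr1n eq_sym oner_eq0.
have n1 : (n%:R - 1 : R) != 0 by exact: natr_sub1_neq0 (ltnW n_ge3).
move/eqP: gE; rewrite -subr_eq0 -{1}[g y]scale1r -scalerBl scaler_eq0 (negbTE g_neq0) orbF.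
by rewrite subr_eq0 => /eqP E1; rewrite -[LHS](mulfK n1) -E1 mul1r.
Qed.

(** Scalar operators commute with every jacobian, so a symmetry annihilates the scalar along its own
    direction, and some symmetry passes through [y] in each coordinate direction. *)
Lemma operator_constant : boxed U -> exists a, forall y, U y -> A y = a%:M.
Proof.
move=> bU; have n0 : (0 < n)%N by exact: leq_trans n_ge3.
pose i0 := Ordinal n0.
have AE y : U y -> A y = (A y i0 i0)%:M.
  by move=> Uy; have [a ->] := operator_scalar Uy; rewrite [a%:M i0 i0]mxE eqxx mulr1n.
have [[y0 Uy0]|U0] := pselect (exists y, U y); last by exists 0 => y Uy; case: U0; exists y.
exists (A y0 i0 i0) => y Uy; rewrite (AE y Uy); congr (_%:M).
apply: (gradient0_constant (f := fun z => A z i0 i0) oU bU _ _ Uy Uy0); first exact: A_smooth.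
move=> l {Uy}y Uy.
(* Any jacobian completing the direction [l] to an admissible jet would do; this one is the solution
   with [g y *m J0] symmetric. *)
pose S := mpartial l g y; pose J0 := - (2^-1 *: (invmx (g y) *m S)).
have Ssym : S^T = S.
  exact: (etrans (esym (mderivE (mderivT (smx_mderiv Uy l (met_smooth oU Gam_smooth)))))
    (congr1 (fun X => mpartial l X y) (funext (met_sym Gam)))).
have pick p q (X : 'I_n -> 'M[R]_(p, q)) : lc (fun k => (delta_mx l 0 : 'cV[R]_n) k 0) X = X l.
  rewrite /lc (bigD1 l)//= big1 => [|k kl]; first by rewrite mxE !eqxx scale1r addr0.
  by rewrite mxE (negbTE kl) scale0r.
have [|h [[hs /(_ y Uy)[_ E]] hy hJ]] := full Uy (h0 := delta_mx l 0) (J0 := J0).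
  have -> : J0^T = - (2^-1 *: (S *m invmx (g y))).
    by rewrite /J0 linearN/= linearZ/= trmx_mul trmx_inv met_sym Ssym.
  by rewrite pick; apply: half_inverse_sum; exact: met_unit.
have Esc := AE y Uy; move: E; rewrite hJ Esc scalar_mxC addrNK /comp hy pick => /matrixP/(_ i0 i0).
by rewrite !mxE.
Qed.

(** The endomorphism is the covariant derivative [jac h] plus the contraction of Gamma with [h].
    Differentiating it produces the curvature contracted with [h], which [curvature_constant]
    expresses by [G]. *)
Lemma killing_field y0 : U y0 -> forall (h0 : 'cV[R]_n) (B0 : 'M[R]_n),
  let G := fun y => (n%:R - 1)^-1 *: g y in
  skew (G y0) B0 -> exists (h : 'rV[R]_n -> 'cV[R]_n) (B : 'rV[R]_n -> 'M[R]_n), [/\ smx U h, smx U B, h y0 = h0, B y0 = B0 &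
    forall y, U y -> skew (G y) (B y) /\ forall r,
      mderiv r h y (B y *m ebase R r - Gam r y *m h y) /\
      mderiv r B y (B y *m Gam r y - Gam r y *m B y +
        (ebase R r *m (h y)^T *m G y - h y *m (ebase R r)^T *m G y))].
Proof.
move=> Uy0 h0 B0 G B0s.
have n1 : (n%:R - 1 : R) != 0 by exact: natr_sub1_neq0 (ltnW n_ge3).
have skewG y X : skew (G y) X <-> skew (g y) X.
  rewrite /skew /G -scalemxAr -scalemxAl -scalerDr; split=> [/eqP|->]; last by rewrite scaler0.
  by rewrite scaler_eq0 invr_eq0 (negbTE n1) => /eqP.
pose LG (c : 'I_n -> R) y := lc c (Gam^~ y).
have dgE c y : U y -> lc c (fun k => mpartial k g y) = (LG c y)^T *m g y + g y *m LG c y.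
  move=> Uy; rewrite /LG -lcMl.
  have -> : (lc c (Gam^~ y))^T = lc c (fun k => (Gam k y)^T).
    by rewrite /lc linear_sum/=; apply: eq_bigr => k _; rewrite linearZ.
  by rewrite -lcMr -lcD; apply: eq_bigr => k _; rewrite metric_parallel.
pose c0 k := h0 k 0.
(* [full] prescribes the ordinary jacobian, so the connection term is subtracted in order that the
   covariant derivative at [y0] be [B0]. *)
have [|h [hinf hy hJ]] := full Uy0 (h0 := h0) (J0 := B0 - LG c0 y0).
  move/skewG: B0s; rewrite (dgE _ _ Uy0) /skew trmxB mulmxBl mulmxBr -/c0 => E.
  rewrite -[RHS]E; apply/matrixP => i j; rewrite !(addmxE, oppmxE); ring.
have hs := hinf.1; have Js := jac_smooth oU hs.
have cs k : smooth U (fun y => comp h y k) by move=> m; exact: hs.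
exists h, (fun y => jac h y + LG (comp h y) y); split=> //.
- apply: smxD => //; exact: (smx_lc oU (c := fun k y => comp h y k) cs Gam_smooth).
- by rewrite hJ /comp hy subrK.
move=> y Uy; split=> [|r].
  apply/skewG; rewrite /skew trmxD mulmxDl mulmxDr -[RHS](lie_metric oU Gam_smooth hinf Uy) (dgE _ _ Uy).
  apply/matrixP => i j; rewrite !addmxE; ring.
have dh k : is_derive y (delta_mx 0 r) (fun y => comp h y k) (jac h y k r).
  by rewrite mxE; exact: (Ck_is_derive r (hs 1%N k 0) Uy).
split.
  move=> i j; rewrite (ord1 j) mulmxDl addmxE addmxE oppmxE.
  have -> : (jac h y *m ebase R r) i 0 = jac h y i r.
    rewrite mxE (bigD1 r)//= big1 => [|k kr]; first by rewrite [ebase R r _ _]mxE !eqxx mulr1 addr0.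
    by rewrite [ebase R r _ _]mxE (negbTE kr) mulr0.
  have -> : (LG (comp h y) y *m ebase R r) i 0 = (Gam r y *m h y) i 0.
    rewrite mxE (bigD1 r)//= big1 => [|k kr]; last by rewrite [ebase R r _ _]mxE (negbTE kr) mulr0.
    rewrite [ebase R r _ _]mxE !eqxx mulr1 addr0 lcE mxE; apply: eq_bigr => k _.
    by rewrite mulrC (Gam_sym Uy k r).
  by rewrite addrK; exact: dh.
apply: (eq_mderiv (mderivD (smx_mderiv Uy r Js) (mderiv_lc dh (fun k => smx_mderiv Uy r (Gam_smooth k))))).
have [/(_ r) -> _] := hinf.2 y Uy.
have KE := curvature_constant _ _ Uy.
have E : lc (comp h y) (fun k => K Gam r k y) =
    ebase R r *m (h y)^T *m G y - h y *m (ebase R r)^T *m G y.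
  have hE : h y = \sum_k comp h y k *: ebase R k.
    apply/matrixP => i j; rewrite (ord1 j) summxE (bigD1 i)//= big1 => [|k ki].
      by rewrite !mxE !eqxx mulr1 addr0.
    by rewrite !mxE eq_sym (negbTE ki) mulr0.
  rewrite hE linear_sum/= mulmx_sumr !mulmx_suml -sumrB; apply: eq_bigr => k _.
  rewrite KE /G; move: (g y) (comp h y k) => gy c.
  rewrite [(_ *: _)^T]linearZ/= -!scalemxAr -!scalemxAl -!scalerBr !scalerA mulrC.
  by congr (_ *: _).
rewrite -E; have -> : lc (comp h y) (fun k => K Gam r k y) =
    lc (comp h y) (fun k => mpartial r (Gam k) y) - lc (comp h y) (fun k => mpartial k (Gam r) y) +
    Gam r y *m LG (comp h y) y - LG (comp h y) y *m Gam r y.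
  by rewrite -lcMl -lcMr -!lcN -!lcD.
rewrite !mulmxDl !mulmxDr; apply/matrixP => i j; rewrite !(addmxE, oppmxE) /LG; ring.
Qed.

End Homogeneous.

(** * Jets of symmetries *)

Lemma scalemxE (R : realType) p q a (M : 'M[R]_(p, q)) i j : (a *: M) i j = a * M i j.
Proof. exact: mxE. Qed.

Section Jets.
Context (R : realType) (n : nat) (g : 'M[R]_n) (dg : 'I_n -> 'M[R]_n).
Hypothesis g_unit : g \in unitmx.
Implicit Types (h : 'cV[R]_n) (J : 'M[R]_n).

Definition jet_constraint h J := lc (fun k => h k 0) dg + J^T *m g + g *m J = 0.

(** Only pairs with [p.1 <= p.2] matter: the diagonal stores the value of the field, the strict
    upper part the skew part of [g *m J]. The symmetric part is fixed by [jet_constraint]. *)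
Definition jet_coord h J (p : 'I_n * 'I_n) : R :=
  if p.1 == p.2 then h p.1 0 else (g *m J) p.1 p.2 - (g *m J) p.2 p.1.

(** Once [h] is zero the constraint makes [g *m J] skew, and the strictly upper coordinates are
    twice its entries. *)
Lemma jet_zero h J : g^T = g -> jet_constraint h J ->
  (forall p : 'I_n * 'I_n, (p.1 <= p.2)%N -> jet_coord h J p = 0) -> h = 0 /\ J = 0.
Proof.
move=> g_sym C c0; have h0 : h = 0.
  apply/matrixP => i j; rewrite (ord1 j) mxE.
  by have := c0 (i, i) (leqnn _); rewrite /jet_coord/= eqxx.
split=> //; move: C; rewrite /jet_constraint h0.
rewrite (_ : (fun _ => _) = fun=> 0); last by apply/funext => k; rewrite mxE.
rewrite lc0 add0r -{1}g_sym -trmx_mul => C.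
have sym i j : (g *m J) i j = - (g *m J) j i.
  have trE (X : 'M[R]_n) : X^T j i = X i j by rewrite mxE.
  have /matrixP/(_ j i) := C; rewrite addmxE trE [RHS]mxE; lra.
suff gJ : g *m J = 0 by rewrite -[J](mulKmx g_unit) gJ mulmx0.
have lt (i j : 'I_n) : (i < j)%N -> (g *m J) i j = 0.
  move=> ij; have := c0 (i, j) (ltnW ij); rewrite /jet_coord/=.
  case: eqP ij => [->|_ _]; first by rewrite ltnn.
  have := sym i j; lra.
apply/matrixP => i j; rewrite [RHS]mxE.
case: (ltngtP i j) => [/lt//|/lt ji|/val_inj <-]; first by rewrite sym ji oppr0.
have := sym i i; lra.
Qed.

(** The set and its mirror image cover all n^2 pairs and meet in the n diagonal ones. *)
Lemma card_le_pairs : (#|[set p : 'I_n * 'I_n | (p.1 <= p.2)%N]%SET| = (n * n.+1) %/ 2)%N.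
Proof.
set P := [set p : 'I_n * 'I_n | (p.1 <= p.2)%N]%SET.
pose sw (p : 'I_n * 'I_n) := (p.2, p.1).
have swK : involutive sw by case.
have := cardsUI P (sw @: P)%SET; rewrite (card_imset _ (inv_inj swK)).
have inS p : (p \in sw @: P)%SET = (p.2 <= p.1)%N.
  by rewrite -[p]swK (mem_imset _ _ (inv_inj swK)) inE.
have -> : (P :|: sw @: P)%SET = [set: 'I_n * 'I_n]%SET.
  by apply/setP => p; rewrite !inE inS leq_total.
have -> : (P :&: sw @: P)%SET = ((fun i : 'I_n => (i, i)) @: [set: 'I_n]%SET)%SET.
  apply/setP => -[i j]; rewrite !inE inS/= -eqn_leq; apply/idP/imsetP => [/eqP/val_inj <-|[k _ [-> ->]]//].
  by exists i; rewrite ?finset.in_setT.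
rewrite card_imset; last by move=> i j [].
rewrite !cardsT card_prod !card_ord => E.
by rewrite mulnS addnC E addnn -muln2 mulnK.
Qed.

(** The matrix [Phi] of the coordinates of the given jets is square by the dimension count and has
    independent rows, so it reaches every coordinate vector. *)
Lemma jets_full d (h : 'I_d -> 'cV[R]_n) (J : 'I_d -> 'M[R]_n) : g^T = g ->
  d = ((n * n.+1) %/ 2)%N -> (forall k, jet_constraint (h k) (J k)) ->
  (forall lam : 'I_d -> R, \sum_k lam k *: h k = 0 -> \sum_k lam k *: J k = 0 ->
     forall k, lam k = 0) ->
  forall h0 J0, jet_constraint h0 J0 ->
    exists lam : 'I_d -> R, \sum_k lam k *: h k = h0 /\ \sum_k lam k *: J k = J0.
Proof.
move=> g_sym dE C free h0 J0 C0.
have coord_comb (lam : 'I_d -> R) p : jet_coord (\sum_k lam k *: h k) (\sum_k lam k *: J k) p =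
    \sum_k lam k * jet_coord (h k) (J k) p.
  rewrite /jet_coord; case: ifP => _.
    by rewrite summxE; apply: eq_bigr => k _; rewrite mxE.
  rewrite mulmx_sumr !summxE -sumrB; apply: eq_bigr => k _.
  by rewrite -scalemxAr !scalemxE mulrBr.
have C_comb (lam : 'I_d -> R) : jet_constraint (\sum_k lam k *: h k) (\sum_k lam k *: J k).
  rewrite /jet_constraint; transitivity (\sum_k lam k *:
    (lc (fun l => h k l 0) dg + (J k)^T *m g + g *m J k)); last first.
    by rewrite big1// => k _; rewrite C scaler0.
  rewrite linear_sum/= mulmx_suml mulmx_sumr.
  have -> : lc (fun l => (\sum_k lam k *: h k) l 0) dg = \sum_k lam k *: lc (fun l => h k l 0) dg.
    rewrite /lc; under eq_bigr do rewrite summxE scaler_suml.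
    rewrite exchange_big; apply: eq_bigr => k _; rewrite scaler_sumr.
    by apply: eq_bigr => l _; rewrite mxE scalerA.
  rewrite -!big_split; apply: eq_bigr => k _ /=.
  by rewrite linearZ/= -scalemxAl -scalemxAr -!scalerDr.
set P := [set p : 'I_n * 'I_n | (p.1 <= p.2)%N]%SET.
have cardP : #|P| = d by rewrite dE card_le_pairs.
pose Phi : 'M[R]_(d, #|P|) := \matrix_(k, m) jet_coord (h k) (J k) (enum_val m).
have PhiE (u : 'rV_d) m : (u *m Phi) 0 m =
    jet_coord (\sum_k u 0 k *: h k) (\sum_k u 0 k *: J k) (enum_val m).
  by rewrite coord_comb mxE; apply: eq_bigr => k _; rewrite mxE.
have Phi_free : row_free Phi.
  apply: inj_row_free => u u0.
  have [|hz Jz] := jet_zero (h := \sum_k u 0 k *: h k) (J := \sum_k u 0 k *: J k) g_sym (C_comb _).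
    move=> p pP; have pP' : p \in P by rewrite inE.
    by rewrite -(enum_rankK_in pP' pP') -PhiE u0 mxE.
  by apply/rowP => k; rewrite mxE; apply: (free _ hz Jz).
have Phi_full : row_full Phi by apply/eqP; exact: etrans (eqP Phi_free) (esym cardP).
pose v : 'rV[R]_#|P| := \row_m jet_coord h0 J0 (enum_val m).
have /submxP[u uE] : (v <= Phi)%MS by exact: submx_full.
exists (fun k => u 0 k).
have [||hz Jz] := jet_zero (h := h0 - \sum_k u 0 k *: h k) (J := J0 - \sum_k u 0 k *: J k) g_sym.
- have Cu := C_comb (fun k => u 0 k); move: C0 Cu; rewrite /jet_constraint.
  move: (\sum_k u 0 k *: h k) (\sum_k u 0 k *: J k) => h1 J1 C0 C1.
  have -> : lc (fun k => (h0 - h1) k 0) dg = lc (fun k => h0 k 0) dg - lc (fun k => h1 k 0) dg.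
    by rewrite /lc -sumrB; apply: eq_bigr => k _; rewrite addmxE oppmxE scalerBl.
  have {C0 C1}C01 := etrans (congr2 (fun X Y => X - Y) C0 C1) (subrr 0).
  rewrite -[RHS]C01 trmxB mulmxBl mulmxBr; apply/matrixP => i j.
  rewrite !(addmxE, oppmxE); ring.
- move=> p pP; have pP' : p \in P by rewrite inE.
  have : v 0 (enum_rank_in pP' p) = (u *m Phi) 0 (enum_rank_in pP' p) by rewrite uE.
  rewrite PhiE mxE enum_rankK_in// /jet_coord; case: ifP => _.
    by rewrite addmxE oppmxE => ->; rewrite subrr.
  rewrite mulmxBr !addmxE !oppmxE; lra.
by split; apply/eqP; rewrite eq_sym -subr_eq0; apply/eqP.
Qed.

End Jets.

(** * Symmetries and parallel endomorphisms are determined locally by initial values *)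

Section Uniqueness.
Context (R : realType) (n : nat) (U : set 'rV[R]_n) (oU : open U) (y0 : 'rV[R]_n) (Uy0 : U y0).

Lemma commutator_unique m (N : 'I_n -> 'rV[R]_n -> 'M[R]_m) : (forall k, smx U (N k)) ->
  exists2 e, 0 < e & ball y0 e `<=` U /\ forall e' X x x', 0 < e' -> e' <= e ->
    smx (ball y0 e') X ->
    (forall k y, ball y0 e' y -> mderiv k X y (X y *m N k y - N k y *m X y)) ->
    ball y0 e' x -> ball y0 e' x' -> X x' = 0 -> X x = 0.
Proof.
move=> Ns; have [||e e0 [eU eq]] := linear_system_unique
  (L := fun k y (X : 'M[R]_m) => X *m N k y - N k y *m X) oU Uy0.
- move=> k y a u v /=.
  by rewrite mulmxDl mulmxDr -scalemxAl -scalemxAr opprD addrACA -scalerBr.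
- move=> k i j; have := @smxM _ _ _ oU _ _ _ (fun=> delta_mx i j) (N k) (smx_cst _ _) (Ns k).
  have := @smxM _ _ _ oU _ _ _ (N k) (fun=> delta_mx i j) (Ns k) (smx_cst _ _).
  by move=> s1 s2; have /(_ 0%N) := smxD oU s2 (smxN oU s1).
exists e => //; split=> // e' X x x' e'0 e'e Xs Xd; apply: (eq _ _ _ _ e'0 e'e (Xs 1%N)).
by move=> k y By; exact: mderivE (Xd k y By).
Qed.

(** The field and its jacobian are packed side by side in one matrix, which turns the affine
    equation into a linear system of the form treated by [linear_system_unique]. *)
Lemma infinitesimal_unique (Gam : 'I_n -> 'rV[R]_n -> 'M[R]_n) A :
  (forall r, smx U (Gam r)) ->
  exists2 e, 0 < e & ball y0 e `<=` U /\ forall e' h x x', 0 < e' -> e' <= e ->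
    infinitesimal (ball y0 e') Gam A h ->
    ball y0 e' x -> ball y0 e' x' -> h x' = 0 -> jac h x' = 0 -> h x = 0.
Proof.
move=> Gs.
(* Right multiplication by [P1], [P2] extracts the field and the jacobian; [Q1], [Q2] put them back
   in place. *)
pose P1 : 'M[R]_(1 + n, 1) := col_mx 1%:M 0; pose P2 : 'M[R]_(1 + n, n) := col_mx 0 1%:M.
pose Q1 : 'M[R]_(1, 1 + n) := row_mx 1%:M 0; pose Q2 : 'M[R]_(n, 1 + n) := row_mx 0 1%:M.
have QP11 : Q1 *m P1 = 1%:M by rewrite mul_row_col mulmx1 mul0mx addr0.
have QP12 : Q1 *m P2 = 0 by rewrite mul_row_col mulmx0 mul0mx addr0.
have QP21 : Q2 *m P1 = 0 by rewrite mul_row_col mulmx0 mul0mx addr0.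
have QP22 : Q2 *m P2 = 1%:M by rewrite mul_row_col mulmx1 mul0mx add0r.
pose L k y (Z : 'M[R]_(n, 1 + n)) := Z *m P2 *m ebase R k *m Q1 +
  (Z *m P2 *m Gam k y - Gam k y *m (Z *m P2) -
   lc (fun l => (Z *m P1) l 0) (fun l => mpartial l (Gam k) y) -
   lc (fun l => (Z *m P2) l k) (fun l => Gam l y)) *m Q2.
have lcl p q a (u v : 'I_n -> R) (X : 'I_n -> 'M[R]_(p, q)) :
    lc (fun l => a * u l + v l) X = a *: lc u X + lc v X by rewrite lcDl lcZl.
have [||e e0 [eU eq]] := linear_system_unique (L := L) oU Uy0.
- move=> k y a u v; rewrite /L.
  have E q (P : 'M[R]_(1 + n, q)) l j : ((a *: u + v) *m P) l j = a * (u *m P) l j + (v *m P) l j.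
    by rewrite mulmxDl -scalemxAl addmxE scalemxE.
  under [lc (fun l => ((a *: u + v) *m P1) l 0) _]eq_bigr do rewrite E.
  under [lc (fun l => ((a *: u + v) *m P2) l k) _]eq_bigr do rewrite E.
  rewrite -!/(lc _ _) !lcl.
  rewrite !(mulmxDl, mulmxDr, mulNmx) -!(scalemxAl, scalemxAr) !scalerDr.
  apply/matrixP => i j; rewrite !(addmxE, oppmxE, scalemxE); ring.
- move=> k i j; set D := delta_mx i j.
  suff : smx U (fun y => L k y D) by move/(_ 0%N).
  have cs p q (X : 'M[R]_(p, q)) : smx U (fun=> X) by exact: smx_cst.
  have cstf (c : 'I_n -> R) l : smooth U (fun=> c l) by move=> ?; exact: Ck_cst.
  apply: smxD => //; apply: smxM => //; apply: smxD => //; last first.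
    by apply: smxN => //; exact: (smx_lc oU (c := fun l _ => (D *m P2) l k) (cstf _) Gs).
  apply: smxD => //; last first.
    apply: smxN => //; apply: (smx_lc oU (c := fun l _ => (D *m P1) l 0) (cstf _)) => l.
    exact: (smx_mpartial oU l (Gs k)).
  apply: smxD => //; first exact: smxM.
  by apply: smxN => //; exact: smxM.
exists e => //; split=> // e' h x x' e'0 e'e hinf Bx Bx' hx' Jx'.
have oB : open (ball y0 e') by exact: ball_open.
have Js := jac_smooth oB hinf.1.
pose X y := h y *m Q1 + jac h y *m Q2.
have XP1 y : X y *m P1 = h y.
  by rewrite mulmxDl -!mulmxA QP11 QP21 mulmx1 mulmx0 addr0.
have XP2 y : X y *m P2 = jac h y.
  by rewrite mulmxDl -!mulmxA QP12 QP22 mulmx1 mulmx0 add0r.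
suff : X x = 0 by rewrite -(XP1 x) => ->; rewrite mul0mx.
apply: (eq e' X x x') => //.
- have Xs : smx (ball y0 e') X.
    by apply: smxD => //; apply: smxM => //; (exact: hinf.1 || exact: smx_cst).
  exact: (Xs 1%N).
- move=> k y By; rewrite /L XP1 XP2; apply: mderivE.
  have dh : mderiv k h y (jac h y *m ebase R k).
    move=> i j; rewrite (ord1 j) mxE (bigD1 k)//= big1 => [|l lk].
      rewrite [ebase R k _ _]mxE !eqxx mulr1 addr0 mxE.
      exact: (Ck_is_derive k (hinf.1 1%N i 0) By).
    by rewrite [ebase R k _ _]mxE (negbTE lk) mulr0.
  apply: (eq_mderiv (mderivD (mderivM dh (mderiv_cst y k Q1))
    (mderivM (smx_mderiv By k Js) (mderiv_cst y k Q2)))).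
  by rewrite !mulmx0 !addr0; have [/(_ k) -> _] := hinf.2 y By.
- by rewrite /X hx' Jx' !mul0mx addr0.
Qed.

End Uniqueness.

(** * The local normal form in one chart *)

Section Local.
Context (R : realType) (n : nat) (n_ge3 : (3 <= n)%N).
Context (Gam : 'I_n -> 'rV[R]_n -> 'M[R]_n) (A : 'rV[R]_n -> 'M[R]_n).

Lemma infinitesimal_subset (U W : set 'rV[R]_n) h : W `<=` U ->
  infinitesimal U Gam A h -> infinitesimal W Gam A h.
Proof.
move=> WU [hs hE]; split; first exact: (smx_subset WU).
by move=> y Wy; exact: hE (WU _ Wy).
Qed.

Section Combination.
Context (U : set 'rV[R]_n) (oU : open U) (d : nat) (h : 'I_d -> 'rV[R]_n -> 'cV[R]_n) (lam : 'I_d -> R).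
Hypothesis hinf : forall k, infinitesimal U Gam A (h k).

Let comb y := \sum_k lam k *: h k y.

Lemma smx_comb : smx U comb.
Proof.
apply: smx_sum => // k; apply: smxZ => //; first by move=> m; exact: Ck_cst.
exact: (hinf k).1.
Qed.

Lemma jac_comb y : U y -> jac comb y = \sum_k lam k *: jac (h k) y.
Proof.
move=> Uy; apply/matrixP => i s; rewrite mxE summxE.
have D : mderiv s comb y (\sum_k (0 *: h k y + lam k *: mpartial s (h k) y)).
  apply: mderiv_sum => k; apply: (mderivZ (is_derive_cst (lam k : R) y (delta_mx 0 s))).
  exact: (smx_mderiv Uy s (hinf k).1).
have /(congr1 (fun X : 'cV_n => X i 0)) := mderivE D.
rewrite mxE summxE => ->; apply: eq_bigr => k _.
by rewrite scale0r add0r !mxE.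
Qed.

Lemma infinitesimal_comb : infinitesimal U Gam A comb.
Proof.
split; first exact: smx_comb.
move=> y Uy; rewrite (jac_comb Uy).
have lcc p q (c : 'I_d -> 'I_n -> R) (X : 'I_n -> 'M[R]_(p, q)) c' :
    (forall l, c' l = \sum_k lam k * c k l) -> lc c' X = \sum_k lam k *: lc (c k) X.
  move=> c'E; rewrite /lc; under eq_bigr do rewrite c'E scaler_suml.
  rewrite exchange_big; apply: eq_bigr => k _; rewrite scaler_sumr.
  by apply: eq_bigr => l _; rewrite scalerA.
have combE l : comp comb y l = \sum_k lam k * comp (h k) y l.
  by rewrite /comp summxE; apply: eq_bigr => k _; rewrite mxE.
have jacE r l : (\sum_k lam k *: jac (h k) y) l r = \sum_k lam k * jac (h k) y l r.
  by rewrite summxE; apply: eq_bigr => k _; rewrite scalemxE.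
split=> [r|].
  have D : mderiv r (jac comb) y (\sum_k (0 *: jac (h k) y + lam k *: mpartial r (jac (h k)) y)).
    apply: (mderiv_ext oU Uy (fun z Uz => esym (jac_comb Uz))).
    apply: mderiv_sum => k; apply: (mderivZ (is_derive_cst (lam k : R) y (delta_mx 0 r))).
    exact: (smx_mderiv Uy r (jac_smooth oU (hinf k).1)).
  rewrite (mderivE D) mulmx_suml mulmx_sumr.
  rewrite (lcc _ _ _ _ _ combE) (lcc _ _ _ _ _ (jacE r)) -!sumrB; apply: eq_bigr => k _.
  have [/(_ r) -> _] := (hinf k).2 y Uy.
  by rewrite scale0r add0r -scalemxAl -scalemxAr -!scalerBr.
rewrite (lcc _ _ _ _ _ combE) mulmx_suml mulmx_sumr -sumrB -big_split big1// => k _ /=.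
have [_ E] := (hinf k).2 y Uy.
by rewrite -scalemxAl -scalemxAr -scalerBr -scalerDr E scaler0.
Qed.

End Combination.

(** Independence is required on every ball inside [U]: at each point the jets must be independent,
    and a combination with zero jet vanishes on a small ball only. *)
Lemma local_normal_form (U : set 'rV[R]_n) (y0 : 'rV[R]_n) d (h : 'I_d -> 'rV[R]_n -> 'cV[R]_n) :
  open U -> U y0 -> (forall r, smx U (Gam r)) -> smx U A ->
  (forall y, U y -> forall r s i, Gam r y i s = Gam s y i r) ->
  (forall y, U y -> met Gam y \in unitmx) ->
  d = ((n * n.+1) %/ 2)%N -> (forall k, infinitesimal U Gam A (h k)) ->
  (forall lam : 'I_d -> R, forall y e, 0 < e -> ball y e `<=` U ->
    (forall z, ball y e z -> \sum_k lam k *: h k z = 0) -> forall k, lam k = 0) ->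
  exists (e : R) (F : 'rV[R]_n -> 'rV[R]_n) (eps : 'I_n -> R) (a : R), [/\ 0 < e, ball y0 e `<=` U, forall i : 'I_n, eps i = 1 \/ eps i = -1 &
    [/\ forall i, smooth (ball y0 e) (fun y => F y 0 i), jacobian F y0 \in unitmx,
      forall y, ball y0 e y -> A y = a%:M &
      forall y, ball y0 e y -> normal_f eps (F y) != 0 /\ stereographic_equation (Gam^~ y) eps F y]].
Proof.
move=> oU Uy0 Gs As Gsym gu dE hinf free.
have n1 : (n%:R - 1 : R) != 0 by exact: natr_sub1_neq0 (ltnW n_ge3).
(* Rescaled to curvature one, as the cone connection requires. *)
pose G y := (n%:R - 1)^-1 *: met Gam y.
have gs := met_smooth oU Gs.
have Gms : smx U G by apply: smxZ => // m; exact: Ck_cst.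
have Ns k : smx U (cone_connection G Gam k).
  apply: smx_block => //; [exact: smx_cst|apply: smxN => //; apply: smxM => //|]; exact: smx_cst.
have [e1 e10 [e1U uniq]] := infinitesimal_unique oU Uy0 A Gs.
have [e2 e20 [e2U puniq]] := commutator_unique oU Uy0 Ns.
pose e := Num.min e1 e2.
have e0 : 0 < e by rewrite lt_min e10.
have ee1 : e <= e1 by rewrite ge_min lexx.
have ee2 : e <= e2 by rewrite ge_min lexx orbT.
have eU : ball y0 e `<=` U by move=> z /(le_ball ee1) /e1U.
have oW : open (ball y0 e) by exact: ball_open.
have By0 : ball y0 e y0 by exact: ballxx.
have hW k := infinitesimal_subset eU (hinf k).
have GsW r := smx_subset eU (Gs r).
have guW y (Wy : ball y0 e y) := gu y (eU _ Wy).
have full y : ball y0 e y -> forall (h0 : 'cV[R]_n) J0,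
    lc (fun k => h0 k 0) (fun k => mpartial k (met Gam) y) + J0^T *m met Gam y + met Gam y *m J0 = 0 ->
    exists f, [/\ infinitesimal (ball y0 e) Gam A f, f y = h0 & jac f y = J0].
  move=> Wy h0 J0 C.
  have [||lam [hE JE]] := jets_full (guW _ Wy) (met_sym Gam y) dE
      (h := fun k => h k y) (J := fun k => jac (h k) y) _ _ C.
  - by move=> k; exact: (lie_metric oW GsW (hW k) Wy).
  - move=> lam hz Jz; apply: (free lam y0 e e0 eU) => z Wz.
    apply: (uniq e (fun y => \sum_k lam k *: h k y) z y e0 ee1) => //.
      exact: infinitesimal_comb.
    by rewrite (jac_comb lam hW Wy).
  exists (fun y => \sum_k lam k *: h k y); split=> //; first exact: infinitesimal_comb.
  by rewrite (jac_comb lam hW Wy).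
have bW : boxed (ball y0 e) by exact: ball_boxed.
have [a aE] := operator_constant n_ge3 oW GsW (smx_subset eU As) guW full bW.
have Gsymm y : (G y)^T = G y by rewrite /G linearZ/= met_sym.
have Gu y : ball y0 e y -> G y \in unitmx.
  by move=> Wy; rewrite unitmxZ ?guW// unitfE invr_eq0.
have [E [eps [Eu eps1 EgE]]] := orthonormal_basis (Gsymm y0) (Gu _ By0).
have eps2 i : eps i ^+ 2 = 1 by case: (eps1 i) => ->; rewrite ?sqrrN expr1n.
have epsn0 i : eps i != 0 by case: (eps1 i) => ->; rewrite ?oppr_eq0 oner_eq0.
have [|||e' [F [/andP[e'0 e'e] Fs FJ FE]]] := stereographic (G := G) (Gam := Gam)
  (ltnW n_ge3) e0 (smx_subset eU Gms) (fun y _ => Gsymm y) Gu _ _ _ Eu epsn0 EgE eps2.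
- move=> r y Wy; apply: (eq_mderiv (mderivZ (is_derive_cst ((n%:R - 1)^-1 : R) y (delta_mx 0 r))
    (smx_mderiv (eU _ Wy) r gs))).
  rewrite (metric_parallel n_ge3 oW GsW guW full r Wy) scale0r add0r.
  by rewrite /G; move: (met Gam y) => gy; rewrite scalerDr -scalemxAl -scalemxAr.
- exact: (killing_field n_ge3 oW GsW (fun y Wy => Gsym y (eU _ Wy)) guW full By0).
- move=> X [Xs Xd] X0 y Wy; exact: (puniq e X y y0 e0 ee2 Xs Xd Wy By0 X0).
exists e', F, eps, a; split=> //; first by move=> y /(le_ball e'e) /eU.
by split=> // y /(le_ball e'e); exact: aE.
Qed.

End Local.

(** * Symmetries on the manifold *)

Section Manifold.
Context (R : realType) (n : nat) (M : smooth_manifold R n).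
Context (Gam : connection_comps M) (A : operator_comps M).
Hypotheses (Gam_connection : affine_connection Gam) (A_operator : operator_field A).
Implicit Types (c : chart R n M) (eta : vector_comps M).

Definition connection_mx c (r : 'I_n) (y : 'rV[R]_n) : 'M[R]_n := \matrix_(i, s) Gam c y i r s.

Lemma open_chart_img c : open (chart_img c).
Proof. exact: chart_img_open. Qed.
Arguments open_chart_img : clear implicits.

Lemma chart_imgP c y : chart_img c y -> chart_dom c (chart_inv c y) /\ chart_map c (chart_inv c y) = y.
Proof. by move=> [p cp <-]; rewrite chart_mapK. Qed.

Lemma chart_img_map c p : chart_dom c p -> chart_img c (chart_map c p).
Proof. by move=> cp; exists p. Qed.

Lemma connection_mx_smooth c r : atlas c -> smx (chart_img c) (connection_mx c r).
Proof.
move=> ac; apply: smx_intro => i s k.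
by apply: (Ck_ext (open_chart_img c) _ (Gam_connection.1 c ac i r s k)) => y _; rewrite mxE.
Qed.

Lemma operator_smooth c : atlas c -> smx (chart_img c) (A c).
Proof. by move=> ac; apply: smx_intro => i j; exact: A_operator.1. Qed.

Lemma mpartial_connection c r k y i s :
  mpartial k (connection_mx c r) y i s = partial k (fun z => Gam c z i r s) y.
Proof. by rewrite mxE; congr (partial _ _ y); apply/funext => z; rewrite mxE. Qed.

Lemma met_sym_ricci c y : met (connection_mx c) y = sym_ricci Gam c y.
Proof.
have E : Ric (connection_mx c) y = ricci Gam c y.
  apply/matrixP => s k; rewrite !mxE; apply: eq_bigr => r _.
  rewrite /K !(addmxE, oppmxE) !mpartial_connection /curvature -addrA; congr (_ + _).
  rewrite sumrB; congr (_ - _); rewrite mxE; apply: eq_bigr => q _; rewrite !mxE mulrC //.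
apply/matrixP => i j; rewrite /met E [RHS]mxE scalemxE addmxE; congr (_ * (_ + _)).
by rewrite mxE.
Qed.

Definition field_col eta c (y : 'rV[R]_n) : 'cV[R]_n := (eta c y)^T.

Lemma field_jac eta c y i s : jac (field_col eta c) y i s = partial s (fun z => eta c z 0 i) y.
Proof. by rewrite mxE; congr (partial _ _ y); apply/funext => z; rewrite mxE. Qed.

Lemma point_symmetry_infinitesimal eta c : point_symmetry A Gam eta -> atlas c ->
  infinitesimal (chart_img c) (connection_mx c) (A c) (field_col eta c).
Proof.
move=> [[eta_s _] eta_sym] ac; split.
  apply: smx_intro => i j k; rewrite (ord1 j).
  by apply: (Ck_ext (open_chart_img c) _ (eta_s c ac i k)) => y _; rewrite mxE.
move=> y cy; have [EA EG] := eta_sym c ac y cy.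
have cE k : comp (field_col eta c) y k = eta c y 0 k by rewrite /comp mxE.
split=> [r|]; apply/matrixP => i s; last first.
  rewrite addmxE addmxE oppmxE lcE [RHS]mxE -[RHS](EA i s) /lie_operator !big_split/= sumrN.
  congr (_ - _ + _).
  - apply: eq_bigr => k _; rewrite cE mxE; congr (_ * _).
  - by rewrite mxE; apply: eq_bigr => k _; rewrite field_jac mulrC.
  - by rewrite mxE; apply: eq_bigr => k _; rewrite field_jac.
have := EG i r s; rewrite /affine_symmetry !big_split/=.
have -> : \sum_(k < n) partial k (fun z => eta c z 0 i) y * Gam c y k r s =
    (jac (field_col eta c) y *m connection_mx c r y) i s.
  by rewrite [RHS]mxE; apply: eq_bigr => k _; rewrite field_jac [connection_mx _ _ _ _ _]mxE.
have -> : \sum_(k < n) partial k (fun z => Gam c z i r s) y * eta c y 0 k =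
    lc (comp (field_col eta c) y) (fun k => mpartial k (connection_mx c r) y) i s.
  by rewrite lcE; apply: eq_bigr => k _; rewrite mpartial_connection cE mulrC.
have -> : \sum_(k < n) Gam c y i k s * partial r (fun z => eta c z 0 k) y =
    lc (fun k => jac (field_col eta c) y k r) (fun k => connection_mx c k y) i s.
  by rewrite lcE; apply: eq_bigr => k _; rewrite field_jac [connection_mx _ _ _ _ _]mxE mulrC.
have -> : \sum_(k < n) Gam c y i r k * partial s (fun z => eta c z 0 k) y =
    (connection_mx c r y *m jac (field_col eta c) y) i s.
  by rewrite [RHS]mxE; apply: eq_bigr => k _; rewrite field_jac [connection_mx _ _ _ _ _]mxE.
have -> : partial r (partial s (fun z => eta c z 0 i)) y = mpartial r (jac (field_col eta c)) y i s.
  by rewrite [RHS]mxE; congr (partial r _ y); apply/funext => z; rewrite field_jac.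
rewrite !(addmxE, oppmxE) => ->; ring.
Qed.

Lemma transition_map c c' p : chart_dom c p -> transition c c' (chart_map c p) = chart_map c' p.
Proof. by move=> cp; rewrite /transition chart_mapK. Qed.

Section Continuation.
Context (d : nat) (e : 'I_d -> vector_comps M) (lam : 'I_d -> R).
Hypothesis e_sym : forall k, point_symmetry A Gam (e k).

Let vanish (p : M) := forall c, atlas c -> chart_dom c p ->
  \sum_k lam k *: e k c (chart_map c p) = 0.

(** Components transform linearly from chart to chart, so one chart decides whether the combination
    vanishes at [p]. *)
Lemma vanish_one_chart c p : atlas c -> chart_dom c p ->
  \sum_k lam k *: e k c (chart_map c p) = 0 -> vanish p.
Proof.
move=> ac cp E c' ac' cp'; apply/rowP => i; rewrite summxE mxE.
have ov : overlap c c' (chart_map c p) by split; [exact: chart_img_map|rewrite chart_mapK].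
under eq_bigr => k _ do rewrite scalemxE -(transition_map c' cp) ((e_sym k).1.2 c c' ac ac' _ ov i) mulr_sumr.
rewrite exchange_big big1// => l _.
have /rowP/(_ l) := E; rewrite summxE mxE => El.
transitivity (dtrans c c' i l (chart_map c p) * \sum_k (lam k *: e k c (chart_map c p)) 0 l);
  last by rewrite El mulr0.
rewrite mulr_sumr.
by apply: eq_bigr => k _; rewrite scalemxE mulrCA.
Qed.

(** The interior of the zero set is open and nonempty; it is also closed. Around a point of its
    closure, local uniqueness is started at a nearby interior zero, where the whole 1-jet
    vanishes. *)
Lemma unique_continuation c0 y0 r : connected [set: M] -> atlas c0 -> 0 < r ->
  ball y0 r `<=` chart_img c0 ->
  (forall z, ball y0 r z -> \sum_k lam k *: e k c0 z = 0) ->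
  is_lincomb lam e (fun _ _ => 0).
Proof.
move=> Mc ac0 r0 rU E0.
suff Zall : interior [set p | vanish p] = [set: M].
  move=> c ac y /[dup] cy [p cp yE]; rewrite -yE; apply: esym.
  have /interior_subset/= : interior [set p | vanish p] p by rewrite Zall.
  exact.
apply: Mc.
- exists (chart_inv c0 y0); have cy0 : chart_img c0 y0 by exact/rU/ballxx.
  have [dp mp] := chart_imgP cy0.
  have N1 : nbhs (chart_inv c0 y0) (chart_dom c0) by apply: open_nbhs_nbhs; split=> //; exact: chart_dom_open.
  have N2 : nbhs (chart_inv c0 y0) (chart_map c0 @^-1` ball y0 r).
    by apply: (chart_map_continuous dp); rewrite mp; exact: nbhsx_ballx.
  apply: filterS (filterI N1 N2) => q [dq Bq].
  exact: (vanish_one_chart ac0 dq (E0 _ Bq)).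
- by exists (interior [set p | vanish p]); [exact: open_interior|rewrite setTI].
exists (interior [set p | vanish p]); last by rewrite setTI.
move=> p pcl; have [c ac cp] := atlas_cover p.
have [eps eps0 [epsU uniq]] := infinitesimal_unique (open_chart_img c) (chart_img_map cp)
  (A c) (fun r => connection_mx_smooth r ac).
pose x0 := chart_map c p.
pose h z := \sum_k lam k *: field_col (e k) c z.
have hE z : \sum_k lam k *: e k c z = (h z)^T.
  by rewrite /h linear_sum/=; apply: eq_bigr => k _; rewrite linearZ/= trmxK.
have oB : open (ball x0 eps) by exact: ball_open.
have hinf : infinitesimal (ball x0 eps) (connection_mx c) (A c) h.
  apply: infinitesimal_comb => // k.
  exact: (infinitesimal_subset epsU (point_symmetry_infinitesimal (e_sym k) ac)).
have N1 : nbhs p (chart_dom c) by apply: open_nbhs_nbhs; split=> //; exact: chart_dom_open.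
have N2 : nbhs p (chart_map c @^-1` ball x0 eps).
  by apply: (chart_map_continuous cp); exact: nbhsx_ballx.
have [q [qZ [qc qB]]] := pcl _ (filterI N1 N2).
pose x1 := chart_map c q.
have hz : nbhs x1 [set x | h x = 0].
  have N3 : nbhs x1 (chart_img c) by apply: open_nbhs_nbhs; split; [exact: open_chart_img|exact: chart_img_map].
  have N4 : nbhs x1 (chart_inv c @^-1` [set p | vanish p]).
    apply: (chart_inv_continuous (chart_img_map qc)); rewrite chart_mapK//; exact: qZ.
  apply: filterS (filterI N3 N4) => x [cx vx].
  have [dx mx] := chart_imgP cx.
  have := vx c ac dx; rewrite mx hE => /(congr1 trmx).
  by rewrite trmxK trmx0.
have hx1 : h x1 = 0 by exact: (nbhs_singleton hz).
have Jx1 : jac h x1 = 0.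
  apply/matrixP => i s; rewrite [RHS]mxE mxE.
  rewrite (partial_open (g := fun=> 0) s (open_interior [set x | h x = 0]) hz).
    by have [_ D0] := is_derive_cst (0 : R) x1 (delta_mx 0 s); exact: D0.
  by move=> z /interior_subset/= ->; rewrite mxE.
apply: filterS (filterI N1 N2) => q' [q'c q'B].
apply: (vanish_one_chart ac q'c); rewrite hE.
by rewrite (uniq eps h (chart_map c q') x1 eps0 (lexx _) hinf q'B qB hx1 Jx1) trmx0.
Qed.

End Continuation.
End Manifold.

(** * The chart in normal form *)

Section CoordinateChange.
Context (R : realType) (n : nat) (V : set 'rV[R]_n) (F g : 'rV[R]_n -> 'rV[R]_n).
Hypotheses (oV : open V) (oFV : open (F @` V)).
Hypothesis F_smooth : forall i, smooth V (fun y => F y 0 i).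
Hypothesis g_smooth : forall i, smooth (F @` V) (fun z => g z 0 i).
Hypothesis gK : forall y, V y -> g (F y) = y.

Let V_g z : (F @` V) z -> V (g z). Proof. by move=> [y Vy <-]; rewrite gK. Qed.
Let Fg z : (F @` V) z -> F (g z) = z. Proof. by move=> [y Vy <-]; rewrite gK. Qed.
Let FV y : V y -> (F @` V) (F y). Proof. by move=> Vy; exists y. Qed.

Lemma jacobian_inverse y : V y -> jacobian g (F y) *m jacobian F y = 1%:M.
Proof.
move=> Vy; apply/matrixP => k l; rewrite [RHS]mxE mxE.
have dF m : is_derive y (delta_mx 0 l) (fun w => F w 0 m) (jacobian F y m l).
  by rewrite mxE; exact: (Ck_is_derive l (F_smooth m 1%N) Vy).
have [_ D] := is_derive_comp oFV (FV Vy) (g_smooth k 1%N) dF.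
have [_ Dc] := is_derive_coord y (delta_mx 0 l) k.
transitivity (partial l (fun w => g (F w) 0 k) y).
  by rewrite [RHS]D; apply: eq_bigr => m _; rewrite mxE.
rewrite (partial_open (g := fun w => w 0 k) l oV Vy); last by move=> z /gK ->.
by rewrite [LHS]Dc mxE eqxx.
Qed.

Lemma jacobian_inverseV z : (F @` V) z -> jacobian F (g z) *m jacobian g z = 1%:M.
Proof. by move=> [y Vy <-]; apply: mulmx1C; rewrite gK// jacobian_inverse. Qed.

Lemma jacobian_smooth (U : set 'rV[R]_n) (f : 'rV[R]_n -> 'rV[R]_n) : open U ->
  (forall i, smooth U (fun y => f y 0 i)) -> smx U (jacobian f).
Proof.
move=> oU fs; apply: smx_intro => i j k.
by apply: (Ck_ext oU _ (Ck_partial j (fs i k.+1))) => y _; rewrite mxE.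
Qed.

(** The derivative of the identity [jacobian F (g z) *m jacobian g z = 1%:M] along the r-th
    coordinate. *)
Lemma second_inverse r z : (F @` V) z ->
  (\sum_p jacobian g z p r *: mpartial p (jacobian F) (g z)) *m jacobian g z +
  jacobian F (g z) *m mpartial r (jacobian g) z = 0.
Proof.
move=> FVz.
have JFs := jacobian_smooth oV F_smooth; have Jgs := jacobian_smooth oFV g_smooth.
have dg m : is_derive z (delta_mx 0 r) (fun w => g w 0 m) (jacobian g z m r).
  by rewrite mxE; exact: (Ck_is_derive r (g_smooth m 1%N) FVz).
have D : mderiv r (fun w => jacobian F (g w)) z (\sum_p jacobian g z p r *: mpartial p (jacobian F) (g z)).
  move=> i j; apply: is_derive_eq (is_derive_comp oV (V_g FVz) (JFs 1%N i j) dg) _.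
  by rewrite summxE; apply: eq_bigr => p _; rewrite scalemxE [mpartial _ _ _ _ _]mxE mulrC.
have D0 := mderivM D (smx_mderiv FVz r Jgs).
have D1 := mderiv_ext oFV FVz (fun w => @jacobian_inverseV w) D0.
exact: mderiv_unique D1 (mderiv_cst z r 1%:M).
Qed.

(** In the new coordinates the Christoffel symbols with upper index [i] are minus the covariant
    Hessian of the i-th coordinate function, and [stereographic_equation] supplies that Hessian. *)
Lemma normal_connection (eps : 'I_n -> R) (C : 'I_n -> 'M[R]_n) y i r s : V y ->
  stereographic_equation C eps F y ->
  let f := normal_f eps (F y) in
  \sum_k partial k (fun z => F z 0 i) y *
    (\sum_p \sum_q C p k q * partial r (fun z => g z 0 p) (F y) * partial s (fun z => g z 0 q) (F y) +
     partial r (partial s (fun z => g z 0 k)) (F y)) =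
  - f^-1 * ((r == i)%:R * (eps s * F y 0 s) + eps r * F y 0 r * (s == i)%:R - F y 0 i * eps r * (r == s)%:R).
Proof.
move=> Vy ode f; pose z := F y; have FVz : (F @` V) z by exact: FV.
pose J := jacobian F y; pose H := jacobian g z.
have JE a b : partial b (fun z => F z 0 a) y = J a b by rewrite mxE.
have HE a b : partial b (fun z => g z 0 a) z = H a b by rewrite mxE.
have JH : J *m H = 1%:M by have := jacobian_inverseV FVz; rewrite gK.
pose Hs : 'M[R]_n := \matrix_(p, q) partial p (partial q (fun z => F z 0 i)) y.
pose T : 'M[R]_n := \matrix_(p, q) \sum_k C p k q * J i k.
pose D : 'M[R]_n := \matrix_(a, b) \sum_k J i k * partial a (partial b (fun z => g z 0 k)) z.
pose B : 'M[R]_n := \matrix_(m, l) ((m == i)%:R * (eps l * F y 0 l) + eps m * F y 0 m * (l == i)%:R -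
  F y 0 i * eps m * (m == l)%:R).
have dJ p k : mpartial p (jacobian F) y i k = Hs p k.
  by rewrite !mxE; congr (partial p _ y); apply/funext => w; rewrite mxE.
have dH a b k : mpartial a (jacobian g) z k b = partial a (partial b (fun z => g z 0 k)) z.
  by rewrite mxE; congr (partial a _ z); apply/funext => w; rewrite mxE.
(* Second derivatives of the inverse map: they cancel the Hessian of [F] in the transformation
   law. *)
have E2 : H^T *m Hs *m H + D = 0.
  apply/matrixP => a b; have /matrixP/(_ i b) := second_inverse a FVz; rewrite gK// => E.
  rewrite [RHS]mxE -[RHS](etrans E (mxE _ _ _ _)) !addmxE; congr (_ + _).
    rewrite [LHS]mxE [RHS]mxE; apply: eq_bigr => k _; congr (_ * _).
    rewrite mxE summxE; apply: eq_bigr => p _; rewrite scalemxE dJ; congr (_ * _).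
    by rewrite mxE.
  by rewrite [LHS]mxE [RHS]mxE; apply: eq_bigr => k _; rewrite dH.
have E1 : Hs - T = f^-1 *: (J^T *m B *m J).
  apply/matrixP => p q; rewrite addmxE oppmxE scalemxE.
  have -> : (Hs p q - T p q) = f^-1 * (\sum_m eps m * F y 0 m * (J m q * J i p + J m p * J i q) -
      F y 0 i * \sum_m eps m * J m q * J m p).
    rewrite [Hs p q]mxE [T p q]mxE; under eq_bigr do rewrite -JE.
    under [X in _ = _ * (X - _)]eq_bigr do rewrite -!JE.
    under [X in _ = _ * (_ - _ * X)]eq_bigr do rewrite -!JE.
    exact: (ode q p i).
  congr (_ * _); rewrite [RHS]mxE.
  have JB l : (J^T *m B) p l = J i p * (eps l * F y 0 l) +
      (\sum_m J m p * (eps m * F y 0 m)) * (l == i)%:R - F y 0 i * eps l * J l p.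
    rewrite [LHS]mxE.
    have bE m : J^T p m * B m l = (m == i)%:R * (J m p * (eps l * F y 0 l)) +
        J m p * (eps m * F y 0 m) * (l == i)%:R - (m == l)%:R * (F y 0 i * eps m * J m p).
      rewrite [J^T p m]mxE [B m l]mxE; ring.
    under eq_bigr do rewrite bE.
    rewrite sumrB big_split/= -mulr_suml; congr (_ + _ - _).
      exact: sum_kronecker.
    exact: sum_kronecker.
  have lE l : (J i p * (eps l * F y 0 l) + (\sum_m J m p * (eps m * F y 0 m)) * (l == i)%:R -
      F y 0 i * eps l * J l p) * J l q = eps l * F y 0 l * (J l q * J i p) +
      (l == i)%:R * ((\sum_m J m p * (eps m * F y 0 m)) * J l q) - F y 0 i * (eps l * J l q * J l p).
    move: (\sum_m _) => S; ring.
  under [RHS]eq_bigr do rewrite JB lE.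
  rewrite sumrB big_split/= -mulr_sumr; congr (_ - _).
  under eq_bigr do rewrite mulrDr.
  rewrite big_split/=; congr (_ + _).
  rewrite [RHS]sum_kronecker.
  by rewrite mulr_suml; apply: eq_bigr => m _; rewrite mulrCA mulrA.
have HJ : H^T *m J^T = 1%:M by rewrite -trmx_mul JH trmx1.
(* The left-hand side is the transformed connection. The Hessian drops out by [E2], and the
   jacobians around [B] cancel against those of the inverse. *)
have ET : H^T *m T *m H + D = - f^-1 *: B.
  have TE : T = Hs - f^-1 *: (J^T *m B *m J) by rewrite -E1 opprB addrCA subrr addr0.
  rewrite TE mulmxBr mulmxBl addrAC E2 sub0r -scalemxAr -scalemxAl !mulmxA HJ mul1mx -mulmxA JH mulmx1.
  by rewrite scaleNr.
transitivity ((- f^-1 *: B) r s); last by rewrite scalemxE [B r s]mxE.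
rewrite -ET addmxE [D r s]mxE.
have -> : (H^T *m T *m H) r s = \sum_k J i k * \sum_p \sum_q C p k q * H p r * H q s.
  transitivity (\sum_p \sum_q \sum_k J i k * (C p k q * H p r * H q s)).
    rewrite [LHS]mxE; under eq_bigr => q _ do rewrite [(H^T *m T) r q]mxE mulr_suml.
    rewrite exchange_big; apply: eq_bigr => p _; apply: eq_bigr => q _.
    rewrite [H^T r p]mxE [T p q]mxE mulr_sumr mulr_suml.
    by apply: eq_bigr => k _; ring.
  under [RHS]eq_bigr => k _ do
    (rewrite mulr_sumr; under eq_bigr => p _ do rewrite mulr_sumr).
  rewrite [RHS]exchange_big; apply: eq_bigr => p _; exact: exchange_big.
rewrite -big_split; apply: eq_bigr => k _ /=; rewrite JE -mulrDr; congr (_ * (_ + _)).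
by apply: eq_bigr => p _; apply: eq_bigr => q _; rewrite -!HE.
Qed.

End CoordinateChange.

(** Contracted with [yx] twice, the two Kronecker terms of the connection coincide, whence the
    coefficient 2 in the normal system. *)
Lemma normal_system_equiv (R : realType) n (a f : R) (eps : 'I_n -> R) (A : 'M[R]_n)
    (Gam : 'I_n -> 'I_n -> 'I_n -> R) (y : 'rV[R]_n) :
  f = normal_f eps y -> A = a%:M -> (forall i r s, Gam i r s =
    - f^-1 * ((r == i)%:R * (eps s * y 0 s) + eps r * y 0 r * (s == i)%:R - y 0 i * eps r * (r == s)%:R)) ->
  forall yt yx yxx : 'rV[R]_n, evolution_system A Gam yt yx yxx <-> normal_system a eps y yt yx yxx.
Proof.
move=> -> -> GE yt yx yxx; set w := normal_f eps y.
have E i : \sum_(j < n) (a%:M : 'M[R]_n) i j *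
      (yxx 0 j + \sum_(r < n) \sum_(s < n) Gam j r s * yx 0 r * yx 0 s) =
    a * yxx 0 i + \sum_(r < n) a * (eps r / w) * yx 0 r * (y 0 i * yx 0 r - 2 * y 0 r * yx 0 i).
  have aE j : (a%:M : 'M[R]_n) i j = a *+ (i == j) by rewrite mxE.
  rewrite (bigD1 i)//= [X in _ + X = _]big1 ?addr0; last by move=> j ji; rewrite aE eq_sym (negbTE ji) mul0r.
  rewrite aE eqxx mulr1n mulrDr; congr (_ + _).
  have inner r : \sum_(s < n) Gam i r s * yx 0 r * yx 0 s =
      - w^-1 * ((r == i)%:R * (yx 0 r * \sum_s eps s * y 0 s * yx 0 s)
        + eps r * y 0 r * yx 0 r * yx 0 i - y 0 i * eps r * yx 0 r * yx 0 r).
    have sE s : Gam i r s * yx 0 r * yx 0 s = - w^-1 * ((r == i)%:R * (yx 0 r * (eps s * y 0 s * yx 0 s))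
        + (s == i)%:R * (eps r * y 0 r * yx 0 r * yx 0 s) - (s == r)%:R * (y 0 i * eps r * yx 0 r * yx 0 s)).
      by rewrite GE [r == s]eq_sym; ring.
    under eq_bigr do rewrite sE.
    rewrite -mulr_sumr sumrB big_split/= -!mulr_sumr; congr (_ * (_ + _ - _)).
      exact: sum_kronecker.
    exact: sum_kronecker.
  under eq_bigr do rewrite inner.
  rewrite -mulr_sumr sumrB big_split/=.
  have -> : \sum_(r < n) (r == i)%:R * (yx 0 r * \sum_s eps s * y 0 s * yx 0 s) =
      \sum_s eps s * y 0 s * yx 0 s * yx 0 i.
    rewrite [LHS]sum_kronecker.
    by rewrite mulr_sumr; apply: eq_bigr => s _; rewrite mulrC.
  rewrite -big_split -sumrB !mulr_sumr; apply: eq_bigr => r _ /=; ring.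
by rewrite /evolution_system /normal_system; split=> H i; rewrite H E.
Qed.

Section Manifold.
Context (R : realType) (n : nat) (M : smooth_manifold R n).
Implicit Types (c : chart R n M).

Lemma smooth_row_continuous (U : set 'rV[R]_n) (f : 'rV[R]_n -> 'rV[R]_n) y :
  (forall i, smooth U (fun y => f y 0 i)) -> U y -> {for y, continuous f}.
Proof. by move=> fs Uy; apply: row_continuous => i; have [+ _] := fs i 0%N; exact. Qed.

Lemma open_overlap c c' : open (overlap c c').
Proof.
rewrite openE => y [cy c'y]; apply: filterI.
  by apply: open_nbhs_nbhs; split=> //; exact: open_chart_img.
by apply: (chart_inv_continuous cy); apply: open_nbhs_nbhs; split=> //; exact: chart_dom_open.
Qed.

(** * The chart obtained from a local diffeomorphism of the coordinate domain *)

Section NewChart.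
Context (c0 : chart R n M) (V : set 'rV[R]_n) (F g : 'rV[R]_n -> 'rV[R]_n).
Hypotheses (oV : open V) (Vc : V `<=` chart_img c0) (oFV : open (F @` V)).
Hypothesis F_smooth : forall i, smooth V (fun y => F y 0 i).
Hypothesis g_smooth : forall i, smooth (F @` V) (fun z => g z 0 i).
Hypothesis gK : forall y, V y -> g (F y) = y.

Let V_g z : (F @` V) z -> V (g z). Proof. by move=> [y Vy <-]; rewrite gK. Qed.
Let FV y : V y -> (F @` V) (F y). Proof. by move=> Vy; exists y. Qed.

Lemma new_chart : exists c : chart R n M,
  [/\ chart_dom c = [set q | chart_dom c0 q /\ V (chart_map c0 q)],
      chart_map c = (fun q => F (chart_map c0 q)) &
      chart_inv c = (fun z => chart_inv c0 (g z))].
Proof.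
pose dom := [set q | chart_dom c0 q /\ V (chart_map c0 q)].
pose map q := F (chart_map c0 q); pose inv z := chart_inv c0 (g z).
have domo : open dom.
  rewrite openE => q [cq Vq]; apply: filterI.
    by apply: open_nbhs_nbhs; split=> //; exact: chart_dom_open.
  by apply: (chart_map_continuous cq); apply: open_nbhs_nbhs.
have img : map @` dom = F @` V.
  apply/seteqP; split=> [z [q [cq Vq] <-]|z [y Vy <-]]; first exact: FV.
  have [dy my] := chart_imgP (Vc Vy).
  by exists (chart_inv c0 y); [split; rewrite ?my|rewrite /map my].
have imgo : open (map @` dom) by rewrite img.
have mapK p : dom p -> inv (map p) = p by move=> [cp Vp]; rewrite /inv gK// chart_mapK.
have mapc p : dom p -> {for p, continuous map}.
  move=> [cp Vp]; apply: continuous_comp; first exact: chart_map_continuous.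
  exact: smooth_row_continuous F_smooth Vp.
have invc z : (map @` dom) z -> {for z, continuous inv}.
  rewrite img => FVz; apply: continuous_comp; first exact: smooth_row_continuous g_smooth FVz.
  by apply: chart_inv_continuous; exact: Vc (V_g FVz).
by exists (Chart domo imgo mapK mapc invc).
Qed.

Context (c : chart R n M).
Hypothesis domE : chart_dom c = [set q | chart_dom c0 q /\ V (chart_map c0 q)].
Hypothesis mapE : chart_map c = (fun q => F (chart_map c0 q)).
Hypothesis invE : chart_inv c = (fun z => chart_inv c0 (g z)).

Lemma new_chart_img : chart_img c = F @` V.
Proof.
rewrite /chart_img domE mapE; apply/seteqP; split=> [z [q [cq Vq] <-]|z [y Vy <-]]; first exact: FV.
by have [dy my] := chart_imgP (Vc Vy); exists (chart_inv c0 y); [split; rewrite ?my|rewrite my].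
Qed.

(** By maximality compatibility is enough: the transitions are those of [c0] composed with [F] or
    with [g], both smooth. *)
Lemma new_chart_atlas : atlas c0 -> atlas c.
Proof.
move=> ac0; apply: atlas_maximal => c' ac' i.
have comp0 := atlas_compatible ac0 ac'.
split=> k.
  apply: (Ck_ext (@open_overlap c c') (f := fun z => transition c0 c' (g z) 0 i)).
    by move=> z _; rewrite /transition invE.
  apply: (Ck_comp (@open_overlap c0 c') (@open_overlap c c') _ ((comp0 i).1 k)).
    move=> z [cz]; rewrite invE => dz; split=> //.
    by move: cz; rewrite new_chart_img => /V_g /Vc.
  move=> j; apply: (Ck_subset _ (g_smooth j k)) => z [+ _].
  by rewrite new_chart_img.
have sub : overlap c' c `<=` overlap c' c0.
  by move=> z [cz]; rewrite domE => -[dz _].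
apply: (Ck_ext (@open_overlap c' c) (f := fun z => F (transition c' c0 z) 0 i)).
  by move=> z _; rewrite /transition mapE.
apply: (Ck_comp oV (@open_overlap c' c) _ (F_smooth i k)).
  by move=> z [cz]; rewrite domE => -[].
by move=> j; exact: (Ck_subset sub ((comp0 j).2 k)).
Qed.

Lemma new_dtrans i k y : V y -> dtrans c0 c i k y = partial k (fun z => F z 0 i) y.
Proof.
move=> Vy; apply: (partial_open k oV Vy) => z Vz; rewrite /transition mapE.
by have [_ ->] := chart_imgP (Vc Vz).
Qed.

Lemma new_dtransV i k z : (F @` V) z -> dtrans c c0 i k z = partial k (fun z => g z 0 i) z.
Proof.
move=> FVz; apply: (partial_open k oFV FVz) => w /V_g/Vc gw; rewrite /transition invE.
by have [_ ->] := chart_imgP gw.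
Qed.

Lemma new_overlap y : V y -> overlap c0 c y.
Proof.
move=> Vy; have [dy my] := chart_imgP (Vc Vy); split; first exact: Vc.
by rewrite domE; split; rewrite ?my.
Qed.

Lemma new_transition y : V y -> transition c0 c y = F y.
Proof. by move=> Vy; have [_ my] := chart_imgP (Vc Vy); rewrite /transition mapE my. Qed.

Lemma new_operator (A : operator_comps M) a y : operator_field A -> atlas c0 -> atlas c -> V y ->
  A c0 y = a%:M -> A c (F y) = a%:M.
Proof.
move=> [_ Atr] ac0 ac Vy Aa; apply/matrixP => i j.
rewrite -(new_transition Vy) (Atr c0 c ac0 ac y (new_overlap Vy)) (new_transition Vy) Aa.
transitivity ((jacobian F y *m a%:M *m jacobian g (F y)) i j); last first.
  by rewrite scalar_mxC -mulmxA (mulmx1C (jacobian_inverse oV oFV F_smooth g_smooth gK Vy)) mulmx1.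
rewrite [RHS]mxE exchange_big; apply: eq_bigr => l _; rewrite [(_ *m a%:M) i l]mxE mulr_suml.
apply: eq_bigr => k _; rewrite (new_dtrans _ _ Vy) new_dtransV; last exact: FV.
by rewrite [jacobian F y i k]mxE [jacobian g _ l j]mxE.
Qed.

Lemma new_connection (Gam : connection_comps M) i r s y : affine_connection Gam ->
  atlas c0 -> atlas c -> V y -> Gam c (F y) i r s =
  \sum_k partial k (fun z => F z 0 i) y *
    (\sum_p \sum_q Gam c0 y k p q * partial r (fun z => g z 0 p) (F y) * partial s (fun z => g z 0 q) (F y) +
     partial r (partial s (fun z => g z 0 k)) (F y)).
Proof.
move=> [_ Gtr] ac0 ac Vy.
have := Gtr c0 c ac0 ac y (new_overlap Vy) i r s; rewrite (new_transition Vy) => ->.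
apply: eq_bigr => k _; apply: (congr2 *%R (new_dtrans i k Vy)); apply: congr2.
  apply: eq_bigr => p _; apply: eq_bigr => q _.
  by rewrite !new_dtransV//; exact: FV.
by apply: (partial_open r oFV (FV Vy)) => z FVz; exact: new_dtransV.
Qed.

End NewChart.
End Manifold.

Theorem theorem22p2 (R : realType) (n : nat) (n_ge3 : (3 <= n)%N)
  (M : smooth_manifold R n) (M_connected : connected [set: M])
  (Gam : connection_comps M) (Gam_connection : affine_connection Gam)
  (Gam_symmetric : symmetric_connection Gam)
  (A : operator_comps M) (A_operator : operator_field A)
  (A_nondegenerate : nondegenerate_operator A)
  (Gam_general : general_position Gam)
  (dimG : has_dim (point_symmetry A Gam) ((n * n.+1) %/ 2)) :
  forall p : M, exists c : chart R n M, [/\ atlas c, chart_dom c p &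
    exists (a : R) (eps : 'I_n -> R),
      (forall i, eps i = 1 \/ eps i = -1) /\
      forall y, chart_img c y ->
        normal_f eps y != 0 /\
        forall yt yx yxx : 'rV[R]_n,
          evolution_system (A c y) (Gam c y) yt yx yxx <->
          normal_system a eps y yt yx yxx].
Proof.
move=> p; have [c0 ac0 cp] := atlas_cover p.
have [e [e_sym e_free _]] := dimG.
have c0p := chart_img_map cp.
have [|||r [F [eps [a [r0 rU eps1 [Fs FJ Aa ode]]]]]] := local_normal_form n_ge3
  (h := fun k => field_col (e k) c0) (@open_chart_img _ _ _ c0) c0p
  (fun r => connection_mx_smooth Gam_connection r ac0) (operator_smooth A_operator ac0)
  _ _ (erefl _) (fun k => point_symmetry_infinitesimal (e_sym k) ac0).
- by move=> y cy k l i; rewrite !mxE; exact: (Gam_symmetric c0 ac0 y cy).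
- by move=> y cy; rewrite met_sym_ricci; exact: (Gam_general.2 c0 ac0 y cy).
(* A relation on one ball continues to all of [M], where the basis admits none. *)
- move=> lam y r r0 rU hz; apply: e_free.
  apply: (unique_continuation Gam_connection e_sym M_connected ac0 r0 rU) => z Bz.
  have /(congr1 trmx) := hz z Bz; rewrite linear_sum trmx0 => E; rewrite -[RHS]E.
  by apply: eq_bigr => k _; rewrite [RHS]linearZ/= trmxK.
have By0 : ball (chart_map c0 p) r (chart_map c0 p) by exact: ballxx.
have oB : open (ball (chart_map c0 p) r) by exact: ball_open.
(* [F] is a diffeomorphism only near the point, so the new chart lives on the smaller set [V]. *)
have [V [g [oV Vy0 Vr oFV [gK _ gs]]]] := inverse_function oB By0 Fs FJ.
have Vc : V `<=` chart_img c0 by move=> y /Vr/rU.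
have FsV i : smooth V (fun y => F y 0 i) by move=> k; exact: Ck_subset Vr (Fs i k).
have [c [domE mapE invE]] := new_chart oV Vc oFV FsV gs gK.
have ac := new_chart_atlas oV Vc FsV gs gK domE mapE invE ac0.
exists c; split=> //; first by rewrite domE.
exists a, eps; split=> // z; rewrite (new_chart_img Vc domE mapE) => -[y Vy <-].
have [f0 odeE] := ode y (Vr _ Vy); split=> //.
apply: normal_system_equiv => //.
  exact: (new_operator oV Vc oFV FsV gs gK domE mapE invE A_operator ac0 ac Vy (Aa y (Vr _ Vy))).
move=> i q s; rewrite (new_connection oV Vc oFV gK domE mapE invE i q s Gam_connection ac0 ac Vy).
rewrite -(normal_connection oV oFV FsV gs gK i q s Vy odeE); apply: eq_bigr => k _.
by congr (_ * (_ + _)); apply: eq_bigr => u _; apply: eq_bigr => v _; rewrite mxE.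
Qed.
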